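(* Let $p>1/2$ and consider the two-bin balls-in-bins process with feedback function $f(x)=x^p$. Let $\mathrm{ELead}$ be the event that the first bin eventually leads the process. Then for every fixed $\alpha\in(0,1/2)$ the limit $$c_p(\alpha)=\lim_{t\to+\infty}\frac{\ln \mathbf{Pr}_{[t,\alpha]}(\mathrm{ELead})}{t}$$ exists and is a strictly negative real number, and $c_p$ is a smooth function of $\alpha$ satisfying $c_p'(\alpha)>0$ on $(0,1/2)$. Moreover, for any $\delta\in(0,1/2)$ there exist $C_\delta\in[0,+\infty)$ and $T_\delta\in\mathbb{N}$ such that for all $\alpha\in(\delta,1/2-\delta)$ and all integers $t\geq T_\delta$, $$e^{c_p(\alpha)\,t-C_\delta\,t^{2/3}}\leq \mathbf{Pr}_{[t,\alpha]}(\mathrm{ELead})\leq e^{c_p(\alpha)\,t+C_\delta}.$$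
   Context: $\mathbb{N}=\{1,2,3,\dots\}$. The two-bin balls-in-bins process with feedback function $f:\mathbb{N}\to(0,\infty)$ is the discrete-time Markov chain $\{(I_m(1),I_m(2))\}_{m\ge 0}$ on $\mathbb{N}^2$ in which, at each time $m\geq 1$, exactly one bin $i_m\in\{1,2\}$ receives a ball (its count increases by $1$ and the other count is unchanged), and, conditionally on the past, bin $i$ is chosen with probability $f(I_{m-1}(i))/\big(f(I_{m-1}(1))+f(I_{m-1}(2))\big)$. For $u\in\mathbb{N}^2$, $\mathbf{Pr}_u$ denotes probability when the initial state is $(I_0(1),I_0(2))=u$. For $t\in\mathbb{N}$ and $\alpha\in[0,1]$, $[t,\alpha]$ denotes the state $(\lceil\alpha t\rceil,\,t-\lceil\alpha t\rceil)$. The event that bin $1$ eventually leads is $\mathrm{ELead}=\{\exists m\geq 0\ \forall M\geq m:\ I_M(1)>I_M(2)\}$. *)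

(* Defs.v *)
From HB Require Import structures.
From mathcomp Require Import all_boot all_order all_algebra.
From mathcomp Require Import all_classical all_reals all_analysis.
Import Order.TTheory GRing.Theory Num.Theory.
Import numFieldNormedType.Exports.

Set Implicit Arguments.
Unset Strict Implicit.
Unset Printing Implicit Defensive.

Local Open Scope classical_set_scope.
Local Open Scope ring_scope.

(* A state is the pair of ball counts of the bins. *)

Definition bins_transition (R : realType) (f : nat -> R) (x y : nat * nat) : R :=
  if y == (x.1.+1, x.2) then f x.1 / (f x.1 + f x.2)
  else if y == (x.1, x.2.+1) then f x.2 / (f x.1 + f x.2)
  else 0.

Definition history (T : Type) (I : nat -> T -> nat * nat) (m : nat)
    (h : nat -> nat * nat) : set T :=
  [set w | forall k, (k <= m)%N -> I k w = h k].

(* The conditional law of the next state given the past is stated in product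
   form, P (A `&` B) = P A * P (B | A), so that null histories need no separate
   treatment. *)
Record balls_in_bins (R : realType) (d : measure_display)
    (T : measurableType d) (f : nat -> R) (P : probability T R)
    (I : nat -> T -> nat * nat) (u : nat * nat) : Prop := BallsInBins {
  bins_measurable : forall m, measurable_fun setT (I m) ;
  bins_init : P [set w | I 0%N w = u] = 1%E ;
  bins_next : forall (m : nat) (h : nat -> nat * nat) (y : nat * nat),
    P (history I m h `&` [set w | I m.+1 w = y]) =
    (P (history I m h) * (bins_transition f (h m) y)%:E)%E
}.

Definition ELead (T : Type) (I : nat -> T -> nat * nat) : set T :=
  [set w | exists m, forall M, (m <= M)%N -> ((I M w).2 < (I M w).1)%N].

(* The state [t, a]. For a in [0, 1] the ceiling is nonnegative and at most t,
   so neither the absolute value nor the truncated subtraction alters it. *)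
Definition split_state (R : realType) (t : nat) (a : R) : nat * nat :=
  let k := `|Num.ceil (a * t%:R)|%N in (k, (t - k)%N).

(* C^infinity on the open interval ]a, b[; the iterated derivatives at a point
   of the interval depend only on the values of g near that point. *)
Definition smooth_on_oo (R : realType) (a b : R) (g : R -> R) : Prop :=
  forall (n : nat) (x : R), a < x < b -> derivable (derive1n n g) x 1.

(* Main.v *)
Require Import Defs.
From HB Require Import structures.
From mathcomp Require Import all_boot all_order all_algebra.
From mathcomp Require Import all_classical all_reals all_analysis.
From mathcomp Require Import measurable_realfun ring lra zify.
Import Order.TTheory GRing.Theory Num.Theory.
Import numFieldNormedType.Exports.

(** Let [f j = j^p]. In the exponential embedding bin 1 needs a time
    [Exp(f x) + Exp(f (x + 1)) + ...] to go from [x] to many balls, and it leads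
    eventually when its time up to a distant horizon is shorter than that of bin 2. The
    Chernoff bound for this event has a discrete counterpart without embedding: for a tilt [lam < f y], the product of
    the factors [1 + lam / f j] for [j < x] and [1 - lam / f j] for [j < y] is harmonic
    for the chain at [(x, y)] ([harmonic_one_step]). Normalised at a horizon [n] it is at
    least one wherever bin 1 is not behind, so optional stopping bounds the probability
    that bin 1 ever catches up ([stay_behind_ge], [ELead_upper]).

    The lower bound compares three nearby tilts instead of changing the measure. Let
    [M1], [M2], [M3] be the harmonic functions of [lam1 < lam2 < lam3]. A state on the
    horizon either has no clear lead of bin 1, and then [M2 <= 2 * M1]; or its lead is so
    large that [M3] dominates [M2]; or the value of [M2] is bounded
    ([harmonic_trichotomy]). If [M1] is small against [M2] at the initial state, and [M3]
    not too large, averaging shows that a lead of [sqrt n] is reached with probability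
    at least the initial value of [M2] up to a subexponential factor ([ELead_lower]), and
    such a lead is kept forever with probability bounded below, because the variances
    [1 / f j ^ 2] are summable ([stay_ahead_big_lead]).

    It remains to evaluate the harmonic functions. With [lam = (t / z)^p], comparing the
    sums with integrals gives [t * tilt_exponent al z + O(1)] for the logarithm at the
    state of [t] balls and fraction [al] ([log_harmonic_upper], [log_harmonic_lower]). The
    derivative of the exponent in [z] vanishes exactly when [a = al z] and
    [b = (1 - al) z] satisfy [lag_clock b = lead_clock a], that is, when the solutions of
    [a' = a^p + 1] and [b' = b^p - 1] merge at infinity. For [0 < al < 1 / 2] there is
    exactly one such [z] ([clock_defect_root], [clock_defect_root_uniq]), it is the
    minimum of the exponent, and there the exponent reduces to
    [rate al = al ln (1 + a^(- p)) + (1 - al) ln (1 - b^(- p))].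

    Since [(a, b)] moves along a solution curve of an explicit differential equation, its
    derivative in [al] is an elementary expression in [a] and [b]; the elementary expressions
    are closed under differentiation, so [rate] is smooth ([rate_smooth]). By
    the envelope principle its derivative is [ln (1 + a^(- p)) - ln (1 - b^(- p)) > 0]
    ([rate_der]), and it is negative since the exponent increases from its minimum to a
    limit that is at most zero ([rate_lt0]).

    The minimum is quadratic, uniformly for [al] in compact subsets ([uniform_well]).
    Changing [z] by a factor [1 - e] therefore changes the exponent by a multiple of
    [t e^2], which has to be large, while the lower bound loses a multiple of [t e]. The
    choice [e = t^(-1/3)] gives the error [t^(2/3)] ([lead_lower]). The optimal tilt
    itself gives the upper bound with error [O(1)] ([lead_upper]), and rounding the
    initial state to integers also costs [O(1)] ([rate_shift]). *)

Set Implicit Arguments.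
Unset Strict Implicit.
Unset Printing Implicit Defensive.

Local Open Scope classical_set_scope.
Local Open Scope ring_scope.

(** * Derivatives and the mean value theorem *)

Section Toolkit.
Context {R : realType}.
Implicit Types (f g df : R -> R) (x a b u : R).

Lemma has_der_eq f x d d' : is_derive x 1 f d -> d = d' -> is_derive x 1 f d'.
Proof. by move=> H <-. Qed.

Lemma has_der_cst (c x : R) : is_derive x 1 (fun _ : R => c) 0.
Proof. exact: is_derive_cst. Qed.

Lemma has_der_id x : is_derive x 1 (fun t : R => t) 1.
Proof. exact: is_derive_id. Qed.

Lemma has_der_add f g x a b : is_derive x 1 f a -> is_derive x 1 g b ->
  is_derive x 1 (fun t => f t + g t) (a + b).
Proof. by move=> ? ?; apply: is_deriveD. Qed.

Lemma has_der_sub f g x a b : is_derive x 1 f a -> is_derive x 1 g b ->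
  is_derive x 1 (fun t => f t - g t) (a - b).
Proof. by move=> ? ?; apply: is_deriveB. Qed.

Lemma has_der_opp f x a : is_derive x 1 f a -> is_derive x 1 (fun t => - f t) (- a).
Proof. by move=> ?; apply: is_deriveN. Qed.

Lemma has_der_mul f g x a b : is_derive x 1 f a -> is_derive x 1 g b ->
  is_derive x 1 (fun t => f t * g t) (a * g x + f x * b).
Proof.
move=> hf hg; have H := @is_deriveM R R f g x 1 a b hf hg.
by apply: (has_der_eq H); rewrite /GRing.scale /= addrC mulrC.
Qed.

Lemma has_der_scale f c x a : is_derive x 1 f a ->
  is_derive x 1 (fun t => c * f t) (c * a).
Proof.
by move=> H; apply: (has_der_eq (has_der_mul (has_der_cst c x) H)); rewrite mul0r add0r.
Qed.

Lemma has_der_inv f x a : is_derive x 1 f a -> f x != 0 ->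
  is_derive x 1 (fun t => (f t)^-1) (- a / f x ^+ 2).
Proof.
move=> H f0; apply: (has_der_eq (is_deriveV f0 H)).
by rewrite /GRing.scale /=; field.
Qed.

Lemma has_der_comp f g x a b : is_derive x 1 g b -> is_derive (g x) 1 f a ->
  is_derive x 1 (fun t => f (g t)) (a * b).
Proof. by move=> ? ?; apply: is_derive1_comp. Qed.

Lemma has_der_pow f x a s : is_derive x 1 f a -> 0 < f x ->
  is_derive x 1 (fun t => f t `^ s) (s * f x `^ (s - 1) * a).
Proof. move=> H f0; exact: (has_der_comp H (is_derive1_powR s f0)). Qed.

Lemma has_der_ln f x a : is_derive x 1 f a -> 0 < f x ->
  is_derive x 1 (fun t => ln (f t)) (a / f x).
Proof.
move=> H f0; apply: (has_der_eq (has_der_comp H (is_derive1_ln f0))).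
by rewrite mulrC.
Qed.

Lemma has_der_continuous f x a : is_derive x 1 f a -> {for x, continuous f}.
Proof. by move=> [H _]; apply: differentiable_continuous; apply/derivable1_diffP. Qed.

Lemma has_der_within f df a b : (forall x, a <= x <= b -> is_derive x 1 f (df x)) ->
  {within `[a, b], continuous f}.
Proof.
move=> H; apply: derivable_within_continuous => x.
by rewrite in_itv /= => /H [].
Qed.

Lemma mvt f df a b : a < b -> (forall x, a <= x <= b -> is_derive x 1 f (df x)) ->
  exists c, a < c < b /\ f b - f a = df c * (b - a).
Proof.
move=> ab H; have [] := @MVT R f df a b ab.
- by move=> x; rewrite in_itv /= => /andP[h1 h2]; apply: H; rewrite !ltW.
- exact: has_der_within H.
- by move=> c; rewrite in_itv /= => ? ?; exists c.
Qed.

Lemma has_der_lt f df a b : a < b -> (forall x, a <= x <= b -> is_derive x 1 f (df x)) ->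
  (forall x, a < x < b -> 0 < df x) -> f a < f b.
Proof.
move=> ab H H0; have [c [cab e]] := mvt ab H.
by rewrite -subr_gt0 e mulr_gt0 ?H0 ?subr_gt0.
Qed.

Lemma has_der_le f df a b : a <= b -> (forall x, a <= x <= b -> is_derive x 1 f (df x)) ->
  (forall x, a < x < b -> 0 <= df x) -> f a <= f b.
Proof.
rewrite le_eqVlt => /orP[/eqP-> //|ab] H H0; have [c [cab e]] := mvt ab H.
by rewrite -subr_ge0 e mulr_ge0 ?H0 ?subr_ge0 ?ltW.
Qed.

Lemma ivt f df a b v : a <= b -> (forall x, a <= x <= b -> is_derive x 1 f (df x)) ->
  f a <= v <= f b -> exists c, a <= c <= b /\ f c = v.
Proof.
move=> ab H /andP[h1 h2].
have [||c + ?] := @IVT R f a b v ab; first exact: has_der_within H.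
  rewrite /Order.min /Order.max; case: ltP => h; first by rewrite h1 h2.
  have e : f a = f b by apply/eqP; rewrite eq_le h (le_trans h1 h2).
  by rewrite -{1}e h1 e h2.
by rewrite in_itv /= => ?; exists c.
Qed.

Lemma has_der_integral g x u (C : R) : 0 < x -> x < u -> measurable_fun `[0, u] g ->
  (forall y, 0 <= y <= u -> `|g y| <= C) -> {for x, continuous g} ->
  is_derive x 1 (fun y => \int[lebesgue_measure]_(t in `[0, y]) g t) (g x).
Proof.
move=> x0 xu mg gC cg.
have ig : (@lebesgue_measure R).-integrable `[0, u] (EFin \o g).
  apply: measurable_bounded_integrable => //.
    by rewrite /= (@lebesgue_measure_itv R `[0, u]) /= lte_fin (lt_trans x0 xu) -EFinB ltry.
  exists C; split; first by rewrite num_real.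
  move=> M CM y; rewrite /= in_itv /= => h; exact: (le_trans (gC y h) (ltW CM)).
have [h1 h2] := continuous_FTC1_closed xu ig x0 cg.
by apply: DeriveDef; [exact: h1|rewrite -derive1E; exact: h2].
Qed.

End Toolkit.

(** * The law of the chain *)

Section Chain.
Context {R : realType}.
Implicit Types (f : nat -> R) (g : nat * nat -> R) (s : nat * nat) (A : nat -> pred (nat * nat)).

Definition one_step f g s : R :=
  (f s.1 * g (s.1.+1, s.2) + f s.2 * g (s.1, s.2.+1)) / (f s.1 + f s.2).

(** The recursion satisfied by the probability of staying in the sets [A 0, ..., A m].
    The sets move with time so that constraints starting at a later time are covered. *)
Fixpoint stay_prob f (A : nat -> pred (nat * nat)) (m : nat) s : R :=
  if A 0%N s then
    if m is m'.+1 then one_step f (stay_prob f (fun k => A k.+1) m') s else 1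
  else 0.

Section Law.
Context {d : measure_display} {T : measurableType d} {f : nat -> R}.
Context {P : probability T R} {I : nat -> T -> nat * nat} {u : nat * nat}.
Hypothesis f_gt0 : forall n, (0 < n)%N -> 0 < f n.
Hypothesis chain : balls_in_bins f P I u.
Hypotheses (u1 : (0 < u.1)%N) (u2 : (0 < u.2)%N).

Local Notation pr X := (fine (P X)).

Lemma measurable_event k (Q : set (nat * nat)) : measurable [set w | Q (I k w)].
Proof.
have mQ : measurable Q.
  apply: countable_measurable; last exact: countableP.
  move=> [a b]; rewrite (_ : [set (a, b)] = [set a] `*` [set b]).
    exact: measurableX.
  by apply/seteqP; split => [[x y] /= [-> ->] //|[x y] /= [-> ->]].
by rewrite -[X in measurable X]setTI; exact: (bins_measurable chain).
Qed.

Lemma measurable_future m j (Q : nat -> set (nat * nat)) :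
  measurable [set w | forall k, (k <= m)%N -> Q k (I (j + k)%N w)].
Proof.
rewrite (_ : mkset _ =
   \bigcap_(k in [set k | (k <= m)%N]) [set w | Q k (I (j + k)%N w)]).
  by apply: bigcap_measurableType => k _; exact: measurable_event.
by apply/seteqP; split => w /= h k; exact: h.
Qed.

Lemma measurable_history m h : measurable (history I m h).
Proof. exact: (measurable_future m 0 (fun k => [set h k])). Qed.

Lemma prE X : measurable X -> P X = (pr X)%:E.
Proof. by move=> mX; rewrite fineK // fin_num_measure. Qed.

Lemma pr_split X Y : measurable X -> measurable Y ->
  pr X = pr (X `&` Y) + pr (X `\` Y).
Proof.
move=> mX mY; apply: EFin_inj; rewrite EFinD -!prE //.
- by rewrite (measureDI P mX mY) addeC.
- exact: measurableD.
- exact: measurableI.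
Qed.

Lemma pr_le X Y : measurable X -> measurable Y -> X `<=` Y -> pr X <= pr Y.
Proof.
by move=> mX mY XY; rewrite -lee_fin -!prE //; apply: le_measure; rewrite ?inE.
Qed.

Lemma pr_ge0 X : 0 <= pr X.
Proof. by rewrite fine_ge0. Qed.

Lemma pr_next m h y :
  pr (history I m h `&` [set w | I m.+1 w = y]) =
  pr (history I m h) * bins_transition f (h m) y.
Proof.
apply: EFin_inj; rewrite EFinM -!prE.
- exact: (bins_next chain).
- exact: measurable_history.
- apply: measurableI; first exact: measurable_history.
  exact: (measurable_event m.+1 [set y]).
Qed.

Lemma history_extend m h s :
  history I m h `&` [set w | I m.+1 w = s] =
  history I m.+1 (fun k => if k == m.+1 then s else h k).
Proof.
apply/seteqP; split => w /=.
  move=> [H1 H2] k; case: eqP => [-> //|kn] km; apply: H1.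
  by rewrite leq_eqVlt in km; case/orP: km => // /eqP.
move=> H; split; last by have := H m.+1 (leqnn _); rewrite eqxx.
by move=> k km; have := H k (leqW km); rewrite ltn_eqF.
Qed.

(** Conditioning on the history up to time [j], the process restarts from the
    present state; the two transition weights sum to one, so all other jumps
    form a null set. *)
Lemma pr_future m A j h : (0 < (h j).1)%N -> (0 < (h j).2)%N ->
  pr (history I j h `&` [set w | forall k, (k <= m)%N -> A k (I (j + k)%N w)]) =
  pr (history I j h) * stay_prob f A m (h j).
Proof.
elim: m A j h => [|m IH] A j h h1 h2.
  rewrite /=; case: ifP => [Ah|/negbT Ah].
    rewrite mulr1; congr (fine (P _)); apply/seteqP; split => w /=; first by case.
    move=> H; split=> // k; rewrite leqn0 => /eqP->.
    by rewrite addn0 (H j).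
  rewrite mulr0 (_ : _ `&` _ = set0) ?measure0 //.
  apply/seteqP; split => w //= [H /(_ 0%N isT)]; rewrite addn0 (H j) //.
  by move/negP : Ah.
rewrite [stay_prob _ _ _ _]/=; case: ifP => [Ah|/negbT Ah]; last first.
  rewrite mulr0 (_ : _ `&` _ = set0) ?measure0 //.
  apply/seteqP; split => w //= [H /(_ 0%N isT)]; rewrite addn0 (H j) //.
  by move/negP : Ah.
set H := history I j h; set A' := fun k => A k.+1.
set E := [set w | forall k, (k <= m)%N -> A' k (I (j.+1 + k)%N w)].
have -> : H `&` [set w | forall k, (k <= m.+1)%N -> A k (I (j + k)%N w)] = H `&` E.
  apply/seteqP; split => w /= [wH wE]; split => //.
    by move=> k km; have := wE k.+1 km; rewrite addnS.
  case=> [_|k]; first by rewrite addn0 (wH j).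
  by rewrite ltnS addnS => km; exact: wE.
set s1 := ((h j).1.+1, (h j).2); set s2 := ((h j).1, (h j).2.+1).
set S1 := [set w | I j.+1 w = s1]; set S2 := [set w | I j.+1 w = s2].
have mH : measurable H by exact: measurable_history.
have mE : measurable E by exact: (measurable_future m j.+1 (fun k => [set s | A' k s])).
have mS1 : measurable S1 by exact: (measurable_event j.+1 [set s1]).
have mS2 : measurable S2 by exact: (measurable_event j.+1 [set s2]).
have s12 : s2 == s1 = false.
  by apply/eqP => -[/n_Sn].
have fs : 0 < f (h j).1 + f (h j).2 by rewrite addr_gt0 // f_gt0.
have D2 : S2 `\` S1 = S2.
  apply/seteqP; split => w /=; first by case.
  by move=> e2; split => // e1; move: s12; rewrite -e1 -e2 eqxx.
have t1 : bins_transition f (h j) s1 = f (h j).1 / (f (h j).1 + f (h j).2).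
  by rewrite /bins_transition eqxx.
have t2 : bins_transition f (h j) s2 = f (h j).2 / (f (h j).1 + f (h j).2).
  by rewrite /bins_transition s12 eqxx.
have null : pr ((H `\` S1) `\` S2) = 0.
  have e1 := pr_split mH mS1.
  have e2 := pr_split (measurableD mH mS1) mS2.
  have e3 : (H `\` S1) `&` S2 = H `&` S2 by rewrite setIDAC D2.
  rewrite e3 !pr_next t1 t2 -/H in e1 e2.
  have e4 : f (h j).1 / (f (h j).1 + f (h j).2) +
            f (h j).2 / (f (h j).1 + f (h j).2) = 1.
    by rewrite -mulrDl divff // gt_eqF.
  have e5 := congr1 (fun t => pr H * t) e4; rewrite mulrDr mulr1 in e5.
  lra.
have branch s : (s == s1) || (s == s2) ->
    pr (H `&` [set w | I j.+1 w = s] `&` E) =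
    pr H * bins_transition f (h j) s * stay_prob f A' m s.
  move=> ss; rewrite -pr_next history_extend.
  set h' := (fun k => if _ then _ else _).
  have h's : h' j.+1 = s by rewrite /h' eqxx.
  by rewrite IH h's //; case/orP: ss => /eqP->.
rewrite (pr_split (measurableI _ _ mH mE) mS1).
rewrite (pr_split (measurableD (measurableI _ _ mH mE) mS1) mS2).
have -> : H `&` E `&` S1 = H `&` S1 `&` E by rewrite setIAC.
have -> : ((H `&` E) `\` S1) `&` S2 = H `&` S2 `&` E.
  by rewrite setIDAC D2 setIAC.
have -> : pr (((H `&` E) `\` S1) `\` S2) = 0.
  apply/eqP; rewrite eq_le pr_ge0 andbT -null; apply: pr_le.
  - by do 2 apply: measurableD => //; exact: measurableI.
  - by do 2 apply: measurableD => //.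
  - by move=> w /= [[[? ?] ?] ?].
rewrite !branch ?eqxx ?orbT // t1 t2 /one_step /= addr0.
by field; rewrite gt_eqF.
Qed.

Lemma pr_stay m A :
  pr [set w | forall k, (k <= m)%N -> A k (I k w)] = stay_prob f A m u.
Proof.
have H0 : pr (history I 0 (fun=> u)) = 1.
  have -> : history I 0 (fun=> u) = [set w | I 0%N w = u].
    apply/seteqP; split => w /=; first by move=> H; exact: H.
    by move=> H k; rewrite leqn0 => /eqP->.
  by rewrite (bins_init chain).
have := @pr_future m A 0 (fun=> u) u1 u2; rewrite H0 mul1r => <-.
set H := history _ _ _; set E := mkset _.
have mH : measurable H by exact: measurable_history.
have mE : measurable E by exact: (measurable_future m 0 (fun k => [set s | A k s])).
rewrite (pr_split mE mH) setIC; set X := E `\` H.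
suff -> : pr X = 0 by rewrite addr0.
apply/eqP; rewrite eq_le pr_ge0 andbT.
have -> : 0 = pr (~` H).
  by apply: EFin_inj; rewrite -(prE (measurableC mH)) probability_setC // (prE mH) H0 subee.
apply: pr_le; [exact: measurableD|exact: measurableC|].
by move=> w [].
Qed.

(** The events of staying up to time [m] decrease to that of staying forever, so a
    bound uniform in [m] passes to the limit. *)
Lemma pr_stay_forever A v : (forall m, v <= stay_prob f A m u) ->
  v <= pr [set w | forall k, A k (I k w)].
Proof.
move=> Hv.
pose F m := [set w | forall k, (k <= m)%N -> A k (I k w)].
have mF m : measurable (F m).
  exact: (measurable_future m 0 (fun k => [set s | A k s])).
have FE : [set w | forall k, A k (I k w)] = \bigcap_m F m.
  apply/seteqP; split => w /=; first by move=> H m _ k _; exact: H.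
  by move=> H k; exact: (H k Logic.I k (leqnn _)).
have mFF : measurable (\bigcap_m F m) by apply: bigcap_measurableType.
have nF : nonincreasing_seq F.
  move=> m n mn; apply/subsetPset => w H k km; apply: H.
  exact: leq_trans km mn.
have Fo : (P (F 0%N) < +oo)%E by rewrite prE // ltry.
have /fine_cvgP[_ cv] : P \o F @ \oo --> (pr (\bigcap_m F m))%:E.
  by rewrite -prE //; exact: nonincreasing_cvg_mu.
rewrite FE; rewrite -(cvg_lim (@Rhausdorff R) cv); apply: limr_ge.
  by apply/cvg_ex; exists (pr (\bigcap_m F m)).
by apply: nearW => m; rewrite /= pr_stay.
Qed.

Lemma measurable_ELead : measurable (ELead I).
Proof.
have -> : ELead I = \bigcup_m \bigcap_(M in [set M | (m <= M)%N])
    [set w | ((I M w).2 < (I M w).1)%N].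
  apply/seteqP; split => w /= [m H]; first by exists m => // M /= ?; exact: H.
  by move=> H2; exists m => M ?; exact: H2.
apply: bigcupT_measurable => m; apply: bigcap_measurableType => M _.
exact: (measurable_event M [set s | (s.2 < s.1)%N]).
Qed.

Lemma ELead_ge A v : (forall m, v <= stay_prob f A m u) ->
  (exists N, forall k s, (N <= k)%N -> A k s -> (s.2 < s.1)%N) ->
  v <= pr (ELead I).
Proof.
move=> /pr_stay_forever Hv [N HN]; apply: (le_trans Hv).
apply: pr_le => //; last by move=> w /= H; exists N => M NM; apply: (HN M) => //; exact: H.
  rewrite (_ : mkset _ = \bigcap_k [set w | A k (I k w)]).
    by apply: bigcap_measurableType => k _; exact: (measurable_event _ [set s | A k s]).
  by apply/seteqP; split => w /= H k; [move=> _|]; exact: H.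
exact: measurable_ELead.
Qed.

(** Bin 1 cannot lead eventually if it is behind at all times; the complement of the
    latter event is what optional stopping bounds. *)
Lemma ELead_le v : (forall m, 1 - v <= stay_prob f (fun _ s => (s.1 < s.2)%N) m u) ->
  pr (ELead I) <= v.
Proof.
move=> /pr_stay_forever; set X := mkset _ => Hv.
have mX : measurable X.
  rewrite /X (_ : mkset _ = \bigcap_k [set w | ((I k w).1 < (I k w).2)%N]).
    by apply: bigcap_measurableType => k _; exact: (measurable_event _ [set s | (s.1 < s.2)%N]).
  by apply/seteqP; split => w /= H k; [move=> _|]; exact: H.
have := @pr_le (ELead I) (~` X) measurable_ELead (measurableC mX).
have -> : pr (~` X) = 1 - pr X.
  by apply: EFin_inj; rewrite EFinB -(prE mX) -(prE (measurableC mX)) probability_setC.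
have -> : (ELead I `<=` ~` X) <-> True.
  split=> // _ w [m H] /(_ m); have := H m (leqnn _).
  by move=> h1 h2; have := ltn_trans h1 h2; rewrite ltnn.
by move=> /(_ Logic.I); lra.
Qed.

End Law.
End Chain.

(** * Elementary bounds for the logarithm *)

Section LnBounds.
Context {R : realType}.
Implicit Types x y v w : R.

Lemma ln_le_sub1 w : 0 < w -> ln w <= w - 1.
Proof. by move=> w0; rewrite -{1}[w](subrKC 1); apply: le_ln1Dx; lra. Qed.

Lemma ln_ge_1sub_inv w : 0 < w -> 1 - w^-1 <= ln w.
Proof.
move=> w0; have := ln_le_sub1 (_ : 0 < w^-1); rewrite invr_gt0 => /(_ w0).
by rewrite lnV ?posrE //; lra.
Qed.

Lemma ln_1D_ge w : 0 <= w <= 1 -> w / 2 <= ln (1 + w).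
Proof.
move=> /andP[w0 w1]; apply: le_trans (ln_ge_1sub_inv (_ : 0 < 1 + w)); last lra.
rewrite -subr_ge0 (_ : _ - _ = w * (1 - w) / (2 * (1 + w))); last by field; lra.
by rewrite divr_ge0 ?mulr_ge0 //; lra.
Qed.

Lemma Nln_1B_le v : 0 <= v <= 1 / 2 -> - ln (1 - v) <= 2 * v.
Proof.
move=> /andP[v0 v1]; have := ln_ge_1sub_inv (_ : 0 < 1 - v) => /(_ ltac:(lra)) h.
suff : 1 - 2 * v <= 2 - (1 - v)^-1 by lra.
rewrite -subr_ge0 (_ : _ - _ = v * (1 - 2 * v) / (1 - v)); last by field; lra.
by rewrite divr_ge0 ?mulr_ge0 //; lra.
Qed.

End LnBounds.

(** * Exponential harmonic functions *)

Section Harmonic.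
Context {R : realType}.
Variable f : nat -> R.
Hypothesis f_gt0 : forall n, (0 < n)%N -> 0 < f n.
Implicit Types (g h : nat * nat -> R) (s : nat * nat) (lam mu : R).

Lemma one_step_le g h s : (0 < s.1)%N -> (0 < s.2)%N ->
  g (s.1.+1, s.2) <= h (s.1.+1, s.2) -> g (s.1, s.2.+1) <= h (s.1, s.2.+1) ->
  one_step f g s <= one_step f h s.
Proof.
move=> s1 s2 h1 h2; have f1 := f_gt0 s1; have f2 := f_gt0 s2.
rewrite /one_step ler_pM2r ?invr_gt0 ?addr_gt0 //.
by apply: lerD; rewrite ler_pM2l.
Qed.

Lemma one_step_cstB c g s : (0 < s.1)%N -> (0 < s.2)%N ->
  one_step f (fun s => c - g s) s = c - one_step f g s.
Proof.
move=> /f_gt0 s1 /f_gt0 s2; rewrite /one_step; field.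
by rewrite gt_eqF // addr_gt0.
Qed.

(** The terms [1 + mu / f j] come from the exponential embedding: a clock of rate
    [f j] has exponential moment [E e^(- mu X) = 1 / (1 + mu / f j)]. *)
Definition log_sum n mu k : R := \sum_(k <= j < n) ln (1 + mu / f j).

(** The logarithm of the product of the exponential moments of the times that the two
    bins need to reach [n] balls, at [lam] for bin 1 and [- lam] for bin 2. Stopping
    at a horizon [n] instead of infinity changes the product by a factor that does
    not depend on the state, and keeps it finite for every [p]. *)
Definition log_harmonic n lam s : R := - (log_sum n lam s.1 + log_sum n (- lam) s.2).

Definition harmonic_fun n lam s : R := expR (log_harmonic n lam s).

Lemma log_sumS n mu k : (k < n)%N ->
  log_sum n mu k = ln (1 + mu / f k) + log_sum n mu k.+1.
Proof. by move=> kn; rewrite /log_sum big_ltn. Qed.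

Lemma log_sum_split n mu k l : (k <= l <= n)%N ->
  log_sum n mu k = log_sum l mu k + log_sum n mu l.
Proof. by move=> /andP[kl ln]; rewrite /log_sum (big_cat_nat kl ln). Qed.

(** A ball in bin 1 multiplies the function by [1 + lam / f x], a ball in bin 2 by
    [1 - lam / f y]; weighted by [f x] and [f y], the contributions [lam] and
    [- lam] cancel. *)
Lemma harmonic_one_step n lam s : (0 < s.1 < n)%N -> (0 < s.2 < n)%N ->
  0 <= lam < f s.2 -> one_step f (harmonic_fun n lam) s = harmonic_fun n lam s.
Proof.
move=> /andP[s1 s1n] /andP[s2 s2n] /andP[l0 ls].
have f1 := f_gt0 s1; have f2 := f_gt0 s2.
have A0 : 0 < 1 + lam / f s.1 by rewrite ltr_pwDl // divr_ge0 // ltW.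
have B0 : 0 < 1 + - lam / f s.2.
  by rewrite mulNr subr_gt0 ltr_pdivrMr // mul1r.
rewrite /one_step /harmonic_fun /log_harmonic /= (log_sumS lam s1n) (log_sumS (- lam) s2n).
set X := log_sum _ _ _; set Y := log_sum _ _ _.
have -> : - (X + (ln (1 + - lam / f s.2) + Y)) =
   - (ln (1 + lam / f s.1) + X + (ln (1 + - lam / f s.2) + Y)) + ln (1 + lam / f s.1) by ring.
have -> : - (ln (1 + lam / f s.1) + X + Y) =
   - (ln (1 + lam / f s.1) + X + (ln (1 + - lam / f s.2) + Y)) + ln (1 + - lam / f s.2) by ring.
rewrite !(expRD _ (ln _)) !lnK ?posrE //.
by field; rewrite !gt_eqF // addr_gt0.
Qed.

Lemma ln_mulC1 lam j : 0 <= lam < f j ->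
  ln (1 + lam / f j) + ln (1 + - lam / f j) = ln (1 - (lam / f j) ^+ 2).
Proof.
move=> /andP[l0 lf]; have f0 : 0 < f j by exact: le_lt_trans lf.
have h : lam / f j < 1 by rewrite ltr_pdivrMr ?mul1r.
have h0 : 0 <= lam / f j by rewrite divr_ge0 // ltW.
rewrite mulNr -lnM ?posrE; [congr ln; ring|lra|lra].
Qed.

(** On the common range the factors for [lam] and [- lam] pair up to
    [1 - (lam / f j)^2], so when bin 1 is ahead every term is nonnegative. *)
Lemma log_harmonic_ahead n lam s : 0 <= lam -> (s.2 <= s.1 <= n)%N ->
  (forall j, (s.2 <= j)%N -> lam < f j) ->
  log_harmonic n lam s = \sum_(s.2 <= j < s.1) ln (1 + lam / f j) +
     \sum_(s.2 <= j < n) - ln (1 - (lam / f j) ^+ 2).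
Proof.
move=> l0 /andP[s21 s1n] lf; rewrite /log_harmonic.
have := @log_sum_split n lam s.2 s.1; rewrite s21 s1n => /(_ isT) e.
rewrite sumrN -[X in _ = _ - X](_ : log_sum n lam s.2 + log_sum n (- lam) s.2 = _).
  by rewrite e /log_sum; ring.
rewrite /log_sum -big_split /=; apply: eq_big_nat => j /andP[h _].
by rewrite ln_mulC1 // l0 lf.
Qed.

Lemma log_harmonic_behind n lam s : 0 <= lam -> (s.1 <= s.2 <= n)%N ->
  (forall j, (s.2 <= j)%N -> lam < f j) ->
  log_harmonic n lam s = - \sum_(s.1 <= j < s.2) ln (1 + lam / f j) +
     \sum_(s.2 <= j < n) - ln (1 - (lam / f j) ^+ 2).
Proof.
move=> l0 s12n lf; rewrite /log_harmonic (log_sum_split _ s12n).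
rewrite sumrN -[X in _ = _ - X](_ : log_sum n lam s.2 + log_sum n (- lam) s.2 = _).
  by rewrite /log_sum; ring.
rewrite /log_sum -big_split /=; apply: eq_big_nat => j /andP[h _].
by rewrite ln_mulC1 // l0 lf.
Qed.

Lemma Nln_1Bsqr_ge0 lam j : 0 <= lam < f j -> 0 <= - ln (1 - (lam / f j) ^+ 2).
Proof.
move=> /andP[l0 lf]; have f0 : 0 < f j by exact: le_lt_trans lf.
have h : lam / f j < 1 by rewrite ltr_pdivrMr ?mul1r.
have h0 : 0 <= lam / f j by rewrite divr_ge0 // ltW.
have : (lam / f j) ^+ 2 < 1 by rewrite expr_lt1.
have : 0 <= (lam / f j) ^+ 2 by rewrite sqr_ge0.
by move=> a b; rewrite oppr_ge0; apply: ln_le0; lra.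
Qed.

Lemma log_harmonic_ge0 n lam s : 0 <= lam -> (s.2 <= s.1 <= n)%N -> (0 < s.2)%N ->
  (forall j, (s.2 <= j)%N -> lam < f j) -> 0 <= log_harmonic n lam s.
Proof.
move=> l0 sn s2 lf; rewrite log_harmonic_ahead //; apply: addr_ge0.
  rewrite big_nat_cond; apply: sumr_ge0 => j /andP[/andP[h _] _].
  apply: ln_ge0; rewrite lerDl divr_ge0 // ltW // f_gt0 //.
  exact: leq_trans h.
rewrite big_nat_cond; apply: sumr_ge0 => j /andP[/andP[h _] _].
by apply: Nln_1Bsqr_ge0; rewrite l0 lf.
Qed.

Lemma harmonic_ge1 n lam s : 0 <= lam -> (s.2 <= s.1 <= n)%N -> (0 < s.2)%N ->
  (forall j, (s.2 <= j)%N -> lam < f j) -> 1 <= harmonic_fun n lam s.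
Proof. by move=> *; rewrite -expR0 ler_expR log_harmonic_ge0. Qed.

(** Optional stopping: the harmonic function is at least one where bin 1 is not
    behind, hence it dominates the probability of ever reaching that set. *)
Lemma stay_behind_ge n lam m s : 0 <= lam -> (0 < s.1)%N -> (0 < s.2)%N ->
  (s.1 + s.2 + m < n)%N -> (forall j, (s.2 <= j)%N -> lam < f j) ->
  1 - harmonic_fun n lam s <= stay_prob f (fun _ s => s.1 < s.2)%N m s.
Proof.
move=> l0; elim: m s => [|m IH] s s1 s2 sn lf.
  rewrite /=; case: ifP => [_|/negbT].
    by rewrite gerBl expR_ge0.
  rewrite -leqNgt => s21; rewrite subr_le0; apply: harmonic_ge1 => //.
  by rewrite s21; lia.
rewrite /=; case: ifP => [s12|/negbT]; last first.
  rewrite -leqNgt => s21; rewrite subr_le0; apply: harmonic_ge1 => //.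
  by rewrite s21; lia.
rewrite -harmonic_one_step; first last.
- by rewrite l0 lf.
- by rewrite s2; lia.
- by rewrite s1; lia.
rewrite -one_step_cstB //; apply: one_step_le => //; apply: IH => //=; try lia.
by move=> j hj; apply: lf; apply: ltnW.
Qed.

Definition swap_state s : nat * nat := (s.2, s.1).

Lemma one_step_swap g s :
  one_step f g s = one_step f (fun s => g (swap_state s)) (swap_state s).
Proof. by rewrite /one_step /= [in RHS]addrC (addrC (f s.2)). Qed.

Lemma eq_one_step g h s : g =1 h -> one_step f g s = one_step f h s.
Proof. by move=> e; rewrite /one_step !e. Qed.

Lemma stay_prob_swap A m s :
  stay_prob f A m s = stay_prob f (fun k s => A k (swap_state s)) m (swap_state s).
Proof.
elim: m A s => [|m IH] A [x y] //=.
case: ifP => // _; rewrite one_step_swap; apply: eq_one_step => -[a b].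
exact: IH.
Qed.

(** The chain is symmetric under exchange of the bins, so the bound for bin 1 staying
    behind also bounds the probability that a leading bin 1 is caught. *)
Lemma stay_ahead_ge n lam m s : 0 <= lam -> (0 < s.1)%N -> (0 < s.2)%N ->
  (s.1 + s.2 + m < n)%N -> (forall j, (s.1 <= j)%N -> lam < f j) ->
  1 - harmonic_fun n lam (swap_state s) <= stay_prob f (fun _ s => s.2 < s.1)%N m s.
Proof.
move=> *; rewrite stay_prob_swap; apply: stay_behind_ge => //=.
by rewrite (addnC s.2).
Qed.

Lemma stay_probS A m s : stay_prob f A m.+1 s =
  if A 0%N s then one_step f (stay_prob f (fun k => A k.+1) m) s else 0.
Proof. by []. Qed.

Lemma stay_probS_le A m s : (0 < s.1)%N -> (0 < s.2)%N ->
  stay_prob f A m.+1 s <= stay_prob f A m s.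
Proof.
elim: m A s => [|m IH] A s s1 s2.
  rewrite /=; case: ifP => // _; have f1 := f_gt0 s1; have f2 := f_gt0 s2.
  rewrite /one_step ler_pdivrMr ?addr_gt0 // mul1r; apply: lerD.
    by rewrite ler_piMr ?(ltW f1) //; case: ifP.
  by rewrite ler_piMr ?(ltW f2) //; case: ifP.
rewrite (stay_probS A m.+1) (stay_probS A m); case: ifP => // _.
by apply: one_step_le => //; exact: (IH (fun k => A k.+1)).
Qed.

Lemma stay_prob_le A m k s : (0 < s.1)%N -> (0 < s.2)%N ->
  stay_prob f A (k + m) s <= stay_prob f A m s.
Proof.
move=> s1 s2; elim: k => [//|k IH]; apply: le_trans IH.
by rewrite addSn; exact: stay_probS_le.
Qed.

Definition mean N g s := iter N (one_step f) g s.

Lemma mean_le N g h s : (0 < s.1)%N -> (0 < s.2)%N ->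
  (forall s', (s.1 <= s'.1)%N -> (s.2 <= s'.2)%N ->
     (s'.1 + s'.2 = s.1 + s.2 + N)%N -> g s' <= h s') ->
  mean N g s <= mean N h s.
Proof.
elim: N s => [|N IH] s s1 s2 gh; first by apply: gh => //; rewrite addn0.
rewrite /mean /=; apply: one_step_le => //; apply: IH => //= s' h1 h2 e;
 apply: gh; lia.
Qed.

Lemma meanD N g h s : (0 < s.1)%N -> (0 < s.2)%N ->
  mean N (fun s => g s + h s) s = mean N g s + mean N h s.
Proof.
rewrite /mean; elim: N s => [//|N IH] s s1 s2; rewrite /= {1}/one_step !IH //.
rewrite /one_step; field; rewrite gt_eqF // addr_gt0 ?f_gt0 //.
Qed.

Lemma meanZ N c g s : (0 < s.1)%N -> (0 < s.2)%N ->
  mean N (fun s => c * g s) s = c * mean N g s.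
Proof.
rewrite /mean; elim: N s => [//|N IH] s s1 s2; rewrite /= {1}/one_step !IH //.
rewrite /one_step; field; rewrite gt_eqF // addr_gt0 ?f_gt0 //.
Qed.

Lemma mean_harmonic N n lam s : (0 < s.1)%N -> (0 < s.2)%N -> (s.1 + s.2 + N <= n)%N ->
  0 <= lam -> (forall j, (s.2 <= j)%N -> lam < f j) ->
  mean N (harmonic_fun n lam) s = harmonic_fun n lam s.
Proof.
rewrite /mean; move=> + + + l0.
elim: N s => [//|N IH] s s1 s2 sn lf; rewrite /= {1}/one_step.
rewrite !IH //=; try lia; last by move=> j hj; apply: lf; exact: ltnW.
rewrite -[RHS]harmonic_one_step ?s1 ?s2 ?l0 ?lf //=; lia.
Qed.

(** Waiting for the state at time [N] and then never losing the lead is an event of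
    the form treated by [stay_prob], with no constraint before [N]. *)
Definition lead_from N (G : pred (nat * nat)) : nat -> pred (nat * nat) := fun k s =>
  if (k < N)%N then true else if k == N then G s else (s.2 < s.1)%N.

Lemma stay_lead_from N G m s :
  stay_prob f (lead_from N G) (N + m) s = mean N (stay_prob f (lead_from 0 G) m) s.
Proof.
rewrite /mean; elim: N s => [//|N IH] s.
by rewrite addSn /=; apply: eq_one_step => s'; exact: IH.
Qed.

Lemma stay_lead_from0 (G : pred (nat * nat)) m s : (G s -> (s.2 < s.1)%N) ->
  stay_prob f (lead_from 0 G) m s =
  if G s then stay_prob f (fun _ s => s.2 < s.1)%N m s else 0.
Proof.
by move=> GS; case: m => [|m] /=; rewrite /lead_from /=; case: ifP => // /GS ->.
Qed.

End Harmonic.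

(** * Dependence of the harmonic functions on the tilt *)

Section Compare.
Context {R : realType}.
Variable f : nat -> R.
Hypothesis f_gt0 : forall n, (0 < n)%N -> 0 < f n.

(** Each term gains at least half of the relative increase of the tilt:
    the slope of [ln (1 + x)] is at least one half for [x <= 1], and
    [- ln (1 - (lam / f j)^2)] is convex in the tilt. *)
Lemma log_harmonic_growth n (lam lam' : R) s :
  0 < lam -> lam < lam' -> (s.2 <= s.1 <= n)%N ->
  (forall j, (s.2 <= j)%N -> lam' < f j) ->
  (lam' - lam) / (2 * lam) * log_harmonic f n lam s <=
  log_harmonic f n lam' s - log_harmonic f n lam s.
Proof.
move=> l0 ll s21 lf.
have l'0 : 0 < lam' by exact: lt_trans ll.
have lf' j : (s.2 <= j)%N -> lam < f j by move=> /lf; exact: lt_trans.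
rewrite !log_harmonic_ahead // ?(ltW l0) ?(ltW l'0) //.
rewrite [leRHS](_ : _ =
  (\sum_(s.2 <= j < s.1) (ln (1 + lam' / f j) - ln (1 + lam / f j))) +
  (\sum_(s.2 <= j < n) (- ln (1 - (lam' / f j) ^+ 2) - - ln (1 - (lam / f j) ^+ 2)))); last first.
  by rewrite !sumrB; ring.
rewrite mulrDr !mulr_sumr; apply: lerD; apply: ler_sum_nat => j /andP[yj _].
  have F := lf _ yj; have F' := lf' _ yj; set F0 := f j in F F' *.
  have F00 : 0 < F0 by lra.
  rewrite -ln_div ?posrE; [|by rewrite addr_gt0 ?divr_gt0|by rewrite addr_gt0 ?divr_gt0].
  apply: (@le_trans _ _ ((lam' - lam) / (2 * lam) * (lam / F0))).
    apply: ler_wpM2l; first by rewrite divr_ge0; lra.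
    by apply: (le_trans (ln_le_sub1 _)); rewrite ?addr_gt0 ?divr_gt0 // addrAC subrr add0r.
  apply: le_trans (ln_ge_1sub_inv _); last by rewrite !(divr_gt0, addr_gt0).
  rewrite -subr_ge0 (_ : _ - _ = (lam' - lam) * (F0 - lam') / (2 * F0 * (F0 + lam'))).
    by rewrite divr_ge0 ?mulr_ge0 //; lra.
  by field; rewrite !gt_eqF //; lra.
have F := lf _ yj; have F' := lf' _ yj; set F0 := f j in F F' *.
have F00 : 0 < F0 by lra.
have P1 : 0 < F0 ^+ 2 - lam ^+ 2 by rewrite subr_gt0 ltrXn2r // ?nnegrE; lra.
have P2 : 0 < F0 ^+ 2 - lam' ^+ 2 by rewrite subr_gt0 ltrXn2r // ?nnegrE; lra.
have E1 : 1 - (lam / F0) ^+ 2 = (F0 ^+ 2 - lam ^+ 2) / F0 ^+ 2 by field; rewrite gt_eqF.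
have E2 : 1 - (lam' / F0) ^+ 2 = (F0 ^+ 2 - lam' ^+ 2) / F0 ^+ 2 by field; rewrite gt_eqF.
rewrite E1 E2 opprK [leRHS]addrC -ln_div ?posrE ?divr_gt0 ?exprn_gt0 //.
set q := (F0 ^+ 2 - lam ^+ 2) in P1 *; set q' := (F0 ^+ 2 - lam' ^+ 2) in P2 *.
have -> : q / F0 ^+ 2 / (q' / F0 ^+ 2) = q / q' by field; rewrite !gt_eqF.
apply: (@le_trans _ _ ((lam' - lam) / (2 * lam) * (lam ^+ 2 / q))).
  apply: ler_wpM2l; first by rewrite divr_ge0; lra.
  rewrite -lnV ?posrE ?divr_gt0 ?exprn_gt0 // invf_div.
  apply: (le_trans (ln_le_sub1 _)); first by rewrite divr_gt0 ?exprn_gt0.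
  by rewrite le_eqVlt; apply/orP; left; apply/eqP; rewrite /q; field; rewrite gt_eqF.
apply: le_trans (ln_ge_1sub_inv _); last by rewrite divr_gt0.
rewrite invf_div -subr_ge0 (_ : _ - _ = (lam' - lam) * (lam' + lam / 2) / q).
  by rewrite divr_ge0 ?mulr_ge0 //; lra.
by rewrite /q' /q; field; rewrite !gt_eqF.
Qed.

(** Raising the tilt favours states where bin 1 has more and bin 2 fewer balls, since
    each missing factor [1 + lam / f j] increases and each extra factor
    [1 - lam / f j] decreases with the tilt. *)
Lemma log_harmonic_tilt n (lam lam' : R) s s' :
  0 < lam -> lam < lam' -> (0 < s.1 <= s'.1)%N -> (s'.2 <= s.2 <= n)%N -> (s'.1 <= n)%N ->
  (forall j, (s'.2 <= j)%N -> lam' < f j) ->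
  log_harmonic f n lam' s - log_harmonic f n lam s <=
  log_harmonic f n lam' s' - log_harmonic f n lam s'.
Proof.
move=> l0 ll /andP[s10 s11] s22 s'n lf.
rewrite /log_harmonic (@log_sum_split _ f n lam s.1 s'.1) ?s11 //.
rewrite (@log_sum_split _ f n lam' s.1 s'.1) ?s11 //.
rewrite (@log_sum_split _ f n (- lam) s'.2 s.2) // (@log_sum_split _ f n (- lam') s'.2 s.2) //.
have A : log_sum f s'.1 lam s.1 <= log_sum f s'.1 lam' s.1.
  apply: ler_sum_nat => j /andP[h _]; have fj : 0 < f j by apply: f_gt0; lia.
  by rewrite ler_ln ?posrE ?addr_gt0 ?divr_gt0 ?(lt_trans l0 ll) // lerD2l ler_pM2r ?invr_gt0 ?ltW.
have B : log_sum f s.2 (- lam') s'.2 <= log_sum f s.2 (- lam) s'.2.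
  apply: ler_sum_nat => j /andP[h _]; have fj' := lf _ h.
  have fj : 0 < f j by apply: lt_trans fj'; exact: lt_trans ll.
  have q : lam' / f j < 1 by rewrite ltr_pdivrMr ?mul1r.
  have q' : lam / f j < lam' / f j by rewrite ltr_pM2r ?invr_gt0.
  by rewrite !mulNr ler_ln ?posrE; lra.
lra.
Qed.

End Compare.

(** * Power feedback: keeping a large lead *)

(** A lead of at least the square root of the number of balls, the size of the
    fluctuations of the lead. The subtraction truncates, so nonempty states in which
    bin 1 is not ahead are excluded. *)
Definition big_lead (s : nat * nat) : bool := (s.1 + s.2 <= (s.1 - s.2) ^ 2)%N.

Lemma big_lead_lt s : (0 < s.2)%N -> big_lead s -> (s.2 < s.1)%N.
Proof. by rewrite /big_lead; case: s => x y /=; nia. Qed.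

Section PowerFeedback.
Context {R : realType}.
Variable p : R.
Hypothesis p_gt : 1 / 2 < p.

Definition power_feedback (n : nat) : R := n%:R `^ p.
Local Notation pow := power_feedback.

Lemma pow_gt0 n : (0 < n)%N -> 0 < pow n.
Proof. by move=> n0; rewrite powR_gt0 // ltr0n. Qed.

Lemma powR_le (r x y : R) : 0 <= r -> 0 < x -> x <= y -> x `^ r <= y `^ r.
Proof. by move=> r0 x0 xy; apply: ge0_ler_powR; rewrite ?nnegrE //; lra. Qed.

Lemma powR_large (r K : R) : 0 < r -> exists n0 : nat, forall x : R, n0%:R <= x -> K <= x `^ r.
Proof.
move=> r0; pose M := Num.max K 1.
have M1 : 1 <= M by rewrite le_max lexx orbT.
exists (Num.truncn (M `^ r^-1)).+1 => x hx.
have h : M `^ r^-1 <= x by apply: (le_trans _ hx); rewrite ltW // truncnS_gt.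
apply: (@le_trans _ _ M); first by rewrite le_max lexx.
have -> : M = (M `^ r^-1) `^ r by rewrite -powRrM mulVf ?gt_eqF // powRr1 //; lra.
by apply: powR_le => //; [exact: ltW|rewrite powR_gt0 //; lra].
Qed.

Lemma p_gt0 : 0 < p.
Proof. by move: p_gt; lra. Qed.

Lemma pow_le m n : (0 < m <= n)%N -> pow m <= pow n.
Proof.
move=> /andP[m0 mn]; apply: powR_le; rewrite ?ltr0n ?ler_nat //.
by rewrite ltW // p_gt0.
Qed.

Lemma pow_ge_quarter n j : (0 < n)%N -> (n <= 4 * j)%N ->
  n%:R `^ p / 4 `^ p <= pow j.
Proof.
move=> n0 nj; have h : (n%:R / 4 : R) <= j%:R.
  by rewrite ler_pdivrMr // -natrM ler_nat mulnC.
have -> : n%:R `^ p / 4 `^ p = (n%:R / 4 : R) `^ p.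
  by rewrite powRM ?invr_ge0 // -[4^-1]powR_inv1 // powRAC powR_inv1 ?powR_ge0.
by apply: powR_le => //; rewrite ?divr_gt0 ?ltr0n // ltW // p_gt0.
Qed.

Lemma powR_half (x : R) : 0 < x -> x `^ p = x `^ (p - 1 / 2) * Num.sqrt x.
Proof.
move=> x0; rewrite -powR12_sqrt ?ltW // -powRD; last by rewrite (gt_eqF x0) implybT.
by congr (_ `^ _); field.
Qed.

Lemma sum_nat_le (a b : nat) (F : nat -> R) (c : R) : (a <= b)%N ->
  (forall j, (a <= j < b)%N -> F j <= c) -> \sum_(a <= j < b) F j <= (b - a)%:R * c.
Proof.
move=> ab H; apply: (@le_trans _ _ (\sum_(a <= j < b) c)); first exact: ler_sum_nat.
by rewrite sumr_const_nat mulr_natl.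
Qed.

Lemma sum_nat_ge (a b : nat) (F : nat -> R) (c : R) : (a <= b)%N ->
  (forall j, (a <= j < b)%N -> c <= F j) -> (b - a)%:R * c <= \sum_(a <= j < b) F j.
Proof.
move=> ab H; apply: (@le_trans _ _ (\sum_(a <= j < b) c)); last exact: ler_sum_nat.
by rewrite sumr_const_nat mulr_natl.
Qed.

(** For a fixed tilt and [n] balls, [lam / f j] is small compared with
    [1 / sqrt n] because [p > 1 / 2]. Hence neither the at most [sqrt n] terms that
    make up the lead nor the at most [n] squares contribute. *)
Lemma log_harmonic_near_tie (lam : R) : 0 < lam -> exists n0 : nat, forall s,
  let n := (s.1 + s.2)%N in (n0 <= n)%N -> (0 < s.2 <= s.1)%N ->
  ((s.1 - s.2) ^ 2 <= n)%N -> (forall j, (s.2 <= j)%N -> lam < pow j) ->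
  log_harmonic pow n lam s <= 1 / 2.
Proof.
move=> l0.
have [|n0 Hn0] := @powR_large (p - 1 / 2) (4 * (4 `^ p * lam)); first by move: p_gt; lra.
exists (maxn n0 4) => s n; rewrite geq_max => /andP[nn0 n4] /andP[y0 yx] dn lf.
have n0' : (0 < n)%N by lia.
have nR : 0 < n%:R :> R by rewrite ltr0n.
have ny j : (s.2 <= j)%N -> (n <= 4 * j)%N.
  have d2 : (2 * (s.1 - s.2) <= n)%N by rewrite leqNgt; apply/negP => h; nia.
  rewrite /n in d2 *; lia.
set r : R := Num.sqrt n%:R; have r0 : 0 < r by rewrite sqrtr_gt0.
have r1 : 1 <= r by rewrite -(sqrtr1 R) ler_wsqrtr // ler1n.
have rr : r * r = n%:R by rewrite -expr2 sqr_sqrtr // ltW.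
have F4 : 0 < 4 `^ p :> R by rewrite powR_gt0.
have w j : (s.2 <= j)%N -> lam / pow j <= 1 / (4 * r).
  move=> hj; have := pow_ge_quarter n0' (ny _ hj); rewrite (powR_half nR) -/r.
  have := Hn0 n%:R; rewrite ler_nat => /(_ nn0) h1 h2.
  have j0 : 0 < pow j by apply: pow_gt0; exact: leq_trans hj.
  rewrite ler_pdivrMr // mulrAC ler_pdivlMr ?mulr_gt0 // mul1r.
  apply: le_trans h2; rewrite ler_pdivlMr //.
  have := ler_wpM2r (ltW r0) h1; lra.
have w0 j : (s.2 <= j)%N -> 0 <= lam / pow j.
  by move=> hj; rewrite divr_ge0 ?powR_ge0 // ltW.
rewrite log_harmonic_ahead ?(ltW l0) ?leq_addr ?yx //.
have S1 : \sum_(s.2 <= j < s.1) ln (1 + lam / pow j) <= 1 / 4.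
  apply: (@le_trans _ _ ((s.1 - s.2)%:R * (1 / (4 * r)))).
    apply: sum_nat_le => // j /andP[hj _]; apply: le_trans (w _ hj).
    by apply: (le_trans (ln_le_sub1 _)); have := w0 _ hj; lra.
  have dr : (s.1 - s.2)%:R <= r.
    rewrite -(@ler_pXn2r _ 2) ?nnegrE ?(ltW r0) // sqr_sqrtr ?(ltW nR) //.
    by rewrite -natrX ler_nat.
  by rewrite mulrA mulr1 ler_pdivrMr ?mulr_gt0 //; lra.
have S2 : \sum_(s.2 <= j < n) - ln (1 - (lam / pow j) ^+ 2) <= 1 / 4.
  apply: (@le_trans _ _ ((n - s.2)%:R * (2 * (1 / (4 * r)) ^+ 2))).
    apply: sum_nat_le => [|j /andP[hj _]]; first exact: leq_addl.
    have h : (lam / pow j) ^+ 2 <= (1 / (4 * r)) ^+ 2.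
      rewrite ler_pXn2r ?nnegrE ?w0 ?w // divr_ge0 // mulr_ge0 //; exact: ltW.
    apply: (le_trans (Nln_1B_le _)); last by rewrite ler_pM2l.
    rewrite sqr_ge0 /=; apply: (le_trans h).
    have -> : (1 / (4 * r)) ^+ 2 = 1 / (16 * (r * r)) by field; rewrite gt_eqF.
    rewrite ler_pdivrMr; last by rewrite !mulr_gt0.
    have : 1 <= r * r by rewrite -[1]mulr1; apply: ler_pM.
    lra.
  have -> : (1 / (4 * r)) ^+ 2 = 1 / (16 * (r * r)) by field; rewrite gt_eqF.
  rewrite rr; have h : (n - s.2)%:R <= n%:R :> R by rewrite ler_nat leq_subr.
  rewrite !mulrA !mulr1 ler_pdivrMr ?mulr_gt0 //; lra.
lra.
Qed.

(** Comparison with an integral; [p > 1 / 2] is exactly the summability of the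
    variances [1 / f j ^ 2] of the exponential clocks. *)
Lemma pow_tail_le x n : (2 <= x)%N ->
  \sum_(x <= j < n) (pow j ^+ 2)^-1 <= (x.-1)%:R `^ (1 - 2 * p) / (2 * p - 1).
Proof.
move=> x2; have q0 : 0 < 2 * p - 1 by move: p_gt; lra.
pose h (r : R) := - (r `^ (1 - 2 * p) / (2 * p - 1)).
have [nx|xn] := leqP n x.
  by rewrite big_geq // divr_ge0 ?powR_ge0 // ltW.
apply: (@le_trans _ _ (\sum_(x <= j < n) (h j%:R - h (j.-1)%:R))).
  apply: ler_sum_nat => j /andP[xj _].
  have j1 : 0 < j.-1%:R :> R by rewrite ltr0n; lia.
  have jj : j.-1%:R < j%:R :> R by rewrite ltr_nat; lia.
  have D (r : R) : j.-1%:R <= r <= j%:R -> is_derive r 1 h (r `^ (- (2 * p))).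
    move=> /andP[h1 h2]; have r0 : 0 < r by lra.
    have H := has_der_opp (has_der_mul (is_derive1_powR (1 - 2 * p) r0) (has_der_cst (2 * p - 1)^-1 r)).
    apply: (has_der_eq H).
    rewrite (_ : 1 - 2 * p - 1 = - (2 * p)); last ring.
    by field; rewrite gt_eqF.
  have [c [/andP[c1 c2] ->]] := mvt jj D.
  have -> : j%:R - j.-1%:R = 1 :> R by rewrite -natrB ?leq_pred // -subn1 subKn //; lia.
  rewrite mulr1 powRN lef_pV2 ?posrE ?powR_gt0 ?exprn_gt0 ?pow_gt0 //; try lra; try lia.
  rewrite -powR_mulrn ?powR_ge0 // -powRrM (mulrC p).
  by apply: powR_le; lra.
rewrite (@eq_big_nat _ _ _ _ _ _ (fun j => h (j.+1).-1%:R - h (j.-1)%:R)) //.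
rewrite (@telescope_sumr _ x n (fun j => h (j.-1)%:R)) ?(ltnW xn) // /h opprK addrC.
by rewrite gerBl divr_ge0 ?powR_ge0 // ltW.
Qed.

(** Exchange the bins and use the tilt [a n^p / sqrt n]: the lead contributes at most
    [- a / 2] to the exponent and the tail only [O(a^2)], so a small [a] makes the
    probability of being caught at most [exp (- a / 4)]. *)
Lemma stay_ahead_big_lead : exists (q : R) (n0 : nat), 0 < q /\
  forall s m, (n0 <= s.1 + s.2)%N -> (0 < s.2)%N -> big_lead s ->
    q <= stay_prob pow (fun _ s => s.2 < s.1)%N m s.
Proof.
have q0 : 0 < 2 * p - 1 by move: p_gt; lra.
pose K : R := 2 * 4 `^ (2 * p - 1) / (2 * p - 1).
have K0 : 0 < K by rewrite divr_gt0 ?mulr_gt0 ?powR_gt0.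
(* [K] is the constant of the quadratic tail estimate, which becomes [a * (a * K)]. *)
have [a [a0 a1 aK]] : exists a : R, [/\ 0 < a, a <= 1 & a * K <= 1 / 4].
  exists (Num.min 1 (1 / (4 * K))); split.
  - by rewrite lt_min ltr01 divr_gt0 // mulr_gt0.
  - by rewrite ge_min lexx.
  - have h : Num.min 1 (1 / (4 * K)) <= 1 / (4 * K) by rewrite ge_min lexx orbT.
    apply: (le_trans (ler_wpM2r (ltW K0) h)).
    by rewrite le_eqVlt; apply/orP; left; apply/eqP; field; rewrite gt_eqF.
have F4 : 0 < 4 `^ p :> R by rewrite powR_gt0.
(* The leading bin has at least a quarter of the balls; for [n] beyond [n0] the tilt
   is then at most half of every [f j] that occurs. *)
have [|n0 Hn0] := @powR_large (1 / 2) (2 * 4 `^ p); first lra.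
exists (1 - expR (- (a / 4))), (maxn n0 4); split.
  by rewrite subr_gt0 expR_lt1; lra.
move=> s m; set n := (s.1 + s.2)%N; rewrite geq_max => /andP[nn0 n4] y0 sL.
have yx := big_lead_lt y0 sL.
have n0' : (0 < n)%N by exact: leq_trans n4.
have quarter j : (s.1 <= j)%N -> (n <= 4 * j)%N by clear -yx; rewrite /n; lia.
have pos j : (s.1 <= j)%N -> 0 < pow j.
  by move=> xj; apply: pow_gt0; clear -yx xj; lia.
have x2 : (2 <= s.1)%N by clear -yx n4; rewrite /n in n4; lia.
have qx : (n <= s.1.-1 * 4)%N by clear -yx n4; rewrite /n in n4 *; lia.
have nR : 0 < n%:R :> R by rewrite ltr0n.
set r : R := Num.sqrt n%:R; have r0 : 0 < r by rewrite sqrtr_gt0.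
have r1 : 1 <= r by rewrite -(sqrtr1 R) ler_wsqrtr // ler1n.
have rr : r * r = n%:R by rewrite -expr2 sqr_sqrtr // ltW.
have r4 : 2 * 4 `^ p <= r.
  have := Hn0 n%:R; rewrite ler_nat div1r powR12_sqrt ?(ltW nR) //; exact.
pose mu := a * n%:R `^ p / r.
have np : 0 < n%:R `^ p :> R by rewrite powR_gt0.
have mu0 : 0 < mu by rewrite divr_gt0 ?mulr_gt0.
have small j : (s.1 <= j)%N -> mu / pow j <= 1 / 2.
  move=> xj; have jp := pos _ xj.
  have := pow_ge_quarter n0' (quarter _ xj); rewrite ler_pdivrMr // => h.
  rewrite ler_pdivrMr // /mu ler_pdivrMr //.
  have h1 : a * n%:R `^ p <= n%:R `^ p by rewrite ler_piMl // ltW.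
  have := ler_wpM2l (ltW jp) r4; lra.
have lf j : (s.1 <= j)%N -> mu < pow j.
  move=> xj; have := small _ xj; have jp := pos _ xj.
  by rewrite ler_pdivrMr //; lra.
have x0 : (0 < s.1)%N by exact: leq_trans y0 (ltnW yx).
apply: (le_trans _ (stay_ahead_ge pow_gt0 (ltW mu0) x0 y0 (ltnSn (n + m)) lf)).
rewrite lerD2l lerN2 /harmonic_fun ler_expR.
rewrite log_harmonic_behind ?(ltW mu0) ?(ltnW yx) //=; last first.
  by apply: (@leq_trans n); [exact: leq_addr|rewrite -addnS leq_addr].
have S1 : a / 2 <= \sum_(s.2 <= j < s.1) ln (1 + mu / pow j).
  apply: (@le_trans _ _ ((s.1 - s.2)%:R * (a / (2 * r)))).
    have dr : r <= (s.1 - s.2)%:R.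
      rewrite -(@ler_pXn2r _ 2) ?nnegrE ?(ltW r0) // sqr_sqrtr ?(ltW nR) //.
      by rewrite -natrX ler_nat.
    rewrite mulrA ler_pdivlMr ?mulr_gt0 //.
    have := ler_wpM2l (ltW a0) dr; lra.
  apply: sum_nat_ge => [|j /andP[hj hj']]; first exact: ltnW.
  have jn : pow j <= n%:R `^ p by apply: pow_le; rewrite /n; clear -hj hj' y0; lia.
  have jp : 0 < pow j by apply: pow_gt0; exact: leq_trans hj.
  have ar : 0 <= a / r <= 1 by rewrite divr_ge0 ?ler_pdivrMr ?mul1r ?(ltW a0) ?(ltW r0) //=; lra.
  apply: (@le_trans _ _ (ln (1 + a / r))).
    by have := ln_1D_ge ar; rewrite (_ : a / (2 * r) = a / r / 2) //; field; rewrite gt_eqF.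
  have arm : a / r <= mu / pow j.
    rewrite ler_pdivlMr // /mu mulrAC ler_pM2r ?invr_gt0 // ler_pM2l //.
  by move/andP: ar => [ar _]; rewrite ler_ln ?posrE; lra.
have S2 : \sum_(s.1 <= j < (n + m).+1) - ln (1 - (mu / pow j) ^+ 2) <= a * (1 / 4).
  apply: (@le_trans _ _ (2 * mu ^+ 2 * \sum_(s.1 <= j < (n + m).+1) (pow j ^+ 2)^-1)).
    rewrite mulr_sumr; apply: ler_sum_nat => j /andP[hj _].
    rewrite -mulrA -expr_div_n; apply: Nln_1B_le; rewrite sqr_ge0 /=.
    have h := small _ hj.
    have h0 : 0 <= mu / pow j by rewrite divr_ge0 ?powR_ge0 // ltW.
    have : (mu / pow j) ^+ 2 <= (1 / 2) ^+ 2 by rewrite ler_pXn2r ?nnegrE.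
    by move=> /le_trans; apply; rewrite expr2; lra.
  apply: (@le_trans _ _ (2 * mu ^+ 2 * ((n%:R / 4) `^ (1 - 2 * p) / (2 * p - 1)))).
    apply: ler_wpM2l; first by rewrite mulr_ge0 // sqr_ge0.
    apply: (le_trans (pow_tail_le _ x2)); rewrite ler_pM2r ?invr_gt0 //.
    have -> : 1 - 2 * p = - (2 * p - 1) by ring.
    have h : (n%:R / 4 : R) <= s.1.-1%:R.
      by rewrite ler_pdivrMr // -natrM ler_nat.
    have nq : 0 < n%:R / 4 :> R by rewrite divr_gt0.
    rewrite !powRN lef_pV2 ?posrE ?powR_gt0 //; last exact: lt_le_trans h.
    apply: powR_le => //; exact: ltW.
  rewrite [leLHS](_ : _ = a * (a * K)); first by rewrite ler_pM2l.
  rewrite /mu /K.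
  have -> : n%:R `^ p = n%:R `^ (p - 1 / 2) * r :> R by exact: powR_half.
  have -> : (n%:R / 4) `^ (1 - 2 * p) = (n%:R `^ (p - 1 / 2) ^+ 2)^-1 * 4 `^ (2 * p - 1) :> R.
    rewrite powRM ?invr_ge0 // ?(ltW nR) //.
    rewrite -(@powR_mulrn _ (n%:R `^ (p - 1/2)) 2) ?powR_ge0 // -powRrM.
    rewrite -powRN -[4^-1]powR_inv1 // -powRrM.
    by congr (_ `^ _ * _ `^ _); field.
  have : 0 < n%:R `^ (p - 1 / 2) :> R by rewrite powR_gt0.
  move=> A0; field; rewrite !gt_eqF //.
lra.
Qed.

End PowerFeedback.

(** * Two bounds for the probability of leading eventually *)

Section LowerBound.
Context {R : realType}.
Variable p : R.
Hypothesis p_gt : 1 / 2 < p.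
Local Notation pow := (power_feedback p).

Lemma expR_half_le2 : expR (1 / 2) <= 2 :> R.
Proof.
rewrite -[leRHS]lnK ?posrE // ler_expR.
by apply: le_trans (ln_ge_1sub_inv _) => //; lra.
Qed.

Lemma balanced_split n : exists a b : nat, (a + b = n)%N /\ (b <= a <= b.+1)%N.
Proof.
exists (uphalf n), n./2; have := odd_double_half n; rewrite uphalf_half -addnn.
have : (odd n <= 1)%N by case: (odd n).
by clear; lia.
Qed.

(** This inequality replaces a change of measure. Write [M1], [M2], [M3] for the three
    harmonic functions at a state on the horizon. Near a tie [M2] is at most 2 while
    [M1] is at least 1, and moving from the tie towards states led by bin 2 only
    favours [M1], so without a big lead [M2 <= 2 * M1]. With a big lead, either
    [M3 >= e^V * M2], or the growth of the logarithm in the tilt bounds [M2]. *)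
Lemma harmonic_trichotomy (lam1 lam2 lam3 V : R) : 0 < lam1 -> lam1 < lam2 -> lam2 < lam3 ->
  exists n0 : nat, forall s, let n := (s.1 + s.2)%N in
  (n0 <= n)%N -> (0 < s.1)%N -> (0 < s.2)%N -> (forall u2, (0 < u2 <= s.2)%N ->
  (forall j, (u2 <= j)%N -> lam3 < pow j) -> (2 * u2 < n)%N ->
  harmonic_fun pow n lam2 s <=
    2 * harmonic_fun pow n lam1 s + (expR (- V) * harmonic_fun pow n lam3 s
      + expR (V * (2 * lam2) / (lam3 - lam2)) * (big_lead s)%:R)).
Proof.
move=> l1 l12 l23.
have l2 : 0 < lam2 by exact: lt_trans l12.
have [n0 Hn0] := log_harmonic_near_tie p_gt l2.
exists n0 => -[x y] n nn0 /= x0 y0 u2 /andP[u0 uy] lf un; rewrite -/n.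
have lf2 j : (u2 <= j)%N -> lam2 < pow j by move=> /lf; exact: lt_trans.
have lf1 j : (u2 <= j)%N -> lam1 < pow j by move=> /lf2; exact: lt_trans.
have tie s' : (s'.1 + s'.2)%N = n -> (u2 <= s'.2 <= s'.1)%N -> ((s'.1 - s'.2) ^ 2 <= n)%N ->
    log_harmonic pow n lam2 s' <= 1 / 2.
  move=> e /andP[us ss] d2; rewrite -e; apply: Hn0; rewrite ?e ?ss ?andbT //.
    exact: leq_trans us.
  by move=> j hj; apply: lf2; exact: leq_trans hj.
have E3 : 0 <= expR (- V) * harmonic_fun pow n lam3 (x, y) by rewrite mulr_ge0 ?expR_ge0.
have E0 : 0 <= expR (V * (2 * lam2) / (lam3 - lam2)) * (big_lead (x, y))%:R :> R.
  by rewrite mulr_ge0 ?expR_ge0.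
have E1 : 0 <= harmonic_fun pow n lam1 (x, y) by rewrite expR_ge0.
have small s' : (s'.1 + s'.2)%N = n -> (u2 <= s'.2 <= s'.1)%N -> ((s'.1 - s'.2) ^ 2 <= n)%N ->
    log_harmonic pow n lam2 (x, y) - log_harmonic pow n lam1 (x, y) <=
    log_harmonic pow n lam2 s' - log_harmonic pow n lam1 s' ->
    harmonic_fun pow n lam2 (x, y) <= 2 * harmonic_fun pow n lam1 (x, y).
  move=> e us d2 h; have t := tie _ e us d2.
  have g : 0 <= log_harmonic pow n lam1 s'.
    move/andP: us => [us ss]; apply: log_harmonic_ge0; rewrite ?(ltW l1) //.
    - exact: pow_gt0.
    - by rewrite ss -e leq_addr.
    - exact: leq_trans us.
    - by move=> j hj; apply: lf1; exact: leq_trans hj.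
  apply: le_trans (ler_wpM2r E1 expR_half_le2).
  by rewrite /harmonic_fun -expRD ler_expR; lra.
have [xy|yx] := ltnP x y.
  suff : harmonic_fun pow n lam2 (x, y) <= 2 * harmonic_fun pow n lam1 (x, y) by lra.
  (* The balanced state with the same number of balls is the tie to compare with. *)
  have [a [b [eab ba]]] := balanced_split n.
  have ab : (x <= a)%N by clear -eab ba xy; rewrite /n /= in eab; lia.
  have uab : (u2 <= b <= y)%N by clear -eab ba xy un; rewrite /n /= in eab un; lia.
  apply: (small (a, b)) => //=.
  - by clear -ba uab; lia.
  - by apply: (@leq_trans (1 ^ 2)); [rewrite leq_exp2r //; clear -ba; lia|clear -un; lia].
  - apply: log_harmonic_tilt => //=.
    + exact: pow_gt0.
    + by rewrite x0.
    + by rewrite /n leq_addl andbT; case/andP: uab.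
    + by rewrite -eab leq_addr.
    + by move=> j hj; apply: lf2; apply: leq_trans hj; case/andP: uab.
case: (boolP (big_lead (x, y))) => [bl|nbl]; last first.
  suff : harmonic_fun pow n lam2 (x, y) <= 2 * harmonic_fun pow n lam1 (x, y) by move: E0; rewrite (negbTE nbl); lra.
  apply: (small (x, y)) => //=; first by rewrite uy.
  by move: nbl; rewrite /big_lead /= -ltnNge => /ltnW.
rewrite bl mulr1 in E0 *.
have gr := @log_harmonic_growth R pow n lam2 lam3 (x, y) l2 l23 _ _.
have {gr} : (lam3 - lam2) / (2 * lam2) * log_harmonic pow n lam2 (x, y) <=
  log_harmonic pow n lam3 (x, y) - log_harmonic pow n lam2 (x, y).
  apply: gr => /=; first by rewrite yx /n leq_addr.
  by move=> j hj; apply: lf; exact: leq_trans hj.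
have d0 : 0 < lam3 - lam2 by lra.
have [VH gr|VH gr] := leP V (log_harmonic pow n lam3 (x, y) - log_harmonic pow n lam2 (x, y)).
  suff : harmonic_fun pow n lam2 (x, y) <= expR (- V) * harmonic_fun pow n lam3 (x, y) by lra.
  by rewrite /harmonic_fun -expRD ler_expR; lra.
suff : harmonic_fun pow n lam2 (x, y) <= expR (V * (2 * lam2) / (lam3 - lam2)) by lra.
rewrite /harmonic_fun ler_expR ler_pdivlMr //.
have := le_lt_trans gr VH; rewrite mulrAC ltr_pdivrMr; last by rewrite mulr_gt0.
by move=> /ltW; rewrite mulrC.
Qed.

(** Average the trichotomy over the state at the horizon. As [M1], [M2], [M3] are
    harmonic, the hypotheses on their initial values say that the parts of [M2] charged
    to [M1] and to [M3] are at most a quarter of it each. The remaining half sits on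
    states with a big lead, whose weight is bounded, so such a state is reached with
    probability of order [M2] over that weight, and from there the lead is kept with
    probability at least [q]. *)
Lemma ELead_lower : exists q : R, 0 < q /\
  forall (d : measure_display) (T : measurableType d) (P : probability T R)
    (I : nat -> T -> nat * nat) (u : nat * nat) (lam1 lam2 lam3 V B : R),
  balls_in_bins pow P I u -> (0 < u.1 < u.2)%N ->
  0 < lam1 -> lam1 < lam2 -> lam2 < lam3 -> (forall j, (u.2 <= j)%N -> lam3 < pow j) ->
  (exists n0, forall n, (n0 <= n)%N ->
    [/\ 8 * harmonic_fun pow n lam1 u <= harmonic_fun pow n lam2 u,
     4 * harmonic_fun pow n lam3 u <= expR V * harmonic_fun pow n lam2 u &
     B <= harmonic_fun pow n lam2 u]) ->
  q * (B * expR (- (V * (2 * lam2) / (lam3 - lam2)))) <= fine (P (ELead I)).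
Proof.
have [q [nq [q0 Hq]]] := stay_ahead_big_lead p_gt.
exists (q / 2); split; first by rewrite divr_gt0.
move=> d T P I u lam1 lam2 lam3 V B chain /andP[u1 u12] l1 l12 l23 lf [n0 Hn0].
have l2 : 0 < lam2 by exact: lt_trans l12.
have l3 : 0 < lam3 by exact: lt_trans l23.
have lf2 j : (u.2 <= j)%N -> lam2 < pow j by move=> /lf; exact: lt_trans.
have lf1 j : (u.2 <= j)%N -> lam1 < pow j by move=> /lf2; exact: lt_trans.
have u2 : (0 < u.2)%N by exact: ltn_trans u12.
have pw := @pow_gt0 R p.
have [nt Hnt] := @harmonic_trichotomy lam1 lam2 lam3 V l1 l12 l23.
pose N := maxn nq (maxn n0 (maxn nt u.2)).
pose n := (u.1 + u.2 + N)%N.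
have [nn0 nnq nnt nu2] : [/\ (n0 <= n)%N, (nq <= n)%N, (nt <= n)%N & (2 * u.2 < n)%N].
  by split; rewrite /n /N; clear -u1; lia.
have [h1 h3 hB] := Hn0 n nn0.
set W := V * (2 * lam2) / (lam3 - lam2).
pose m := mean pow N (fun s => (big_lead s)%:R) u.
have key : harmonic_fun pow n lam2 u / 2 <= expR W * m.
  have := @mean_le R pow pw N (harmonic_fun pow n lam2) (fun s => 2 * harmonic_fun pow n lam1 s +
    (expR (- V) * harmonic_fun pow n lam3 s + expR W * (big_lead s)%:R)) u u1 u2.
  rewrite meanD // meanD // !meanZ // (mean_harmonic pw u1 u2 (leqnn _) (ltW l1) lf1)
    (mean_harmonic pw u1 u2 (leqnn _) (ltW l2) lf2)
    (mean_harmonic pw u1 u2 (leqnn _) (ltW l3) lf) -/m => H.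
  have {}H : harmonic_fun pow n lam2 u <=
    2 * harmonic_fun pow n lam1 u + (expR (- V) * harmonic_fun pow n lam3 u + expR W * m).
    apply: H => s s1 s2 e; rewrite -/n in e; rewrite -e.
    apply: (Hnt s _ _ _ u.2); rewrite ?e ?u2 //; first exact: leq_trans s1.
    exact: leq_trans s2.
  have : expR (- V) * harmonic_fun pow n lam3 u <= harmonic_fun pow n lam2 u / 4.
    rewrite expRN mulrC ler_pdivrMr ?expR_gt0 //; lra.
  lra.
have key2 : q * m <= fine (P (ELead I)).
  apply: (ELead_ge pw chain u1 u2 (A := lead_from N big_lead)); last first.
    exists N.+1 => k s; rewrite /lead_from => Nk.
    by rewrite ltnNge (ltnW Nk) /= gtn_eqF.
  move=> k; apply: le_trans (stay_prob_le pw _ k N u1 u2).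
  rewrite stay_lead_from /m -meanZ //.
  apply: mean_le => // s s1 s2 e; rewrite -/n in e.
  have s20 : (0 < s.2)%N by exact: leq_trans u2 s2.
  rewrite stay_lead_from0; last exact: big_lead_lt.
  case: ifP => bl; last by rewrite mulr0.
  by rewrite mulr1; apply: Hq; rewrite ?e.
apply: le_trans key2.
rewrite expRN -/W.
have k3 : harmonic_fun pow n lam2 u / 2 / expR W <= m.
  by rewrite ler_pdivrMr ?expR_gt0 // [m * _]mulrC.
have k4 : B / expR W <= harmonic_fun pow n lam2 u / expR W.
  by rewrite ler_pM2r // invr_gt0 expR_gt0.
apply: (@le_trans _ _ (q * (harmonic_fun pow n lam2 u / 2 / expR W))); last first.
  by rewrite ler_pM2l.
have -> : q / 2 * (B / expR W) = q * (B / expR W / 2) by ring.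
rewrite ler_pM2l //; move: k4; rewrite mulrAC; lra.
Qed.

(** Optional stopping bounds the probability by the initial value of any of the
    harmonic functions. *)
Lemma ELead_upper (d : measure_display) (T : measurableType d) (P : probability T R)
    (I : nat -> T -> nat * nat) (u : nat * nat) (lam v : R) :
  balls_in_bins pow P I u -> (0 < u.1)%N -> (0 < u.2)%N ->
  0 <= lam -> (forall j, (u.2 <= j)%N -> lam < pow j) ->
  (forall n, (u.1 + u.2 < n)%N -> harmonic_fun pow n lam u <= v) ->
  fine (P (ELead I)) <= v.
Proof.
move=> chain u1 u2 l0 lf Hv; have pw := @pow_gt0 R p.
apply: (ELead_le pw chain u1 u2) => m.
apply: le_trans (stay_behind_ge pw l0 u1 u2 (ltnSn _) lf).
by rewrite lerD2l lerN2; apply: Hv; rewrite ltnS leq_addr.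
Qed.

End LowerBound.

(** * Clocks of the tilted fluid limit *)

Section Antiderivatives.
Context {R : realType}.
Variable p : R.
Hypothesis p_gt : 1 / 2 < p.
Implicit Types (r v w u x y z : R).
Let p0 : 0 < p := p_gt0 p_gt.
Let q0 : 0 < 2 * p - 1. Proof. by move: p_gt; lra. Qed.

Lemma powR_gt1 (x r : R) : 0 < r -> 1 < x -> 1 < x `^ r.
Proof.
move=> r0 x1; have := @gt0_ltr_powR R r r0 1 x.
by rewrite powR1; apply; rewrite ?nnegrE //; lra.
Qed.

Lemma powR_lt (x y r : R) : 0 < r -> 0 <= x -> x < y -> x `^ r < y `^ r.
Proof. by move=> r0 x0 xy; apply: gt0_ltr_powR; rewrite ?nnegrE //; lra. Qed.

Lemma powR_lt1 (x r : R) : 0 < r -> 0 <= x -> x < 1 -> x `^ r < 1.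
Proof. by move=> r0 x0 x1; have := powR_lt r0 x0 x1; rewrite powR1. Qed.

Lemma has_der_powR (r x : R) : 0 < x -> is_derive x 1 (fun y : R => y `^ r) (r * x `^ r / x).
Proof.
move=> x0; apply: (has_der_eq (is_derive1_powR r x0)).
by rewrite powRB ?(gt_eqF x0) ?implybT // powRr1 ?ltW // mulrA.
Qed.

(** The exponent conjugate to [2 * p]: with [w = s^(1 - 2 * p)], the power [s^(- 2 * p)]
    is [w^conj_exp]. *)
Definition conj_exp : R := 2 * p / (2 * p - 1).

Definition lead_clock_density (t : R) : R := (1 + t `^ p) `^ (- 1).
Definition clock_gap_density (w : R) : R := 2 / (2 * p - 1) * (1 - w `^ conj_exp) `^ (- 1).

(** Under the tilt the clocks of bin 1 run at rates [f j + lam] and those of bin 2 at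
    rates [f j - lam]. In units where [lam = 1] the fluid limits solve [a' = a^p + 1]
    and [b' = b^p - 1]; [lead_clock] and [lag_clock] are their time functions,
    normalised so that their difference vanishes at infinity. *)
Definition lead_clock (r : R) : R := \int[lebesgue_measure]_(t in `[0, r]) lead_clock_density t.
Definition clock_gap_integral (v : R) : R := \int[lebesgue_measure]_(t in `[0, v]) clock_gap_density t.

(** The substitution [w = s^(1 - 2 p)] turns the improper integral of
    [2 / (s^(2 p) - 1)] over [[r, +oo[] into a proper one. *)
Definition clock_gap (r : R) : R := clock_gap_integral (r `^ (1 - 2 * p)).
Definition lag_clock (r : R) : R := lead_clock r - clock_gap r.

Lemma lead_clock_der r : 0 < r -> is_derive r 1 lead_clock (r `^ p + 1)^-1.
Proof.
move=> r0; have pos (t : R) : 0 < 1 + t `^ p by rewrite ltr_pwDl ?powR_ge0.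
have e : lead_clock_density r = (r `^ p + 1)^-1.
  by rewrite /lead_clock_density powR_inv1 ?(ltW (pos _)) // addrC.
rewrite -e; apply: (@has_der_integral R lead_clock_density r (r + 1) 1) => //.
- lra.
- apply: measurable_funTS; rewrite /lead_clock_density; apply: (measurableT_comp (measurable_powR (- 1))).
  by apply: measurable_funD => //; exact: measurable_powR.
- move=> y /andP[y0 _]; rewrite /lead_clock_density powR_inv1 ?(ltW (pos _)) //.
  by rewrite ger0_norm ?invr_ge0 ?(ltW (pos _)) // invf_le1 // lerDl powR_ge0.
- have H1 := has_der_add (has_der_cst 1 r) (has_der_powR p r0).
  exact: (has_der_continuous (has_der_pow (- 1) H1 (pos r))).
Qed.

Lemma conj_exp_gt0 : 0 < conj_exp.
Proof. by rewrite divr_gt0 // mulr_gt0. Qed.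

Lemma clock_gap_density_denom_gt0 w : 0 <= w < 1 -> 0 < 1 - w `^ conj_exp.
Proof. by move=> /andP[w0 w1]; rewrite subr_gt0 powR_lt1 // conj_exp_gt0. Qed.

Lemma clock_gap_density_le w u : 0 <= w -> w <= u -> u < 1 -> clock_gap_density w <= clock_gap_density u.
Proof.
move=> w0 wu u1.
have h1 : 0 < 1 - w `^ conj_exp by apply: clock_gap_density_denom_gt0; lra.
have h2 : 0 < 1 - u `^ conj_exp by apply: clock_gap_density_denom_gt0; lra.
rewrite /clock_gap_density (powR_inv1 (ltW h1)) (powR_inv1 (ltW h2)).
rewrite ler_pM2l ?divr_gt0 // lef_pV2 ?posrE //.
rewrite lerD2l lerN2 ge0_ler_powR ?nnegrE ?(ltW conj_exp_gt0) //; lra.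
Qed.

Lemma clock_gap_density_ge0 w : 0 <= clock_gap_density w.
Proof. by rewrite mulr_ge0 ?powR_ge0 // divr_ge0 // ltW. Qed.

Lemma measurable_clock_gap_density D : measurable_fun D clock_gap_density.
Proof.
apply: measurable_funTS; rewrite /clock_gap_density; apply: measurable_funM => //.
apply: (measurableT_comp (measurable_powR (- 1))).
by apply: measurable_funB => //; exact: measurable_powR.
Qed.

Lemma clock_gap_integral_der v : 0 < v < 1 -> is_derive v 1 clock_gap_integral (clock_gap_density v).
Proof.
move=> /andP[v0 v1]; have [h1 h2] : v < (v + 1) / 2 /\ (v + 1) / 2 < 1 by split; lra.
apply: (@has_der_integral R clock_gap_density v ((v + 1) / 2) (clock_gap_density ((v + 1) / 2)) v0 h1).
- exact: measurable_clock_gap_density.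
- move=> y /andP[y0 y1]; rewrite (ger0_norm (clock_gap_density_ge0 _)); exact: (clock_gap_density_le y0 y1 h2).
- have pos : 0 < 1 - v `^ conj_exp by apply: clock_gap_density_denom_gt0; lra.
  have H1 := has_der_sub (has_der_cst 1 v) (has_der_powR conj_exp v0).
  exact: (has_der_continuous (has_der_scale _ (has_der_pow (- 1) H1 pos))).
Qed.

Lemma clock_gap_integral_ge0 v : 0 <= clock_gap_integral v.
Proof. by apply: Rintegral_ge0 => x _; exact: clock_gap_density_ge0. Qed.

Lemma clock_gap_integral_le v u : 0 < v -> v <= u -> u < 1 ->
  clock_gap_integral v <= clock_gap_density u * v.
Proof.
move=> v0 vu u1.
have fin : (lebesgue_measure (`[0%R, v]%classic : set R) < +oo)%E.
  by rewrite lebesgue_measure_itv /= lte_fin v0 -EFinB ltry.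
have b w : 0 <= w <= v -> clock_gap_density w <= clock_gap_density u by move=> /andP[w0 wv]; exact: (clock_gap_density_le w0 (le_trans wv vu) u1).
apply: (@le_trans _ _ (\int[lebesgue_measure]_(t in `[0, v]) (cst (clock_gap_density u) t))).
  apply: le_Rintegral => //.
  - apply: measurable_bounded_integrable => //; first exact: measurable_clock_gap_density.
    exists (clock_gap_density u); split; first by rewrite num_real.
    move=> M CM y; rewrite /= in_itv /= => h; apply: le_trans (ltW CM).
    by rewrite (ger0_norm (clock_gap_density_ge0 _)); exact: b.
  - by apply: measurable_bounded_integrable => //; exact: bounded_cst.
rewrite Rintegral_cst //= (lebesgue_measure_itv `[0, v]) /= lte_fin v0 /= subr0.
exact: lexx.
Qed.

Lemma clock_gap_der r : 1 < r -> is_derive r 1 clock_gap (- 2 / ((r `^ p) ^+ 2 - 1)).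
Proof.
move=> r1; have r0 : 0 < r by lra.
have s1 : 1 < r `^ p by exact: powR_gt1.
set s := r `^ p in s1 *.
have v : 0 < r `^ (1 - 2 * p) < 1.
  rewrite powR_gt0 //= (_ : 1 - 2 * p = - (2 * p - 1)); last ring.
  by rewrite powRN invf_lt1 ?powR_gt0 // powR_gt1.
have H := has_der_comp (has_der_powR (1 - 2 * p) r0) (clock_gap_integral_der v).
refine (has_der_eq H _).
have e1 : (r `^ (1 - 2 * p)) `^ conj_exp = (s ^+ 2)^-1.
  rewrite -powRrM /s -powR_mulrn ?powR_ge0 // -powRrM -powRN; congr (_ `^ _).
  by rewrite /conj_exp; field; rewrite gt_eqF.
have e2 : r `^ (1 - 2 * p) = r / s ^+ 2.
  rewrite /s -powR_mulrn ?powR_ge0 // -powRrM -powRN -{2}[r]powRr1 ?(ltW r0) // -powRD.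
    by congr (_ `^ _); ring.
  by rewrite (gt_eqF r0) implybT.
have ss : 1 < s ^+ 2 by rewrite expr2; apply: (lt_trans s1); rewrite ltr_pMr //; lra.
rewrite /clock_gap_density e1 powR_inv1; last by rewrite subr_ge0 invf_le1 ?ltW //; lra.
rewrite e2; field; rewrite (gt_eqF r0) (gt_eqF q0) !gt_eqF //; lra.
Qed.

Lemma lag_clock_der r : 1 < r -> is_derive r 1 lag_clock (r `^ p - 1)^-1.
Proof.
move=> r1; have s1 : 1 < r `^ p by exact: powR_gt1.
have r0 : 0 < r by lra.
apply: (has_der_eq (has_der_sub (lead_clock_der r0) (clock_gap_der r1))).
set s := r `^ p in s1 *.
have ss : 1 < s ^+ 2 by rewrite expr2; apply: (lt_trans s1); rewrite ltr_pMr //; lra.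
field; rewrite !gt_eqF //; lra.
Qed.

Lemma clock_gap_ge0 r : 0 <= clock_gap r.
Proof. exact: clock_gap_integral_ge0. Qed.

Lemma powR_neg_le (x y : R) : 0 < x -> x <= y -> y `^ (1 - 2 * p) <= x `^ (1 - 2 * p).
Proof.
move=> x0 xy; rewrite (_ : 1 - 2 * p = - (2 * p - 1)); last ring.
rewrite !powRN lef_pV2 ?posrE ?powR_gt0 //; last lra.
by apply: powR_le => //; exact: ltW.
Qed.

Lemma clock_gap_le : exists C, 0 <= C /\ forall r, 2 <= r -> clock_gap r <= C * r `^ (1 - 2 * p).
Proof.
exists (clock_gap_density (2 `^ (1 - 2 * p))); split; first exact: clock_gap_density_ge0.
move=> r r2; apply: clock_gap_integral_le; first by rewrite powR_gt0; lra.
  by apply: powR_neg_le.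
rewrite (_ : 1 - 2 * p = - (2 * p - 1)); last ring.
rewrite powRN invf_lt1 ?powR_gt0 // powR_gt1 //; lra.
Qed.

(** Boundary values at infinity are discarded through this decay. *)
Lemma ge0_of_decay (x K r0 : R) :
  (forall r, r0 <= r -> - (K * r `^ (1 - 2 * p)) <= x) -> 0 <= x.
Proof.
move=> H; rewrite leNgt; apply/negP => x0.
have [n0 Hn] := @powR_large R (2 * p - 1) ((`|K| + 1) / - x) q0.
pose r := Num.max r0 (Num.max n0%:R 1).
have rr : r0 <= r by rewrite le_max lexx.
have rn : n0%:R <= r by rewrite !le_max lexx orbT.
have r1 : 1 <= r by rewrite !le_max lexx !orbT.
have := H r rr; have := Hn r rn.
rewrite (_ : 1 - 2 * p = - (2 * p - 1)); last ring.
rewrite powRN; have : 0 < r `^ (2 * p - 1) by rewrite powR_gt0; lra.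
set w := r `^ _ => w0; rewrite ler_pdivrMr; last lra.
move=> h1; rewrite lerNl ler_pdivlMr // => h2.
have := ler_norm K; lra.
Qed.

End Antiderivatives.

(** * Costs: antiderivatives of the logarithmic terms *)

Section Potentials.
Context {R : realType}.
Variable p : R.
Hypothesis p_gt : 1 / 2 < p.
Implicit Types (r a b x y z al : R).
Local Notation Lead := (lead_clock p).
Local Notation Lag := (lag_clock p).
Local Notation Gap := (clock_gap p).

(** Antiderivatives of [ln (1 + r^(- p))] and [ln (1 - r^(- p))], found by integration
    by parts. The clocks are normalised at infinity, so the sum of the costs also tends
    to zero there: the horizon leaves no trace in the exponent. *)
Definition lead_cost (r : R) : R := r * ln (1 + (r `^ p)^-1) + p * Lead r.
Definition lag_cost (r : R) : R := r * ln (1 - (r `^ p)^-1) - p * Lag r.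

Lemma powRp_gt1 r : 1 < r -> 1 < r `^ p.
Proof. by move=> r1; apply: powR_gt1 => //; exact: p_gt0. Qed.

Lemma ln_1Dinv_der r : 0 < r ->
  is_derive r 1 (fun t => ln (1 + (t `^ p)^-1)) (- (p / (r * (r `^ p + 1)))).
Proof.
move=> r0; have s0 : 0 < r `^ p by exact: powR_gt0.
have pos : 0 < 1 + (r `^ p)^-1 by rewrite addr_gt0 ?invr_gt0.
have H := has_der_add (has_der_cst 1 r) (has_der_inv (has_der_powR p r0) (lt0r_neq0 s0)).
apply: (has_der_eq (has_der_ln H pos)).
by field; rewrite !gt_eqF //; lra.
Qed.

Lemma ln_1Binv_der r : 1 < r ->
  is_derive r 1 (fun t => ln (1 - (t `^ p)^-1)) (p / (r * (r `^ p - 1))).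
Proof.
move=> r1; have r0 : 0 < r by lra.
have s1 := powRp_gt1 r1; have s0 : 0 < r `^ p by exact: powR_gt0.
have pos : 0 < 1 - (r `^ p)^-1 by rewrite subr_gt0 invf_lt1.
have H := has_der_sub (has_der_cst 1 r) (has_der_inv (has_der_powR p r0) (lt0r_neq0 s0)).
apply: (has_der_eq (has_der_ln H pos)).
by field; rewrite !gt_eqF //; lra.
Qed.

Lemma lead_cost_der r : 0 < r -> is_derive r 1 lead_cost (ln (1 + (r `^ p)^-1)).
Proof.
move=> r0; have s0 : 0 < r `^ p by exact: powR_gt0.
have H := has_der_add (has_der_mul (has_der_id r) (ln_1Dinv_der r0))
  (has_der_scale p (lead_clock_der p r0)).
apply: (has_der_eq H); field; rewrite !gt_eqF //; lra.
Qed.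

Lemma lag_cost_der r : 1 < r -> is_derive r 1 lag_cost (ln (1 - (r `^ p)^-1)).
Proof.
move=> r1; have s1 := powRp_gt1 r1; have r0 : 0 < r by lra.
have H := has_der_sub (has_der_mul (has_der_id r) (ln_1Binv_der r1))
  (has_der_scale p (lag_clock_der p_gt r1)).
apply: (has_der_eq H); field; rewrite !gt_eqF //; lra.
Qed.

Lemma ln_1Dinv_ge0 r : 0 < r -> 0 <= ln (1 + (r `^ p)^-1).
Proof. by move=> r0; apply: ln_ge0; rewrite lerDl invr_ge0 powR_ge0. Qed.

Lemma ln_1Binv_le0 r : 1 < r -> ln (1 - (r `^ p)^-1) <= 0.
Proof. by move=> r1; apply: ln_le0; rewrite gerBl invr_ge0 powR_ge0. Qed.

Lemma cost_sumE r : 1 < r ->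
  lead_cost r + lag_cost r = r * ln (1 - ((r `^ p) ^+ 2)^-1) + p * Gap r.
Proof.
move=> r1; have s1 := powRp_gt1 r1; have s0 : 0 < r `^ p by lra.
have i1 : (r `^ p)^-1 < 1 by rewrite invf_lt1.
have i0 : 0 < (r `^ p)^-1 by rewrite invr_gt0.
have -> : ((r `^ p) ^+ 2)^-1 = ((r `^ p)^-1) ^+ 2 by rewrite exprVn.
have -> : 1 - (r `^ p)^-1 ^+ 2 = (1 + (r `^ p)^-1) * (1 - (r `^ p)^-1) by ring.
by rewrite lnM ?posrE /lead_cost /lag_cost /lag_clock; [ring|lra|lra].
Qed.

Lemma r_over_sqr r : 0 < r -> r / (r `^ p) ^+ 2 = r `^ (1 - 2 * p).
Proof.
move=> r0; rewrite -powR_mulrn ?powR_ge0 // -powRrM -powRN -{1}[r]powRr1 ?(ltW r0) // -powRD.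
  by congr (_ `^ _); ring.
by rewrite (gt_eqF r0) implybT.
Qed.

Lemma large_power : exists r0, 2 <= r0 /\ forall r, r0 <= r -> 2 <= r `^ p.
Proof.
have [n0 Hn] := @powR_large R p 2 (p_gt0 p_gt).
exists (Num.max 2 n0%:R); split; first by rewrite le_max lexx.
by move=> r; rewrite ge_max => /andP[_]; exact: Hn.
Qed.

Lemma ln_1Bsqr_tail r : 2 <= r -> 2 <= r `^ p ->
  - (2 * r `^ (1 - 2 * p)) <= r * ln (1 - ((r `^ p) ^+ 2)^-1) <= 0.
Proof.
move=> r2 s2; have r0 : 0 < r by lra.
have s4 : 4 <= (r `^ p) ^+ 2 by rewrite expr2; have := ler_pM (ltac:(lra) : 0 <= 2 :> R) (ltac:(lra) : 0 <= 2 :> R) s2 s2; lra.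
set v := ((r `^ p) ^+ 2)^-1.
have v0 : 0 < v by rewrite invr_gt0; lra.
have v1 : v <= 1 / 2 by rewrite /v invf_ple ?posrE; lra.
have := Nln_1B_le (_ : 0 <= v <= 1 / 2); rewrite (ltW v0) v1 => /(_ isT) h.
have h' : ln (1 - v) <= 0 by apply: ln_le0; lra.
rewrite -(r_over_sqr r0) -/v; apply/andP; split.
  by have := ler_wpM2l (ltW r0) h; lra.
by rewrite pmulr_rle0.
Qed.

Lemma cost_sum_decay : exists C r0, [/\ 0 <= C, 2 <= r0 & forall r, r0 <= r ->
  - (C * r `^ (1 - 2 * p)) <= lead_cost r + lag_cost r <= C * r `^ (1 - 2 * p)].
Proof.
have [r0 [r02 Hr]] := large_power; have [C [C0 HC]] := clock_gap_le p_gt.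
have p0 := p_gt0 p_gt.
exists (2 + p * C), r0; split => //; first by rewrite addr_ge0 // mulr_ge0 // ltW.
move=> r rr; have r2 : 2 <= r by exact: le_trans rr.
have /andP[h1 h2] := ln_1Bsqr_tail r2 (Hr _ rr).
have r1 : 1 < r by lra.
rewrite (cost_sumE r1).
have h3 : p * Gap r <= p * (C * r `^ (1 - 2 * p)) by rewrite ler_pM2l // HC.
have h4 : 0 <= p * Gap r by rewrite mulr_ge0 ?clock_gap_ge0 // ltW.
have h5 : 0 <= r `^ (1 - 2 * p) by exact: powR_ge0.
have h6 : 0 <= p * (C * r `^ (1 - 2 * p)) by rewrite !mulr_ge0 // ltW.
by apply/andP; split; lra.
Qed.

Lemma cost_sum_nonincr x y : 1 < x -> x <= y -> lead_cost y + lag_cost y <= lead_cost x + lag_cost x.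
Proof.
move=> x1 xy; rewrite -lerN2.
apply: (@has_der_le R (fun r => - (lead_cost r + lag_cost r)) (fun r => - (ln (1 + (r `^ p)^-1) + ln (1 - (r `^ p)^-1))) x y xy).
  move=> r /andP[xr _]; apply: has_der_opp; apply: has_der_add.
    by apply: lead_cost_der; lra.
  by apply: lag_cost_der; lra.
move=> r /andP[xr _]; have r1 : 1 < r by lra.
have s1 := powRp_gt1 r1; have s0 : 0 < r `^ p by lra.
have i1 : (r `^ p)^-1 < 1 by rewrite invf_lt1.
have i0 : 0 < (r `^ p)^-1 by rewrite invr_gt0.
rewrite -lnM ?posrE; try lra.
rewrite oppr_ge0; apply: ln_le0.
have -> : (1 + (r `^ p)^-1) * (1 - (r `^ p)^-1) = 1 - (r `^ p)^-1 ^+ 2 by ring.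
by rewrite gerBl sqr_ge0.
Qed.

(** The sum of the costs decreases and tends to zero. *)
Lemma cost_sum_ge0 r : 1 < r -> 0 <= lead_cost r + lag_cost r.
Proof.
move=> r1; have [C [r0 [C0 r02 H]]] := cost_sum_decay.
apply: (@ge0_of_decay R p p_gt _ C (Num.max r r0)) => y; rewrite ge_max => /andP[ry ry'].
have /andP[h _] := H _ ry'; apply: (le_trans h); exact: cost_sum_nonincr.
Qed.

Lemma clock_gap_nonincr x y : 1 < x -> x <= y -> Gap y <= Gap x.
Proof.
move=> x1 xy; rewrite -lerN2.
apply: (@has_der_le R (fun r => - Gap r) (fun r => - (- 2 / ((r `^ p) ^+ 2 - 1))) x y xy).
  by move=> r /andP[xr _]; apply: has_der_opp; apply: clock_gap_der => //; lra.
move=> r /andP[xr _]; have r1 : 1 < r by lra.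
have s1 := powRp_gt1 r1.
have ss : 1 < (r `^ p) ^+ 2 by rewrite expr2; apply: (lt_trans s1); rewrite ltr_pMr //; lra.
by rewrite mulNr opprK divr_ge0 // subr_ge0 ltW.
Qed.

(** The tail integral blows up logarithmically at [1]; the comparison function
    has derivative [r] times smaller. *)
Lemma clock_gap_blowup r : 1 < r -> - ln (1 - ((r `^ p) ^+ 2)^-1) / p <= Gap r.
Proof.
move=> r1; have p0 := p_gt0 p_gt.
pose U x := p * Gap x + ln (1 - ((x `^ p) ^+ 2)^-1).
suff : 0 <= U r by rewrite /U ler_pdivrMr //; lra.
have mono x y : 1 < x -> x <= y -> U y <= U x.
  move=> x1 xy; rewrite -lerN2.
  apply: (@has_der_le R (fun r => - U r)
    (fun r => 2 * p * (1 - r^-1) / ((r `^ p) ^+ 2 - 1)) x y xy) => z /andP[xz _];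
    have z1 : 1 < z by lra.
    have z0 : 0 < z by lra.
    have s1 := powRp_gt1 z1; have s0 : 0 < z `^ p by lra.
    have ss : 1 < (z `^ p) ^+ 2 by rewrite expr2; apply: (lt_trans s1); rewrite ltr_pMr.
    have ss0 : (z `^ p) ^+ 2 != 0 by rewrite gt_eqF //; lra.
    have pos : 0 < 1 - ((z `^ p) ^+ 2)^-1 by rewrite subr_gt0 invf_lt1; lra.
    have H1 := has_der_mul (has_der_powR p z0) (has_der_powR p z0).
    have ssm : z `^ p * z `^ p != 0 by rewrite -expr2.
    have H2 := has_der_sub (has_der_cst 1 z) (has_der_inv H1 ssm).
    have H3 := has_der_opp (has_der_add (has_der_scale p (clock_gap_der p_gt z1)) (has_der_ln H2 pos)).
    apply: (has_der_eq H3); field; rewrite !gt_eqF //; try lra.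
  have s1 := powRp_gt1 z1.
  have ss : 1 < (z `^ p) ^+ 2 by rewrite expr2; apply: (lt_trans s1); rewrite ltr_pMr //; lra.
  have : z^-1 <= 1 by rewrite invf_le1; lra.
  by move=> h; rewrite divr_ge0 ?mulr_ge0 //; lra.
have [r0 [r02 Hr]] := large_power.
apply: (@ge0_of_decay R p p_gt _ 2 (Num.max r r0)) => y; rewrite ge_max => /andP[ry ry'].
apply: le_trans (mono _ _ r1 ry).
have y2 : 2 <= y by exact: le_trans ry'.
have /andP[h1 h2] := ln_1Bsqr_tail y2 (Hr _ ry').
have : ln (1 - ((y `^ p) ^+ 2)^-1) * y <= ln (1 - ((y `^ p) ^+ 2)^-1).
  have : ln (1 - ((y `^ p) ^+ 2)^-1) <= 0.
    have y0 : 0 < y by lra.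
    by move: h2; rewrite pmulr_rle0.
  have y1 : 1 <= y by lra.
  by move=> h; have := ler_wnM2r h y1; lra.
have : 0 <= p * Gap y by rewrite mulr_ge0 ?clock_gap_ge0 // ltW.
by rewrite /U; lra.
Qed.

End Potentials.

(** * The optimal tilt *)

(* From here on the clocks enter only through their derivatives and bounds. *)
Opaque lead_clock clock_gap.

Section Saddle.
Context {R : realType}.
Variable p : R.
Hypothesis p_gt : 1 / 2 < p.
Implicit Types (r a b x y z al : R).
Local Notation Lead := (lead_clock p).
Local Notation Lag := (lag_clock p).
Local Notation Gap := (clock_gap p).

(** The derivative of the rescaled clock defect splits into a function of each
    coordinate, which is monotone with a simple derivative. *)
Definition lead_moment (r : R) : R := (p - 1) * Lead r + r / (r `^ p + 1).
Definition lag_moment (r : R) : R := (p - 1) * Lag r + r / (r `^ p - 1).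

Lemma lead_moment_der r : 0 < r -> is_derive r 1 lead_moment (p / (r `^ p + 1) ^+ 2).
Proof.
move=> r0; have s0 : 0 < r `^ p by exact: powR_gt0.
have H1 := has_der_add (has_der_powR p r0) (has_der_cst 1 r).
have n1 : r `^ p + 1 != 0 by rewrite gt_eqF //; lra.
have H := has_der_add (has_der_scale (p - 1) (lead_clock_der p r0))
  (has_der_mul (has_der_id r) (has_der_inv H1 n1)).
by apply: (has_der_eq H); field; rewrite n1 gt_eqF.
Qed.

Lemma lag_moment_der r : 1 < r -> is_derive r 1 lag_moment (- (p / (r `^ p - 1) ^+ 2)).
Proof.
move=> r1; have r0 : 0 < r by lra.
have s1 := powRp_gt1 p_gt r1.
have H1 := has_der_sub (has_der_powR p r0) (has_der_cst 1 r).
have n1 : r `^ p - 1 != 0 by rewrite gt_eqF //; lra.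
have H := has_der_add (has_der_scale (p - 1) (lag_clock_der p_gt r1))
  (has_der_mul (has_der_id r) (has_der_inv H1 n1)).
by apply: (has_der_eq H); field; rewrite n1 gt_eqF.
Qed.

Lemma lead_moment_nondecr x y : 0 < x -> x <= y -> lead_moment x <= lead_moment y.
Proof.
move=> x0 xy; apply: (@has_der_le R lead_moment (fun r => p / (r `^ p + 1) ^+ 2) x y xy).
  by move=> r /andP[xr _]; apply: lead_moment_der; lra.
by move=> r _; rewrite divr_ge0 ?sqr_ge0 // ltW // p_gt0.
Qed.

Lemma lag_moment_nonincr x y : 1 < x -> x <= y -> lag_moment y <= lag_moment x.
Proof.
move=> x0 xy; rewrite -lerN2.
apply: (@has_der_le R (fun r => - lag_moment r) (fun r => - - (p / (r `^ p - 1) ^+ 2)) x y xy).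
  by move=> r /andP[xr _]; apply: has_der_opp; apply: lag_moment_der; lra.
by move=> r _; rewrite opprK divr_ge0 ?sqr_ge0 // ltW // p_gt0.
Qed.

Lemma moment_gap_decay : exists K r0, forall r, r0 <= r ->
  - (K * r `^ (1 - 2 * p)) <= lag_moment r - lead_moment r.
Proof.
have [C [C0 HC]] := clock_gap_le p_gt.
exists (`|p - 1| * C), 2 => r r2; have r1 : 1 < r by lra.
have s1 := powRp_gt1 p_gt r1.
have ss : 1 < (r `^ p) ^+ 2 by rewrite expr2; apply: (lt_trans s1); rewrite ltr_pMr //; lra.
have -> : lag_moment r - lead_moment r = - ((p - 1) * Gap r) + 2 * r / ((r `^ p) ^+ 2 - 1).
  by rewrite /lag_moment /lead_moment /lag_clock; field; rewrite !gt_eqF //; lra.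
have h1 : 0 <= 2 * r / ((r `^ p) ^+ 2 - 1) by rewrite divr_ge0 ?mulr_ge0 ?subr_ge0 ?(ltW ss) //; lra.
have h2 : (p - 1) * Gap r <= `|p - 1| * C * r `^ (1 - 2 * p).
  rewrite -mulrA; apply: (@le_trans _ _ (`|p - 1| * Gap r)).
    by rewrite ler_wpM2r ?clock_gap_ge0 // ler_norm.
  by rewrite ler_wpM2l // HC.
lra.
Qed.

(** The two moments tend to the same limit at infinity, [lead_moment] from below and
    [lag_moment] from above; the increase of [lead_moment] on [[a, a + 1]] is a margin
    that stays bounded below when [a] is bounded. *)
Lemma moment_gap_ge a b : 0 < a -> 1 < b -> p / ((a + 1) `^ p + 1) ^+ 2 <= lag_moment b - lead_moment a.
Proof.
move=> a0 b1; have aa1 : a < a + 1 by lra.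
have H r : a <= r <= a + 1 -> is_derive r 1 lead_moment (p / (r `^ p + 1) ^+ 2).
  by move=> /andP[ar _]; apply: lead_moment_der; lra.
have [c [/andP[ac ca] e]] := mvt aa1 H.
have h : p / ((a + 1) `^ p + 1) ^+ 2 <= lead_moment (a + 1) - lead_moment a.
  have c0 : 0 < c by lra.
  have sc : 0 < c `^ p by exact: powR_gt0.
  have sa : c `^ p <= (a + 1) `^ p by apply: powR_le; [exact: ltW (p_gt0 p_gt)| |]; lra.
  rewrite e (_ : a + 1 - a = 1) ?mulr1; last ring.
  rewrite ler_pM2l ?p_gt0 // lef_pV2 ?posrE ?exprn_gt0 //; try lra.
  by rewrite ler_pXn2r ?nnegrE //; lra.
have [K [r0 HK]] := moment_gap_decay.
suff : 0 <= lag_moment b - lead_moment (a + 1) by lra.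
apply: (@ge0_of_decay R p p_gt _ K (Num.max r0 (Num.max b (a + 1)))) => r.
rewrite !ge_max => /andP[rr /andP[br ar]].
have := HK r rr; have := lag_moment_nonincr b1 br; have := lead_moment_nondecr (_ : 0 < a + 1) ar.
by move=> /(_ ltac:(lra)); lra.
Qed.

(** Up to a positive factor, the derivative of [tilt_exponent] in [z]. *)
Definition clock_defect (al z : R) : R := Lag ((1 - al) * z) - Lead (al * z).

(** The defect need not be monotone in [z]; this weight makes it so. *)
Definition scaled_defect (al z : R) : R := z `^ (p - 1) * clock_defect al z.

(** The limit of [ln (harmonic function) / t] at the state with fraction [al], when the
    tilt equals the feedback of [t / z] balls. *)
Definition tilt_exponent (al z : R) : R := (lead_cost p (al * z) + lag_cost p ((1 - al) * z)) / z.

Lemma domain_pos al z : 0 < al < 1 -> 1 < (1 - al) * z -> 0 < z /\ 0 < al * z.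
Proof.
move=> /andP[al0 al1] h; have z0 : 0 < z.
  have a' : 0 < 1 - al by lra.
  by rewrite -(pmulr_rgt0 _ a'); lra.
by split=> //; rewrite mulr_gt0.
Qed.

Lemma clock_defect_der al z : 0 < al < 1 -> 1 < (1 - al) * z -> is_derive z 1 (clock_defect al)
  ((1 - al) / (((1 - al) * z) `^ p - 1) - al / ((al * z) `^ p + 1)).
Proof.
move=> hal hz; have [z0 az0] := domain_pos hal hz.
have Hb := has_der_scale (1 - al) (has_der_id z).
have Ha := has_der_scale al (has_der_id z).
have H := has_der_sub (has_der_comp Hb (lag_clock_der p_gt hz)) (has_der_comp Ha (lead_clock_der p az0)).
by apply: (has_der_eq H); rewrite !mulr1 mulrC [al / _]mulrC.
Qed.

Lemma scaled_defect_der al z : 0 < al < 1 -> 1 < (1 - al) * z -> is_derive z 1 (scaled_defect al)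
  (z `^ (p - 1) / z * (lag_moment ((1 - al) * z) - lead_moment (al * z))).
Proof.
move=> hal hz; have [z0 az0] := domain_pos hal hz.
have H := has_der_mul (has_der_powR (p - 1) z0) (clock_defect_der hal hz).
apply: (has_der_eq H); rewrite /clock_defect /lag_moment /lead_moment.
have s1 := powRp_gt1 p_gt hz; have s0 : 0 < (al * z) `^ p by exact: powR_gt0.
by field; rewrite (gt_eqF z0) !gt_eqF //; lra.
Qed.

Lemma tilt_exponent_der al z : 0 < al < 1 -> 1 < (1 - al) * z ->
  is_derive z 1 (tilt_exponent al) (p / z ^+ 2 * clock_defect al z).
Proof.
move=> hal hz; have [z0 az0] := domain_pos hal hz.
have Hb := has_der_scale (1 - al) (has_der_id z).
have Ha := has_der_scale al (has_der_id z).
have H := has_der_mul (has_der_add (has_der_comp Ha (lead_cost_der p az0))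
  (has_der_comp Hb (lag_cost_der p_gt hz))) (has_der_inv (has_der_id z) (lt0r_neq0 z0)).
apply: (has_der_eq H); rewrite /lead_cost /lag_cost /clock_defect.
by field; rewrite (gt_eqF z0).
Qed.

Lemma scaled_defect_incr al x y : 0 < al < 1 -> 1 < (1 - al) * x -> x < y ->
  scaled_defect al x < scaled_defect al y.
Proof.
move=> hal hx xy; have hr r : x <= r -> 1 < (1 - al) * r.
  move=> xr; apply: (lt_le_trans hx); rewrite ler_wpM2l //.
  by move/andP: hal => [_ h]; lra.
apply: (@has_der_lt R (scaled_defect al) (fun z => z `^ (p - 1) / z * (lag_moment ((1 - al) * z) - lead_moment (al * z))) x y xy).
  by move=> r /andP[xr _]; apply: scaled_defect_der => //; exact: hr.
move=> r /andP[/ltW/hr h _]; have [r0 ar0] := domain_pos hal h.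
rewrite mulr_gt0 ?divr_gt0 ?powR_gt0 //.
apply: lt_le_trans (moment_gap_ge ar0 h).
apply: divr_gt0; first exact: p_gt0.
by rewrite exprn_gt0 // ltr_wpDl ?powR_ge0.
Qed.

Lemma lead_clock_lipschitz x y : 0 < x -> x <= y -> 0 <= Lead y - Lead x <= y - x.
Proof.
move=> x0 xy; have D r : x <= r -> is_derive r 1 Lead (r `^ p + 1)^-1.
  by move=> xr; apply: lead_clock_der; lra.
rewrite subr_ge0; apply/andP; split.
  apply: (@has_der_le R Lead (fun r => (r `^ p + 1)^-1) x y xy).
    by move=> r /andP[xr _]; exact: D.
  by move=> r _; rewrite invr_ge0 addr_ge0 ?powR_ge0.
suff : x - Lead x <= y - Lead y by lra.
apply: (@has_der_le R (fun r => r - Lead r) (fun r => 1 - (r `^ p + 1)^-1) x y xy).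
  by move=> r /andP[xr _]; exact: (has_der_sub (has_der_id r) (D r xr)).
move=> r /andP[xr _]; have := powR_ge0 r p => s0.
by rewrite subr_ge0 invf_le1 ?lerDr // ltr_wpDl.
Qed.

Lemma lead_clock_slope x y : 0 < x -> x <= y -> (y - x) / (y `^ p + 1) <= Lead y - Lead x.
Proof.
move=> x0 xy; pose k := (y `^ p + 1)^-1.
suff : Lead x - k * x <= Lead y - k * y by rewrite -/k; lra.
apply: (@has_der_le R (fun r => Lead r - k * r) (fun r => (r `^ p + 1)^-1 - k * 1) x y xy).
  move=> r /andP[xr _]; have r0 : 0 < r by lra.
  exact: (has_der_sub (lead_clock_der p r0) (has_der_scale k (has_der_id r))).
move=> r /andP[xr ry]; rewrite mulr1 subr_ge0 lef_pV2 ?posrE ?ltr_wpDl ?powR_ge0 //.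
by rewrite lerD2r; apply: powR_le; [exact: ltW (p_gt0 p_gt)| |]; lra.
Qed.

Lemma lead_clock_incr x y : 0 < x -> x < y -> Lead x < Lead y.
Proof.
move=> x0 xy; rewrite -subr_gt0; apply: lt_le_trans (lead_clock_slope x0 (ltW xy)).
by rewrite divr_gt0 ?subr_gt0 // ltr_wpDl ?powR_ge0.
Qed.

Lemma lag_clock_incr x y : 1 < x -> x < y -> Lag x < Lag y.
Proof.
move=> x1 xy; apply: (@has_der_lt R Lag (fun r => (r `^ p - 1)^-1) x y xy).
  by move=> r /andP[xr _]; apply: lag_clock_der => //; lra.
move=> r /andP[xr _]; rewrite invr_gt0 subr_gt0; apply: powRp_gt1 => //; lra.
Qed.

Lemma lag_clock_inj x y : 1 < x -> 1 < y -> Lag x = Lag y -> x = y.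
Proof.
move=> x1 y1 e; apply/eqP; rewrite eq_le !leNgt.
apply/andP; split; apply/negP => h.
  by have := lag_clock_incr y1 h; rewrite e ltxx.
by have := lag_clock_incr x1 h; rewrite e ltxx.
Qed.

(** The gap is at least [b] itself. As the lead clock grows at rate at most one, the lag
    clock at [b] is then not ahead of the lead clock at any smaller argument. *)
Lemma clock_gap_large : exists b, [/\ 1 < b, b <= 2 & 2 <= Gap b].
Proof.
have p0 := p_gt0 p_gt.
pose e : R := expR (- (2 * p)).
have e0 : 0 < e by exact: expR_gt0.
have e1 : e < 1 by rewrite expR_lt1 oppr_lt0 mulr_gt0.
pose y := ((1 - e)^-1) `^ (1 / (2 * p)).
have y1 : 1 < y by apply: powR_gt1; rewrite ?divr_gt0 ?mulr_gt0 // invf_gt1; lra.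
have ey : ((y `^ p) ^+ 2)^-1 = 1 - e.
  rewrite -powR_mulrn ?powR_ge0 // -!powRrM.
  rewrite (_ : 1 / (2 * p) * (p * 2%:R) = 1); last by field; rewrite gt_eqF.
  by rewrite powRr1 ?invrK // invr_ge0; lra.
have := clock_gap_blowup p_gt y1; rewrite ey opprB addrC subrK expRK opprK mulfK ?gt_eqF // => h.
exists (Num.min 2 y); split.
- by rewrite lt_min y1 andbT; lra.
- by rewrite ge_min lexx.
- apply: (le_trans h); apply: clock_gap_nonincr => //.
    by rewrite lt_min y1 andbT; lra.
  by rewrite ge_min lexx orbT.
Qed.

Lemma clock_gap_small e : 0 < e -> exists r0, 2 <= r0 /\ forall r, r0 <= r -> Gap r <= e.
Proof.
move=> e0; have [C [C0 HC]] := clock_gap_le p_gt.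
have q0 : 0 < 2 * p - 1 by move: p_gt; lra.
have [n0 Hn] := @powR_large R (2 * p - 1) (C / e) q0.
exists (Num.max 2 n0%:R); split; first by rewrite le_max lexx.
move=> r; rewrite ge_max => /andP[r2 rn]; apply: (le_trans (HC _ r2)).
rewrite (_ : 1 - 2 * p = - (2 * p - 1)) ?powRN; last ring.
have w0 : 0 < r `^ (2 * p - 1) by rewrite powR_gt0; lra.
by rewrite ler_pdivrMr // mulrC -ler_pdivrMr // Hn.
Qed.

(** From [al * z] to [b = (1 - al) * z] the lead clock gains a multiple of [b^(1 - p)],
    whereas the gap at [b] is only of order [b^(1 - 2 * p)]. *)
Lemma clock_defect_ge0_large al : 0 < al < 1 / 2 -> exists z0, forall z, z0 <= z ->
  1 < (1 - al) * z /\ 0 <= clock_defect al z.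
Proof.
move=> /andP[al0 al1]; have [C [C0 HC]] := clock_gap_le p_gt.
pose ga := (1 - 2 * al) / (1 - al).
have ga0 : 0 < ga by rewrite divr_gt0; lra.
have [n0 Hn] := @powR_large R p (Num.max 1 (2 * C / ga)) (p_gt0 p_gt).
exists (Num.max (2 * n0%:R) 4) => z; rewrite ge_max => /andP[zn z4].
have h2 : 1 / 2 * z <= (1 - al) * z by apply: ler_wpM2r; lra.
have b2 : 2 <= (1 - al) * z by lra.
split; first lra.
have bn : n0%:R <= (1 - al) * z by lra.
set b := (1 - al) * z in h2 b2 bn *.
have az0 : 0 < al * z by rewrite mulr_gt0; lra.
have ab : al * z <= b by apply: ler_wpM2r; lra.
have dba : b - al * z = b * ga by rewrite /b /ga; field; rewrite gt_eqF; lra.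
have := lead_clock_slope az0 ab; rewrite dba /clock_defect /lag_clock -/b => h.
have := HC _ b2; have b0 : 0 < b by lra.
rewrite -(r_over_sqr _ b0) => h'.
have := Hn _ bn; rewrite ge_max => /andP[s1]; set s := b `^ p in h h' s1 *.
rewrite ler_pdivrMr // => s2.
have s0 : 0 < s by lra.
suff : C * (b / s ^+ 2) <= b * ga / (s + 1) by lra.
have -> : C * (b / s ^+ 2) = b * (C / s ^+ 2) by ring.
rewrite -mulrA ler_pM2l // ler_pdivrMr ?exprn_gt0 // mulrAC ler_pdivlMr; last lra.
have h3 : C * (s + 1) <= C * (2 * s) by apply: ler_wpM2l => //; lra.
apply: (le_trans h3).
have : 2 * C * s <= s * ga * s by apply: ler_wpM2r => //; exact: ltW.
by rewrite expr2; lra.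
Qed.

(** The defect is negative where [(1 - al) * z] is close to 1, since the gap blows up
    there, and nonnegative for large [z]. *)
Lemma clock_defect_root al : 0 < al < 1 / 2 -> exists z, 1 < (1 - al) * z /\ clock_defect al z = 0.
Proof.
move=> hal; have hal1 : 0 < al < 1 by move/andP: hal => [h1 h2]; apply/andP; split; lra.
have [z2 Hz2] := clock_defect_ge0_large hal; move/andP: hal => [al0 al1].
have [b [b1 b2 hT]] := clock_gap_large.
pose z1 := b / (1 - al).
have bz : (1 - al) * z1 = b by rewrite /z1 mulrC divfK // gt_eqF; lra.
have dom z : z1 <= z -> 1 < (1 - al) * z.
  by move=> h; apply: (lt_le_trans b1); rewrite -bz; apply: ler_wpM2l; lra.
pose zm := Num.max z1 z2.
have [|||z [/andP[hz _] hK]] := @ivt R (clock_defect al) (fun z => (1 - al) / (((1 - al) * z) `^ p - 1) - al / ((al * z) `^ p + 1)) z1 zm 0.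
- by rewrite le_max lexx.
- by move=> x /andP[h _]; apply: clock_defect_der => //; exact: dom.
- apply/andP; split; last first.
    by have [] := Hz2 zm; rewrite // le_max lexx orbT.
  have hz1 : 1 < (1 - al) * z1 by rewrite bz.
  have [z10 az0] := domain_pos hal1 hz1.
  have ab : al * z1 <= b by rewrite -bz; apply: ler_wpM2r; lra.
  have /andP[_ h] := lead_clock_lipschitz az0 ab.
  by rewrite /clock_defect bz /lag_clock; lra.
- by exists z; split=> //; exact: dom.
Qed.

Lemma clock_defect_root_uniq al x y : 0 < al < 1 -> 1 < (1 - al) * x -> 1 < (1 - al) * y ->
  clock_defect al x = 0 -> clock_defect al y = 0 -> x = y.
Proof.
move=> hal hx hy ex ey; apply/eqP; rewrite eq_le !leNgt.
apply/andP; split; apply/negP => h.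
  by have := scaled_defect_incr hal hy h; rewrite /scaled_defect ex ey !mulr0 ltxx.
by have := scaled_defect_incr hal hx h; rewrite /scaled_defect ex ey !mulr0 ltxx.
Qed.

(** The lag clock starts from minus infinity at 1 and catches up with the lead clock at
    infinity. *)
Lemma lag_clock_solve a : 0 < a -> exists b, 1 < b /\ Lag b = Lead a.
Proof.
move=> a0; have [b [b1 b2 hT]] := clock_gap_large.
have e0 : 0 < Lead (a + 1) - Lead a by rewrite subr_gt0; apply: lead_clock_incr; lra.
have [r0 [r02 Hr]] := clock_gap_small e0.
have [m [bm rm am]] : exists m, [/\ b <= m, r0 <= m & a + 1 <= m].
  by exists (Num.max b (Num.max r0 (a + 1))); split; rewrite !le_max lexx ?orbT.
have a10 : 0 < a + 1 by lra.
have b0 : 0 < b by lra.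
have [|||x [/andP[hx _] e]] := @ivt R Lag (fun r => (r `^ p - 1)^-1) b m (Lead a).
- exact: bm.
- by move=> x /andP[h _]; apply: lag_clock_der => //; lra.
- apply/andP; split; rewrite /lag_clock.
    case: (leP a b) => ab; first by have /andP[_ h] := lead_clock_lipschitz a0 ab; lra.
    by have /andP[h _] := lead_clock_lipschitz b0 (ltW ab); lra.
  have /andP[h _] := lead_clock_lipschitz a10 am.
  rewrite subr_ge0 in h; rewrite lerBrDr; apply: le_trans h.
  by rewrite -lerBrDl; exact: Hr.
- by exists x; split; [exact: lt_le_trans hx|].
Qed.

Lemma lag_clock_le b : Lag b <= Lead b.
Proof. by rewrite /lag_clock gerBl clock_gap_ge0. Qed.

Lemma curve_lt a b : 0 < a -> 1 < b -> Lag b = Lead a -> a <= b.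
Proof.
move=> a0 b1 e; rewrite leNgt; apply/negP => ba.
have b0 : 0 < b by lra.
have := lead_clock_incr b0 ba; have := lag_clock_le b; lra.
Qed.

End Saddle.

(** * The curve of optimal tilts *)

Section Curve.
Context {R : realType}.
Variable p : R.
Hypothesis p_gt : 1 / 2 < p.
Implicit Types (r a b x y z al : R).
Local Notation Lead := (lead_clock p).
Local Notation Lag := (lag_clock p).
Local Notation Defect := (clock_defect p).

(** For [0 < al < 1 / 2] there is exactly one critical point of the exponent in [z]. *)
Definition curve_scale (al : R) : R := xget 1 [set z | 1 < (1 - al) * z /\ Defect al z = 0].
Local Notation zz := curve_scale.
Definition curve_lead (al : R) : R := al * zz al.
Local Notation aa := curve_lead.
Definition curve_lag (al : R) : R := (1 - al) * zz al.
Local Notation bb := curve_lag.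

Lemma curve_scale_spec al : 0 < al < 1 / 2 -> 1 < (1 - al) * zz al /\ Defect al (zz al) = 0.
Proof.
move=> hal; have [z hz] := clock_defect_root p_gt hal.
exact: (@xgetI _ 1 [set z | 1 < (1 - al) * z /\ Defect al z = 0] z hz).
Qed.

Lemma half_lt1 al : 0 < al < 1 / 2 -> 0 < al < 1.
Proof. by move=> /andP[h1 h2]; apply/andP; split; lra. Qed.

Lemma curve_scale_gt0 al : 0 < al < 1 / 2 -> 0 < zz al.
Proof. by move=> hal; have [h _] := curve_scale_spec hal; have [] := domain_pos (half_lt1 hal) h. Qed.

Lemma curve_lead_gt0 al : 0 < al < 1 / 2 -> 0 < aa al.
Proof. by move=> hal; have [h _] := curve_scale_spec hal; have [] := domain_pos (half_lt1 hal) h. Qed.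

Lemma curve_lag_gt1 al : 0 < al < 1 / 2 -> 1 < bb al.
Proof. by move=> hal; have [] := curve_scale_spec hal. Qed.

Lemma curve_eq al : 0 < al < 1 / 2 -> Lag (bb al) = Lead (aa al).
Proof. by move=> hal; have [_ /eqP] := curve_scale_spec hal; rewrite subr_eq0 => /eqP. Qed.

Lemma curve_sum al : aa al + bb al = zz al.
Proof. by rewrite /aa /bb; ring. Qed.

Lemma curve_fractionE al : 0 < al < 1 / 2 -> aa al / (aa al + bb al) = al.
Proof. by move=> /curve_scale_gt0 z0; rewrite curve_sum /aa mulfK // gt_eqF. Qed.

(** The lag clock is behind the lead clock by a positive gap, so equal clocks force
    [a < b]. *)
Lemma curve_ratio a b : 0 < a -> 1 < b -> Lag b = Lead a -> 0 < a / (a + b) < 1 / 2.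
Proof.
move=> a0 b1 e; have b0 : 0 < b by lra.
have ab : a < b.
  rewrite lt_neqAle (curve_lt p_gt a0 b1 e) andbT; apply/negP => /eqP ab.
  move: b1 e; rewrite -ab => a1 e.
  have T0 : clock_gap p a = 0.
    have -> : clock_gap p a = Lead a - (Lead a - clock_gap p a) by ring.
    by rewrite -/(Lag a) e subrr.
  have : - clock_gap p a < - clock_gap p (a + 1).
    apply: (@has_der_lt R (fun x => - clock_gap p x) (fun r => - (- 2 / ((r `^ p) ^+ 2 - 1)))).
    - by rewrite ltrDl.
    - by move=> r /andP[ar _]; apply: has_der_opp; apply: clock_gap_der => //; exact: lt_le_trans ar.
    move=> r /andP[ar _]; have s1 := powRp_gt1 p_gt (lt_trans a1 ar).
    have ss : 1 < (r `^ p) ^+ 2 by rewrite expr2; apply: (lt_trans s1); rewrite ltr_pMr //; lra.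
    by rewrite mulNr opprK divr_gt0 // subr_gt0.
  by rewrite T0 oppr0 oppr_gt0 ltNge clock_gap_ge0.
rewrite divr_gt0 ?addr_gt0 //= ltr_pdivrMr ?addr_gt0 //; lra.
Qed.

Lemma curve_param a b : 0 < a -> 1 < b -> Lag b = Lead a ->
  aa (a / (a + b)) = a /\ bb (a / (a + b)) = b.
Proof.
move=> a0 b1 e; have b0 : 0 < b by lra.
have hal := curve_ratio a0 b1 e; set al := a / (a + b) in hal *.
have ab0 : a + b != 0 by rewrite gt_eqF // addr_gt0.
have ea : al * (a + b) = a by rewrite /al divfK.
have eb : (1 - al) * (a + b) = b by rewrite mulrBl ea; ring.
have [h1 h2] := curve_scale_spec hal.
have ez : zz al = a + b.
  apply: (clock_defect_root_uniq p_gt (half_lt1 hal)) => //; first by rewrite eb.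
  by rewrite /clock_defect ea eb e subrr.
by rewrite /aa /bb ez.
Qed.

(** The determinant of the point [(a, b)] and its velocity [(a^p + 1, b^p - 1)]: up to
    sign, the angular speed of the curve, hence the denominator when the curve is
    parametrised by the fraction [a / (a + b)]. *)
Definition curve_det a b : R := b * (a `^ p + 1) - a * (b `^ p - 1).

(** On the curve the clocks cancel in the difference of the moments, which leaves the
    determinant over a positive denominator. *)
Lemma curve_det_gt0 a b : 0 < a -> 1 < b -> Lag b = Lead a -> 0 < curve_det a b.
Proof.
move=> a0 b1 e; have h := moment_gap_ge p_gt a0 b1.
have s0 : 0 < a `^ p by exact: powR_gt0.
have s1 := powRp_gt1 p_gt b1.
have : 0 < lag_moment p b - lead_moment p a.
  apply: lt_le_trans h; apply: divr_gt0; first exact: p_gt0.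
  by rewrite exprn_gt0 // ltr_wpDl ?powR_ge0.
rewrite /lag_moment /lead_moment e.
have -> : (p - 1) * Lead a + b / (b `^ p - 1) - ((p - 1) * Lead a + a / (a `^ p + 1)) =
  curve_det a b / ((b `^ p - 1) * (a `^ p + 1)).
  by rewrite /curve_det; field; rewrite !gt_eqF //; lra.
by rewrite pmulr_lgt0 // invr_gt0 mulr_gt0 //; lra.
Qed.

Definition lag_clock_inv (y : R) : R := xget 1 [set b | 1 < b /\ Lag b = y].

Lemma lag_clock_invK b : 1 < b -> lag_clock_inv (Lag b) = b.
Proof.
move=> b1; have [h1 h2] := @xgetI _ 1 [set b' | 1 < b' /\ Lag b' = Lag b] b (conj b1 erefl).
exact: (lag_clock_inj p_gt h1 b1 h2).
Qed.

Lemma lag_clock_inv_der b : 1 < b -> is_derive (Lag b) 1 lag_clock_inv (b `^ p - 1).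
Proof.
move=> b1; rewrite -[b `^ p - 1]invrK; apply: (@is_derive_inverse R Lag).
- near=> x; apply: lag_clock_invK; near: x; exact: lt_nbhsr.
- near=> x; apply: (has_der_continuous (lag_clock_der p_gt _)); near: x; exact: lt_nbhsr.
- exact: lag_clock_der.
- by rewrite invr_eq0 gt_eqF // subr_gt0 powRp_gt1.
Unshelve. all: by end_near. Qed.

(** The curve as a graph over its first coordinate; in this form it is differentiable
    by the inverse function theorem for the lag clock. *)
Definition curve_partner (a : R) : R := lag_clock_inv (Lead a).

Lemma curve_partner_spec a : 0 < a -> 1 < curve_partner a /\ Lag (curve_partner a) = Lead a.
Proof.
by move=> a0; have [b hb] := lag_clock_solve p_gt a0; exact: (@xgetI _ 1 [set b | 1 < b /\ Lag b = Lead a] b hb).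
Qed.

Lemma curve_partner_der a : 0 < a ->
  is_derive a 1 curve_partner ((curve_partner a `^ p - 1) / (a `^ p + 1)).
Proof.
move=> a0; have [b1 e] := curve_partner_spec a0.
have H := lag_clock_inv_der b1; rewrite e in H.
exact: (has_der_comp (lead_clock_der p a0) H).
Qed.

Lemma curve_partnerE al : 0 < al < 1 / 2 -> curve_partner (aa al) = bb al.
Proof.
move=> hal; have [h1 h2] := curve_partner_spec (curve_lead_gt0 hal).
by apply: (lag_clock_inj p_gt h1 (curve_lag_gt1 hal)); rewrite h2 curve_eq.
Qed.

Definition curve_fraction (a : R) : R := a / (a + curve_partner a).

Lemma curve_fraction_der a : 0 < a -> is_derive a 1 curve_fraction
  (curve_det a (curve_partner a) / ((a `^ p + 1) * (a + curve_partner a) ^+ 2)).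
Proof.
move=> a0; have [b1 e] := curve_partner_spec a0.
have s0 : 0 < a `^ p by exact: powR_gt0.
have ab : 0 < a + curve_partner a by rewrite addr_gt0 //; lra.
have H := has_der_mul (has_der_id a)
  (has_der_inv (has_der_add (has_der_id a) (curve_partner_der a0)) (lt0r_neq0 ab)).
apply: (has_der_eq H); rewrite /curve_det.
by field; rewrite !gt_eqF //; lra.
Qed.

Lemma curve_fractionK a : 0 < a -> aa (curve_fraction a) = a.
Proof. by move=> a0; have [b1 e] := curve_partner_spec a0; have [] := curve_param a0 b1 e. Qed.

(** A second inversion passes from the parameter [a] to the fraction. *)
Lemma curve_lead_der al : 0 < al < 1 / 2 -> is_derive al 1 aa
  ((aa al `^ p + 1) * (aa al + bb al) ^+ 2 / curve_det (aa al) (bb al)).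
Proof.
move=> hal; have a0 := curve_lead_gt0 hal; have b1 := curve_lag_gt1 hal.
have w0 := curve_det_gt0 a0 b1 (curve_eq hal).
have s0 : 0 < aa al `^ p by exact: powR_gt0.
have e : curve_fraction (aa al) = al by rewrite /curve_fraction curve_partnerE // curve_fractionE.
have H := curve_fraction_der a0; rewrite curve_partnerE // in H.
have H' : is_derive (curve_fraction (aa al)) 1 aa
   (curve_det (aa al) (bb al) / ((aa al `^ p + 1) * (aa al + bb al) ^+ 2))^-1.
  apply: (@is_derive_inverse R curve_fraction).
  - near=> x; apply: curve_fractionK; near: x; exact: lt_nbhsr.
  - near=> x; apply: (has_der_continuous (curve_fraction_der _)); near: x; exact: lt_nbhsr.
  - by rewrite gt_eqF // divr_gt0 // mulr_gt0 ?exprn_gt0 //; lra.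
by rewrite e invf_div in H'.
Unshelve. all: by end_near. Qed.

Lemma near_in_oo x y z : x < y < z -> \forall t \near y, x < t < z.
Proof.
move=> /andP[xy yz]; near=> t; apply/andP; split; near: t.
  exact: lt_nbhsr.
exact: lt_nbhsl.
Unshelve. all: by end_near. Qed.

Lemma curve_lag_der al : 0 < al < 1 / 2 -> is_derive al 1 bb
  ((bb al `^ p - 1) * (aa al + bb al) ^+ 2 / curve_det (aa al) (bb al)).
Proof.
move=> hal; have a0 := curve_lead_gt0 hal; have b1 := curve_lag_gt1 hal.
have w0 := curve_det_gt0 a0 b1 (curve_eq hal).
have s0 : 0 < aa al `^ p by exact: powR_gt0.
have H := has_der_comp (curve_lead_der hal) (curve_partner_der a0).
apply: (@near_eq_is_derive _ _ _ (fun t => curve_partner (aa t))).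
  by apply: filterS (near_in_oo hal) => t; exact: curve_partnerE.
apply: (has_der_eq H); rewrite curve_partnerE //.
by field; rewrite !gt_eqF //; lra.
Qed.

End Curve.

(** * The rate function *)

Section Rate.
Context {R : realType}.
Variable p : R.
Hypothesis p_gt : 1 / 2 < p.
Implicit Types (r a b x y z al : R).
Local Notation aa := (curve_lead p).
Local Notation bb := (curve_lag p).
Local Notation zz := (curve_scale p).

(** Functions on [(0, 1/2)] built from the curve by arithmetic, powers and
    logarithms: since the curve solves an autonomous equation of this kind, the
    class is closed under differentiation. *)
Inductive elementary : (R -> R) -> Prop :=
| elementary_cst c : elementary (fun=> c)
| elementary_id : elementary id
| elementary_lead : elementary aa
| elementary_lag : elementary bb
| elementary_add f g : elementary f -> elementary g -> elementary (fun x => f x + g x)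
| elementary_mul f g : elementary f -> elementary g -> elementary (fun x => f x * g x)
| elementary_inv f : elementary f -> (forall x, 0 < x < 1 / 2 -> f x != 0) ->
    elementary (fun x => (f x)^-1)
| elementary_pow s f : elementary f -> (forall x, 0 < x < 1 / 2 -> 0 < f x) ->
    elementary (fun x => f x `^ s)
| elementary_ln f : elementary f -> (forall x, 0 < x < 1 / 2 -> 0 < f x) ->
    elementary (fun x => ln (f x)).

Lemma elementary_sub f g : elementary f -> elementary g -> elementary (fun x => f x - g x).
Proof.
move=> hf hg; have := elementary_add hf (elementary_mul (elementary_cst (- 1)) hg).
by congr elementary; apply/funext => x; rewrite mulN1r.
Qed.

Let lead_pos x : 0 < x < 1 / 2 -> 0 < aa x. Proof. exact: curve_lead_gt0. Qed.
Let lag_pos x : 0 < x < 1 / 2 -> 0 < bb x.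
Proof. by move=> /(curve_lag_gt1 p_gt); exact: lt_trans. Qed.

Lemma curve_det_pos x : 0 < x < 1 / 2 -> 0 < curve_det p (aa x) (bb x).
Proof.
move=> hx; exact: (curve_det_gt0 p_gt (curve_lead_gt0 p_gt hx) (curve_lag_gt1 p_gt hx) (curve_eq p_gt hx)).
Qed.

Lemma elementary_det : elementary (fun x => curve_det p (aa x) (bb x)).
Proof.
apply: elementary_sub; apply: elementary_mul.
- exact: elementary_lag.
- apply: elementary_add; last exact: elementary_cst.
  exact: (elementary_pow p elementary_lead lead_pos).
- exact: elementary_lead.
- apply: elementary_sub; last exact: elementary_cst.
  exact: (elementary_pow p elementary_lag lag_pos).
Qed.

Lemma elementary_der f : elementary f -> exists g, elementary g /\
  forall x, 0 < x < 1 / 2 -> is_derive x 1 f (g x).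
Proof.
have speed (h : R -> R) : elementary h ->
    elementary (fun x => h x * (aa x + bb x) ^+ 2 / curve_det p (aa x) (bb x)).
  move=> hh; apply: elementary_mul.
    apply: elementary_mul => //.
    by apply: elementary_mul; apply: elementary_add;
      (exact: elementary_lead || exact: elementary_lag).
  by apply: (elementary_inv elementary_det) => x /curve_det_pos; rewrite lt_neqAle eq_sym => /andP[].
elim=> {f} [c||||f g _ [f' [ef Hf]] _ [g' [eg Hg]]|f g hf [f' [ef Hf]] hg [g' [eg Hg]]
  |f hf [f' [ef Hf]] f0|s f hf [f' [ef Hf]] f0|f hf [f' [ef Hf]] f0].
- exists (fun=> 0); split; first exact: elementary_cst.
  by move=> x _; exact: has_der_cst.
- exists (fun=> 1); split; first exact: elementary_cst.
  by move=> x _; exact: has_der_id.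
- exists (fun x => (aa x `^ p + 1) * (aa x + bb x) ^+ 2 / curve_det p (aa x) (bb x)).
  split; last by move=> x; exact: curve_lead_der.
  apply: speed; apply: elementary_add; last exact: elementary_cst.
  exact: (elementary_pow p elementary_lead lead_pos).
- exists (fun x => (bb x `^ p - 1) * (aa x + bb x) ^+ 2 / curve_det p (aa x) (bb x)).
  split; last by move=> x; exact: curve_lag_der.
  apply: speed; apply: elementary_sub; last exact: elementary_cst.
  exact: (elementary_pow p elementary_lag lag_pos).
- exists (fun x => f' x + g' x); split; first exact: elementary_add.
  by move=> x hx; apply: has_der_add; [exact: Hf|exact: Hg].
- exists (fun x => f' x * g x + f x * g' x); split.
    by apply: elementary_add; exact: elementary_mul.
  by move=> x hx; apply: has_der_mul; [exact: Hf|exact: Hg].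
- exists (fun x => - 1 * f' x * ((f x)^-1 * (f x)^-1)); split.
    apply: elementary_mul; first by apply: elementary_mul => //; exact: elementary_cst.
    by apply: elementary_mul; exact: elementary_inv.
  move=> x hx; apply: (has_der_eq (has_der_inv (Hf _ hx) (f0 _ hx))).
  by field; exact: f0.
- exists (fun x => s * f x `^ (s - 1) * f' x); split.
    apply: elementary_mul => //; apply: elementary_mul; first exact: elementary_cst.
    exact: elementary_pow.
  by move=> x hx; exact: (has_der_pow s (Hf _ hx) (f0 _ hx)).
- exists (fun x => f' x * (f x)^-1); split.
    apply: elementary_mul => //; apply: elementary_inv => // x hx.
    by rewrite gt_eqF // f0.
  by move=> x hx; exact: (has_der_ln (Hf _ hx) (f0 _ hx)).
Qed.

Lemma elementary_derive1n n f : elementary f -> exists g, elementary g /\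
  forall x, 0 < x < 1 / 2 -> derive1n n f x = g x.
Proof.
move=> hf; elim: n => [|n [g [eg Hg]]]; first by exists f.
have [g' [eg' Hg']] := elementary_der eg.
exists g'; split=> // x hx; rewrite derive1nS.
have H : is_derive x 1 (derive1n n f) (g' x).
  apply: (near_eq_is_derive _ (Hg' _ hx)).
  by apply: filterS (near_in_oo hx) => t /Hg.
by rewrite derive1E derive_val.
Qed.

Lemma elementary_smooth f : elementary f -> smooth_on_oo 0 (1 / 2) f.
Proof.
move=> hf n x hx; have [g [eg Hg]] := elementary_derive1n n hf.
have [g' [_ Hg']] := elementary_der eg.
have [H _] : is_derive x 1 (derive1n n f) (g' x).
  apply: (near_eq_is_derive _ (Hg' _ hx)).
  by apply: filterS (near_in_oo hx) => t /Hg.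
exact: H.
Qed.

(** The exponent at the optimal tilt, where the clocks cancel and only the logarithms
    of the costs remain. *)
Definition rate (al : R) : R :=
  al * ln (1 + (aa al `^ p)^-1) + (1 - al) * ln (1 - (bb al `^ p)^-1).

Lemma rate_smooth : smooth_on_oo 0 (1 / 2) rate.
Proof.
apply: elementary_smooth; apply: elementary_add.
  apply: elementary_mul; first exact: elementary_id.
  apply: elementary_ln => [|x /lead_pos h]; last by rewrite addr_gt0 // invr_gt0 powR_gt0.
  apply: elementary_add; first exact: elementary_cst.
  apply: elementary_inv => [|x /lead_pos h]; last by rewrite gt_eqF // powR_gt0.
  exact: (elementary_pow p elementary_lead lead_pos).
apply: elementary_mul; first by apply: elementary_sub; [exact: elementary_cst|exact: elementary_id].
apply: elementary_ln => [|x hx].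
  apply: elementary_sub; first exact: elementary_cst.
  apply: elementary_inv => [|x /lag_pos h]; last by rewrite gt_eqF // powR_gt0.
  exact: (elementary_pow p elementary_lag lag_pos).
by have := powRp_gt1 p_gt (curve_lag_gt1 p_gt hx) => h; rewrite subr_gt0 invf_lt1 // (lt_trans ltr01).
Qed.

Lemma tilt_exponentE al z : 0 < z -> tilt_exponent p al z =
  al * ln (1 + ((al * z) `^ p)^-1) + (1 - al) * ln (1 - (((1 - al) * z) `^ p)^-1)
  - p / z * clock_defect p al z.
Proof. by move=> z0; rewrite /tilt_exponent /lead_cost /lag_cost /clock_defect; field; rewrite gt_eqF. Qed.

Lemma rate_tilt_exponent al : 0 < al < 1 / 2 -> rate al = tilt_exponent p al (zz al).
Proof.
move=> hal; have [h e] := curve_scale_spec p_gt hal.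
by rewrite tilt_exponentE ?curve_scale_gt0 // e mulr0 subr0.
Qed.

(** The envelope principle: only the explicit dependence on the fraction counts. *)
Lemma rate_der al : 0 < al < 1 / 2 -> is_derive al 1 rate
  (ln (1 + (aa al `^ p)^-1) - ln (1 - (bb al `^ p)^-1)).
Proof.
move=> hal; have a0 := curve_lead_gt0 p_gt hal; have b1 := curve_lag_gt1 p_gt hal.
have w0 := curve_det_pos hal; have s0 : 0 < aa al `^ p by exact: powR_gt0.
have s1 := powRp_gt1 p_gt b1; have b0 : 0 < bb al by exact: lt_trans b1.
have H1 := has_der_mul (has_der_id al) (has_der_comp (curve_lead_der p_gt hal) (ln_1Dinv_der p a0)).
have H2 := has_der_mul (has_der_sub (has_der_cst 1 al) (has_der_id al))
  (has_der_comp (curve_lag_der p_gt hal) (ln_1Binv_der p_gt b1)).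
apply: (has_der_eq (has_der_add H1 H2)).
have ea := esym (curve_fractionE p_gt hal).
set a := aa al in ea a0 s0 w0 *; set b := bb al in ea b1 b0 s1 w0 *.
set s := a `^ p in s0 *; set t := b `^ p in s1 *; set W := curve_det _ _ _ in w0 *.
set A := ln _; set B := ln _.
rewrite ea; field; rewrite !gt_eqF //; lra.
Qed.

Lemma rate_der_gt0 al : 0 < al < 1 / 2 -> 0 < ln (1 + (aa al `^ p)^-1) - ln (1 - (bb al `^ p)^-1).
Proof.
move=> hal; have a0 := curve_lead_gt0 p_gt hal; have b1 := curve_lag_gt1 p_gt hal.
have h1 : 0 < ln (1 + (aa al `^ p)^-1) by rewrite ln_gt0 // ltrDl invr_gt0 powR_gt0.
by have := ln_1Binv_le0 p b1; lra.
Qed.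

Lemma clock_defect_gt0 al z : 0 < al < 1 / 2 -> zz al < z -> 0 < clock_defect p al z.
Proof.
move=> hal hz; have [h e] := curve_scale_spec p_gt hal.
have z0 : 0 < z by apply: lt_trans hz; exact: curve_scale_gt0.
by have := scaled_defect_incr p_gt (half_lt1 hal) h hz; rewrite /scaled_defect e mulr0 (pmulr_rgt0 _ (powR_gt0 _ z0)).
Qed.

Lemma domain_up al x y : 0 < al < 1 -> 1 < (1 - al) * x -> x <= y -> 1 < (1 - al) * y.
Proof.
move=> /andP[h1 h2] hx xy; apply: (lt_le_trans hx); rewrite ler_wpM2l //; lra.
Qed.

(** Beyond its minimum the exponent increases strictly, and for large [z], that is for a
    vanishing tilt, it is at most the small term [al * ln (1 + (al z)^(- p))]. *)
Lemma rate_lt0 al : 0 < al < 1 / 2 -> rate al < 0.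
Proof.
move=> hal; rewrite rate_tilt_exponent //; have hal1 := half_lt1 hal.
have [h e] := curve_scale_spec p_gt hal; set z0 := zz al in h e *.
have dom z : z0 <= z -> 1 < (1 - al) * z by exact: domain_up.
have z00 : 0 < z0 by exact: curve_scale_gt0.
have p0 := p_gt0 p_gt.
have mono x y : z0 <= x -> x < y -> tilt_exponent p al x < tilt_exponent p al y.
  move=> hx xy; apply: (@has_der_lt R (tilt_exponent p al) (fun z => p / z ^+ 2 * clock_defect p al z)) => //.
    by move=> r /andP[xr _]; apply: tilt_exponent_der => //; apply: dom; exact: le_trans xr.
  move=> r /andP[xr _]; have zr : z0 < r by exact: le_lt_trans xr.
  by rewrite mulr_gt0 ?clock_defect_gt0 // divr_gt0 // exprn_gt0 // (lt_trans z00).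
have z01 : z0 < z0 + 1 by rewrite ltrDl.
apply: (lt_le_trans (mono _ _ (lexx _) z01)).
rewrite leNgt; apply/negP; set x := tilt_exponent _ _ _ => x0.
move/andP: hal1 => [al0 al1].
have [n0 Hn] := @powR_large R p (2 / x) p0.
(* Here the exponent is at most half of its value [x] at [z0 + 1], although it should
   be larger than [x]. *)
pose z := Num.max (n0%:R / al) (z0 + 2).
have zn : n0%:R <= al * z.
  by rewrite mulrC -ler_pdivrMr // le_max lexx.
have zz2 : z0 + 2 <= z by rewrite le_max lexx orbT.
have zz1 : z0 + 1 < z by apply: lt_le_trans zz2; rewrite ltrD2l ltr1n.
have zz0 : z0 < z by exact: lt_trans zz1.
have zpos : 0 < z by exact: lt_trans zz0.
have h1 := mono _ _ (ltW z01) zz1; rewrite -/x tilt_exponentE // in h1.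
have k0 : 0 <= p / z * clock_defect p al z by rewrite mulr_ge0 ?divr_ge0 ?(ltW p0) ?(ltW zpos) // ltW // clock_defect_gt0.
have k1 := ln_1Binv_le0 p (dom _ (ltW zz0)).
have az0 : 0 < al * z by rewrite mulr_gt0.
have s0 : 0 < (al * z) `^ p by exact: powR_gt0.
have k2 : ln (1 + ((al * z) `^ p)^-1) <= ((al * z) `^ p)^-1.
  by apply: (le_trans (ln_le_sub1 _)); rewrite ?addr_gt0 ?invr_gt0 // addrAC subrr add0r.
have k3 : ((al * z) `^ p)^-1 <= x / 2.
  have := Hn _ zn; rewrite ler_pdivrMr // => h2.
  rewrite -(ler_pM2r s0) mulVf ?gt_eqF //; clear -h2; lra.
have k4 : (1 - al) * ln (1 - (((1 - al) * z) `^ p)^-1) <= 0.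
  by rewrite pmulr_rle0 //; lra.
have k5 : al * ln (1 + ((al * z) `^ p)^-1) <= x / 2.
  apply: (le_trans _ k3); apply: (le_trans _ k2).
  by rewrite ler_piMl ?(ltW al1) // ln_1Dinv_ge0.
clear -h1 k0 k4 k5 x0; lra.
Qed.

Lemma curve_lead_incr x y : 0 < x -> x < y -> y < 1 / 2 -> aa x < aa y.
Proof.
move=> x0 xy y1; apply: (@has_der_lt R aa (fun x => (aa x `^ p + 1) * (aa x + bb x) ^+ 2 / curve_det p (aa x) (bb x))) => //.
  by move=> r /andP[xr ry]; apply: curve_lead_der => //; rewrite (lt_le_trans x0 xr) (le_lt_trans ry y1).
move=> r /andP[xr ry]; have hr : 0 < r < 1 / 2 by rewrite (lt_trans x0 xr) (lt_trans ry y1).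
by rewrite divr_gt0 ?curve_det_pos // mulr_gt0 ?exprn_gt0 ?addr_gt0 ?lead_pos ?lag_pos ?powR_gt0 ?lead_pos.
Qed.

Lemma curve_lag_incr x y : 0 < x -> x < y -> y < 1 / 2 -> bb x < bb y.
Proof.
move=> x0 xy y1; apply: (@has_der_lt R bb (fun x => (bb x `^ p - 1) * (aa x + bb x) ^+ 2 / curve_det p (aa x) (bb x))) => //.
  by move=> r /andP[xr ry]; apply: curve_lag_der => //; rewrite (lt_le_trans x0 xr) (le_lt_trans ry y1).
move=> r /andP[xr ry]; have hr : 0 < r < 1 / 2 by rewrite (lt_trans x0 xr) (lt_trans ry y1).
apply: divr_gt0; last exact: curve_det_pos.
apply: mulr_gt0; last by rewrite exprn_gt0 // addr_gt0 ?lead_pos ?lag_pos.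
by rewrite subr_gt0; apply: (powRp_gt1 p_gt); exact: curve_lag_gt1.
Qed.

End Rate.

(** * Sums against integrals *)

Section SumIntegral.
Context {R : realType}.
Implicit Types r s : R.

Lemma sum_between (g G : R -> R) (x n : nat) : (x <= n)%N ->
  (forall r, x%:R <= r -> is_derive r 1 G (g r)) ->
  (forall r s, x%:R <= r -> r <= s -> g s <= g r) -> (forall r, x%:R <= r -> 0 <= g r) ->
  G n%:R - G x%:R <= \sum_(x <= j < n) g j%:R <= g x%:R + (G n%:R - G x%:R).
Proof.
move=> xn dG mg g0.
have step m : (x <= m)%N -> g m.+1%:R <= G m.+1%:R - G m%:R <= g m%:R.
  move=> xm; have xmR : x%:R <= m%:R :> R by rewrite ler_nat.
  have mm : m%:R < m.+1%:R :> R by rewrite ltr_nat.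
  have D r : m%:R <= r <= m.+1%:R -> is_derive r 1 G (g r).
    by move=> /andP[h _]; apply: dG; exact: le_trans h.
  have [c [/andP[c1 c2] ->]] := mvt mm D.
  rewrite -natrB // subSnn mulr1; have xc : x%:R <= c by apply: le_trans (ltW c1).
  by rewrite mg ?(ltW c2) //= mg // ltW.
suff : G n%:R - G x%:R <= \sum_(x <= j < n) g j%:R <= g x%:R - g n%:R + (G n%:R - G x%:R).
  move=> /andP[-> h] /=; apply: (le_trans h); rewrite lerD2r gerBl.
  by apply: g0; rewrite ler_nat.
rewrite -(subnKC xn); elim: (n - x)%N => [|k IH].
  by rewrite addn0 big_geq // !subrr add0r lexx.
rewrite addnS big_nat_recr ?leq_addr //=.
have /andP[s1 s2] := step (x + k)%N (leq_addr _ _).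
by move/andP: IH => [i1 i2]; apply/andP; split; lra.
Qed.

Lemma combine_upper (A B a b c d l : R) : a - b <= A -> - B <= - l + (d - c) ->
  0 <= a + c -> - A - B <= b + d - l.
Proof. by lra. Qed.

Lemma combine_lower (A B a b c d l : R) : A <= l + (a - b) -> d - c <= - B ->
  a + c <= 1 -> b + d - l - 1 <= - A - B.
Proof. by lra. Qed.

End SumIntegral.

(** * The harmonic functions at the initial state *)

Section StateBounds.
Context {R : realType}.
Variable p : R.
Hypothesis p_gt : 1 / 2 < p.
Local Notation pow := (power_feedback p).
Implicit Types (u : nat * nat) (z r s : R).

Definition fraction (u : nat * nat) : R := u.1%:R / (u.1 + u.2)%:R.

(** The feedback of [t / z] balls, where [t] is the total of the state: the parameter
    [z] measures this total in units of the number of balls whose feedback is the tilt. *)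
Definition tilt (u : nat * nat) (z : R) : R := ((u.1 + u.2)%:R / z) `^ p.

Section OneTilt.
Variables (u : nat * nat) (z : R).
Hypotheses (u1 : (0 < u.1)%N) (u2 : (0 < u.2)%N).
Let al := fraction u.
Let t : R := (u.1 + u.2)%:R.
Let ze := t / z.
Hypothesis dom : 1 < (1 - al) * z.

Let t0 : 0 < t. Proof. by rewrite ltr0n addn_gt0 u1. Qed.

Lemma fraction_01 : 0 < al < 1.
Proof.
rewrite divr_gt0 ?ltr0n ?addn_gt0 ?u1 //= ltr_pdivrMr // mul1r ltr_nat.
by rewrite -[X in (X < _)%N]addn0 ltn_add2l.
Qed.

Let z0 : 0 < z. Proof. by have [] := domain_pos fraction_01 dom. Qed.

Let ze0 : 0 < ze. Proof. exact: divr_gt0. Qed.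

Lemma scaled1 : u.1%:R / ze = al * z.
Proof. by rewrite /ze /al /fraction -/t invf_div mulrA mulrAC. Qed.

Lemma scaled2 : u.2%:R / ze = (1 - al) * z.
Proof.
have -> : u.2%:R = t - u.1%:R by rewrite /t natrD addrC addKr.
rewrite /ze /al /fraction -/t invf_div mulrA mulrAC mulrBl divff //.
exact: lt0r_neq0.
Qed.

Lemma tilt_gt0 : 0 < tilt u z.
Proof. by rewrite powR_gt0. Qed.

Lemma tilt_div j : (0 < j)%N -> tilt u z / pow j = ((j%:R / ze) `^ p)^-1.
Proof.
move=> j0; have jR : 0 < j%:R :> R by rewrite ltr0n.
have -> : tilt u z = ze `^ p by [].
have e : j%:R = ze * (j%:R / ze) by rewrite mulrC divfK // gt_eqF.
have jz := ltW (divr_gt0 jR ze0).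
rewrite /power_feedback {1}e (powRM _ (ltW ze0) jz).
rewrite invfM mulrA divff ?mul1r //; exact: lt0r_neq0 (powR_gt0 _ ze0).
Qed.

Lemma tilt_lt j : (u.2 <= j)%N -> tilt u z < pow j.
Proof.
move=> uj; apply: powR_lt; [exact: p_gt0|exact: ltW|].
apply: (@lt_le_trans _ _ u.2%:R); last by rewrite ler_nat.
by rewrite -/t -/ze -(ltr_pM2r (_ : 0 < ze^-1)) ?invr_gt0 // divff ?gt_eqF // scaled2.
Qed.

Lemma scaled_der (F f : R -> R) r : is_derive (r / ze) 1 F (f (r / ze)) ->
  is_derive r 1 (fun r => ze * F (r / ze)) (f (r / ze)).
Proof.
move=> H; have H1 := has_der_mul (has_der_id r) (has_der_cst ze^-1 r).
apply: (has_der_eq (has_der_scale ze (has_der_comp H1 H))).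
by field; rewrite gt_eqF.
Qed.

Lemma log_sum_lead n : (u.1 <= n)%N ->
  ze * lead_cost p (n%:R / ze) - ze * lead_cost p (al * z) <= log_sum pow n (tilt u z) u.1 <=
  ln (1 + ((al * z) `^ p)^-1) + (ze * lead_cost p (n%:R / ze) - ze * lead_cost p (al * z)).
Proof.
move=> un; rewrite -scaled1.
have pos r : u.1%:R <= r -> 0 < r / ze.
  by move=> h; rewrite divr_gt0 // (lt_le_trans _ h) // ltr0n.
have := @sum_between R (fun r => ln (1 + ((r / ze) `^ p)^-1)) (fun r => ze * lead_cost p (r / ze)) _ _ un.
rewrite (_ : \sum_(u.1 <= j < n) _ = log_sum pow n (tilt u z) u.1); last first.
  by apply: eq_big_nat => j /andP[h _]; rewrite tilt_div // (leq_trans u1).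
apply.
- by move=> r /pos h; apply: (@scaled_der (lead_cost p) (fun r => ln (1 + (r `^ p)^-1))); exact: lead_cost_der.
- move=> r s hr rs; have r0 := pos _ hr; have s0 := pos _ (le_trans hr rs).
  rewrite ler_ln ?posrE ?addr_gt0 ?invr_gt0 ?powR_gt0 // lerD2l lef_pV2 ?posrE ?powR_gt0 //.
  by apply: powR_le; rewrite ?(ltW (p_gt0 p_gt)) // ler_pM2r ?invr_gt0.
- by move=> r /pos; exact: ln_1Dinv_ge0.
Qed.

Lemma log_sum_lag n : (u.2 <= n)%N ->
  ze * lag_cost p ((1 - al) * z) - ze * lag_cost p (n%:R / ze) <= - log_sum pow n (- tilt u z) u.2 <=
  - ln (1 - (((1 - al) * z) `^ p)^-1) + (ze * lag_cost p ((1 - al) * z) - ze * lag_cost p (n%:R / ze)).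
Proof.
move=> un; rewrite -scaled2.
have pos r : u.2%:R <= r -> 1 < r / ze.
  move=> h; apply: (lt_le_trans dom); rewrite -scaled2 ler_pM2r ?invr_gt0 //.
have := @sum_between R (fun r => - ln (1 - ((r / ze) `^ p)^-1)) (fun r => - (ze * lag_cost p (r / ze))) _ _ un.
rewrite (_ : \sum_(u.2 <= j < n) _ = - log_sum pow n (- tilt u z) u.2); last first.
  rewrite /log_sum -sumrN; apply: eq_big_nat => j /andP[h _].
  by rewrite mulNr tilt_div // (leq_trans u2).
rewrite opprK (addrC (- (ze * lag_cost p (n%:R / ze)))); apply.
- move=> r /pos h; apply: has_der_opp.
  by apply: (@scaled_der (lag_cost p) (fun r => ln (1 - (r `^ p)^-1))); exact: lag_cost_der.
- move=> r s hr rs; have r1 := pos _ hr; have s1 := pos _ (le_trans hr rs).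
  have rp := powRp_gt1 p_gt r1; have sp := powRp_gt1 p_gt s1.
  rewrite lerN2 ler_ln ?posrE ?subr_gt0 ?invf_lt1 ?(lt_trans ltr01) // lerD2l lerN2.
  rewrite lef_pV2 ?posrE ?(lt_trans ltr01) //.
  by apply: powR_le; rewrite ?(ltW (p_gt0 p_gt)) ?(lt_trans ltr01 r1) // ler_pM2r ?invr_gt0.
- by move=> r /pos h; rewrite oppr_ge0 ln_1Binv_le0.
Qed.

Lemma scaled_tilt_exponent :
  ze * (lead_cost p (al * z) + lag_cost p ((1 - al) * z)) = t * tilt_exponent p al z.
Proof. by rewrite /tilt_exponent /ze; field; rewrite gt_eqF. Qed.

(** The horizon contributes the sum of the costs at [n], which has the right sign. *)
Lemma log_harmonic_upper n : (u.1 + u.2 <= n)%N ->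
  log_harmonic pow n (tilt u z) u <= t * tilt_exponent p al z - ln (1 - (((1 - al) * z) `^ p)^-1).
Proof.
move=> un; have un1 : (u.1 <= n)%N by apply: leq_trans un; exact: leq_addr.
have un2 : (u.2 <= n)%N by apply: leq_trans un; exact: leq_addl.
have /andP[h1 _] := log_sum_lead un1; have /andP[_ h2] := log_sum_lag un2.
have n1 : 1 < n%:R / ze.
  by apply: (lt_le_trans dom); rewrite -scaled2 ler_pM2r ?invr_gt0 // ler_nat.
have h3 : 0 <= ze * (lead_cost p (n%:R / ze) + lag_cost p (n%:R / ze)).
  by rewrite mulr_ge0 ?(ltW ze0) // cost_sum_ge0.
have e := scaled_tilt_exponent; rewrite mulrDr in e; rewrite mulrDr in h3.
rewrite /log_harmonic opprD -e.
exact: (combine_upper h1 h2 h3).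
Qed.

(** For a large horizon the contribution of the costs at [n] is at most one. *)
Lemma log_harmonic_lower : exists n0 : nat, forall n, (n0 <= n)%N ->
  t * tilt_exponent p al z - ln (1 + ((al * z) `^ p)^-1) - 1 <= log_harmonic pow n (tilt u z) u.
Proof.
have [C [r0 [C0 r02 HC]]] := cost_sum_decay p_gt.
have q0 : 0 < 2 * p - 1 by move: p_gt; lra.
have [m Hm] := @powR_large R (2 * p - 1) (ze * C) q0.
exists (maxn (u.1 + u.2) (Num.truncn (ze * (Num.max r0 m%:R))).+1) => n.
rewrite geq_max => /andP[un nn].
have un1 : (u.1 <= n)%N by apply: leq_trans un; exact: leq_addr.
have un2 : (u.2 <= n)%N by apply: leq_trans un; exact: leq_addl.
have /andP[_ h1] := log_sum_lead un1; have /andP[h2 _] := log_sum_lag un2.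
have big : Num.max r0 m%:R <= n%:R / ze.
  rewrite ler_pdivlMr // mulrC; apply: (@le_trans _ _ (Num.truncn (ze * (Num.max r0 m%:R))).+1%:R).
    by rewrite ltW // truncnS_gt.
  by rewrite ler_nat.
move: big; rewrite ge_max => /andP[nr nm].
have /andP[_ h3] := HC _ nr.
have h4 : ze * (lead_cost p (n%:R / ze) + lag_cost p (n%:R / ze)) <= 1.
  have np : 0 < n%:R / ze.
    by apply: lt_le_trans nr; apply: lt_le_trans r02; exact: ltr0Sn.
  have pos := powR_gt0 (2 * p - 1) np.
  have := ler_wpM2l (ltW ze0) h3; rewrite (_ : 1 - 2 * p = - (2 * p - 1)); last ring.
  rewrite powRN mulrA => /le_trans; apply.
  by rewrite ler_pdivrMr // mul1r; exact: Hm.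
have e := scaled_tilt_exponent; rewrite mulrDr in e; rewrite mulrDr in h4.
rewrite /log_harmonic opprD -e.
exact: (combine_lower h1 h2 h4).
Qed.

End OneTilt.

End StateBounds.

(** * The minimum over the tilt is quadratic *)

Section QuadraticWell.
Context {R : realType}.
Implicit Types x y z : R.

(** A second-order expansion around the minimum, by two applications of the mean value
    theorem. The derivative is given as a product [v * J], because it is only after
    division by a positive factor [v] that it is increasing. *)
Lemma quadratic_well (L J v j : R -> R) (z0 h v0 v1 j0 j1 : R) :
  0 < h -> 0 < v0 -> 0 < j0 -> J z0 = 0 ->
  (forall z, z0 - 3 * h <= z <= z0 -> is_derive z 1 L (v z * J z)) ->
  (forall z, z0 - 3 * h <= z <= z0 -> is_derive z 1 J (j z)) ->
  (forall z, z0 - 3 * h <= z <= z0 -> v0 <= v z <= v1) ->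
  (forall z, z0 - 3 * h <= z <= z0 -> j0 <= j z <= j1) ->
  [/\ v0 * j0 * h ^+ 2 <= L (z0 - 2 * h) - L (z0 - h),
      L (z0 - 3 * h) - L (z0 - 2 * h) <= 3 * (v1 * j1) * h ^+ 2 &
      L z0 <= L (z0 - 2 * h)].
Proof.
move=> h0 v00 j00 Jz0 dL dJ vB jB.
have JB z : z0 - 3 * h <= z < z0 -> j0 * (z0 - z) <= - J z <= j1 * (z0 - z).
  move=> /andP[z3 zz]; have D x : z <= x <= z0 -> is_derive x 1 J (j x).
    by move=> /andP[zx xz]; apply: dJ; rewrite xz (le_trans z3 zx).
  have [c [/andP[c1 c2] e]] := mvt zz D.
  rewrite Jz0 sub0r in e; rewrite e.
  have hc : z0 - 3 * h <= c <= z0 by rewrite (ltW c2) (le_trans z3 (ltW c1)).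
  by rewrite !ler_pM2r ?subr_gt0 // jB.
have drop x y : z0 - 3 * h <= x -> x < y -> y <= z0 -> exists c, [/\ x < c, c < y &
    v0 * (j0 * (z0 - c)) * (y - x) <= L x - L y <= v1 * (j1 * (z0 - c)) * (y - x)].
  move=> x3 xy yz; have D z : x <= z <= y -> is_derive z 1 L (v z * J z).
    by move=> /andP[h1 h2]; apply: dL; rewrite (le_trans x3 h1) (le_trans h2 yz).
  have [c [/andP[c1 c2] e]] := mvt xy D.
  exists c; split => //.
  have cz : c < z0 by exact: lt_le_trans yz.
  have c3 : z0 - 3 * h <= c by apply: le_trans (ltW c1).
  have /andP[J1 J2] : j0 * (z0 - c) <= - J c <= j1 * (z0 - c) by apply: JB; rewrite c3.
  have /andP[V1 V2] : v0 <= v c <= v1 by apply: vB; rewrite c3 ltW.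
  have -> : L x - L y = v c * (- J c) * (y - x) by rewrite mulrN mulNr -e opprB.
  have zc : 0 < z0 - c by rewrite subr_gt0.
  have P1 : 0 <= j0 * (z0 - c) by rewrite mulr_ge0 // ltW.
  rewrite !ler_pM2r ?subr_gt0 //; apply/andP; split; apply: ler_pM => //.
  - exact: ltW.
  - exact: le_trans (ltW v00) V1.
  - exact: le_trans P1 J1.
have J1 : 0 <= j1.
  have /andP[a b] : j0 <= j z0 <= j1 by apply: jB; rewrite lexx andbT; clear -h0; lra.
  by apply: le_trans (ltW j00) (le_trans a b).
have V1 : 0 <= v1.
  have /andP[a b] : v0 <= v z0 <= v1 by apply: vB; rewrite lexx andbT; clear -h0; lra.
  by apply: le_trans (ltW v00) (le_trans a b).
split.
- have [|||c [c1 c2 /andP[l _]]] := drop (z0 - 2 * h) (z0 - h); try (clear -h0; lra).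
  apply: le_trans l; rewrite (_ : z0 - h - (z0 - 2 * h) = h); last ring.
  rewrite expr2 mulrA ler_pM2r // mulrA ler_pM2l ?mulr_gt0 //; clear -c2; lra.
- have [|||c [c1 c2 /andP[_ l]]] := drop (z0 - 3 * h) (z0 - 2 * h); try (clear -h0; lra).
  apply: (le_trans l); rewrite (_ : z0 - 2 * h - (z0 - 3 * h) = h); last ring.
  have -> : 3 * (v1 * j1) * h ^+ 2 = v1 * (j1 * (3 * h)) * h by ring.
  rewrite ler_pM2r //; apply: ler_wpM2l => //; apply: ler_wpM2l => //; clear -c1; lra.
- have [|||c [c1 c2 /andP[l _]]] := drop (z0 - 2 * h) z0; try (clear -h0; lra).
  rewrite -subr_ge0; apply: le_trans l.
  by rewrite !mulr_ge0 ?(ltW v00) ?(ltW j00) // subr_ge0; [exact: ltW|clear -h0; lra].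
Qed.

Lemma powR_bounds (r l h : R) : 0 < l -> exists c C, 0 < c /\
  forall x, l <= x <= h -> c <= x `^ r <= C.
Proof.
move=> l0; have [lh|hl] := leP l h; last first.
  exists 1, 1; split=> // x /andP[h1 h2].
  by have := le_lt_trans (le_trans h1 h2) hl; rewrite ltxx.
have h0 : 0 < h by exact: lt_le_trans lh.
have [r0|r0] := leP 0 r.
  exists (l `^ r), (h `^ r); split; first exact: powR_gt0.
  move=> x /andP[h1 h2]; rewrite powR_le //= powR_le //; exact: lt_le_trans h1.
exists (h `^ r), (l `^ r); split; first exact: powR_gt0.
have nr0 : 0 <= - r by rewrite oppr_ge0 ltW.
have neg x y : 0 < x -> x <= y -> y `^ r <= x `^ r.
  move=> x0 xy; rewrite -[r]opprK !(powRN _ (- r)) lef_pV2 ?posrE ?powR_gt0 //.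
    exact: powR_le.
  exact: lt_le_trans xy.
by move=> x /andP[h1 h2]; rewrite !neg // (lt_le_trans l0 h1).
Qed.

End QuadraticWell.

(** * Uniformity of the quadratic minimum *)

Section UniformWell.
Context {R : realType}.
Variable p : R.
Hypothesis p_gt : 1 / 2 < p.
Implicit Types (x y z al e : R).
Local Notation aa := (curve_lead p).
Local Notation bb := (curve_lag p).
Local Notation zz := (curve_scale p).

Lemma curve_lead_le x y : 0 < x -> x <= y -> y < 1 / 2 -> aa x <= aa y.
Proof.
by move=> x0; rewrite le_eqVlt => /orP[/eqP -> //|xy] y1; exact: ltW (curve_lead_incr p_gt x0 xy y1).
Qed.

Lemma curve_lag_le x y : 0 < x -> x <= y -> y < 1 / 2 -> bb x <= bb y.
Proof.
by move=> x0; rewrite le_eqVlt => /orP[/eqP -> //|xy] y1; exact: ltW (curve_lag_incr p_gt x0 xy y1).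
Qed.

Lemma clock_defect_scaled al z : 0 < z -> clock_defect p al z = z `^ (1 - p) * scaled_defect p al z.
Proof.
move=> z0; rewrite /scaled_defect mulrA -powRD; last by rewrite (gt_eqF z0) implybT.
by rewrite (_ : 1 - p + (p - 1) = 0) ?powRr0 ?mul1r //; ring.
Qed.

(** The coordinates of the curve increase with the fraction, so for [d1 <= al <= d2]
    they lie in the box spanned by the endpoints, and the factors of the derivatives
    are bounded above and away from zero on a neighbourhood of that box. *)
Lemma uniform_well d1 d2 : 0 < d1 -> d1 <= d2 -> d2 < 1 / 2 ->
  exists e0 k0 k1 a0 b0 : R, [/\ 0 < e0, 0 < k0, 0 < a0, 1 < b0 &
  forall al e, d1 <= al <= d2 -> 0 < e -> e <= e0 ->
   [/\ b0 <= (1 - al) * (zz al * (1 - 3 * e)), a0 <= al * (zz al * (1 - 3 * e)),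
       k0 * e ^+ 2 <= tilt_exponent p al (zz al * (1 - 2 * e)) - tilt_exponent p al (zz al * (1 - e)),
       tilt_exponent p al (zz al * (1 - 3 * e)) - tilt_exponent p al (zz al * (1 - 2 * e)) <= k1 * e ^+ 2 &
       rate p al <= tilt_exponent p al (zz al * (1 - 2 * e))]].
Proof.
move=> d10 d12 d21; have p0 := p_gt0 p_gt.
have hd1 : 0 < d1 < 1 / 2 by rewrite d10 (le_lt_trans d12 d21).
have hd2 : 0 < d2 < 1 / 2 by rewrite d21 (lt_le_trans d10 d12).
have am := curve_lead_gt0 p_gt hd1; have bm := curve_lag_gt1 p_gt hd1.
have aM := curve_lead_gt0 p_gt hd2; have bM := curve_lag_gt1 p_gt hd2.
have range al : d1 <= al <= d2 ->
    [/\ aa d1 <= aa al, aa al <= aa d2, bb d1 <= bb al & bb al <= bb d2].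
  move=> /andP[al1 al2]; have al0 := lt_le_trans d10 al1; have al3 := le_lt_trans al2 d21.
  by split; [exact: curve_lead_le|exact: curve_lead_le|exact: curve_lag_le|exact: curve_lag_le].
move: (aa d1) (bb d1) (aa d2) (bb d2) am bm aM bM range => am_ bm_ aM_ bM_ am bm aM bM range.
have bm0 : 0 < bm_ by clear -p_gt bm; lra.
(* Margins: on the interval explored, the second coordinate stays above [b0 > 1] and
   the first one above [a0 > 0]. *)
pose b0 := (1 + bm_) / 2; pose a0 := am_ / 2.
have b01 : 1 < b0 by rewrite /b0; clear -p_gt bm; lra.
have a00 : 0 < a0 by rewrite /a0 divr_gt0 // ltr0n.
pose zlo := am_ + bm_; pose zhi := aM_ + bM_.
have zlo0 : 0 < zlo by rewrite /zlo addr_gt0.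
have zl2 : 0 < zlo / 2 by rewrite divr_gt0 // ltr0n.
have [c1 [C1 [c10 HV]]] := @powR_bounds R (1 - p) (zlo / 2) zhi zl2.
have [c2 [C2 [c20 HZ]]] := @powR_bounds R (p - 1) (zlo / 2) zhi zl2.
have [c3 [C3 [c30 HI]]] := @powR_bounds R (- 1) (zlo / 2) zhi zl2.
pose g0 := p / ((aM_ + 1) `^ p + 1) ^+ 2; pose g1 := lag_moment p b0 - lead_moment p a0.
have g00 : 0 < g0 by rewrite /g0 divr_gt0 // exprn_gt0 // ltr_wpDl // powR_ge0.
pose v0 := p * (c3 * c3) * c1; pose v1 := p * (C3 * C3) * C1.
pose j0 := c2 * c3 * g0; pose j1 := C2 * C3 * g1.
have v00 : 0 < v0 by exact: (mulr_gt0 (mulr_gt0 p0 (mulr_gt0 c30 c30)) c10).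
have j00 : 0 < j0 by exact: (mulr_gt0 (mulr_gt0 c20 c30) g00).
(* The bound 1/6 keeps [z] above half of its optimal value, the other one keeps
   [(1 - al) * z] above [b0]. *)
pose e0 := Num.min (1 / 6) ((bm_ - 1) / (6 * bm_)).
exists e0, (v0 * j0 * zlo ^+ 2), (3 * `|v1 * j1| * zhi ^+ 2), a0, b0; split => //.
- by rewrite /e0 lt_min; apply/andP; split; [by rewrite divr_gt0 // ltr0n|rewrite divr_gt0 ?mulr_gt0 ?subr_gt0].
- exact: (mulr_gt0 (mulr_gt0 v00 j00) (exprn_gt0 2 zlo0)).
move=> al e al12 e_0 ee; have [aal aah bal bah] := range al al12.
move/andP: al12 => [al1 al2].
have hal : 0 < al < 1 / 2 by rewrite (lt_le_trans d10 al1) (le_lt_trans al2 d21).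
have hal1 := half_lt1 hal; have /andP[al0 al11] := hal1.
have e6 : e <= 1 / 6 by apply: (le_trans ee); rewrite ge_min lexx.
have eb : 3 * e * bm_ <= (bm_ - 1) / 2.
  have : e <= (bm_ - 1) / (6 * bm_) by apply: (le_trans ee); rewrite ge_min lexx orbT.
  by rewrite ler_pdivlMr ?mulr_gt0 //; clear -p_gt; lra.
have za := curve_scale_gt0 p_gt hal.
have zl : zlo <= zz al by rewrite -curve_sum lerD.
have zh : zz al <= zhi by rewrite -curve_sum lerD.
set z0 := zz al in za zl zh *.
have e3 : 1 / 2 <= 1 - 3 * e by clear -p_gt e6; lra.
have B3 : b0 <= (1 - al) * (z0 * (1 - 3 * e)).
  rewrite mulrA -/(bb al); apply: (@le_trans _ _ (bm_ * (1 - 3 * e))).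
    by rewrite /b0; clear -p_gt eb; lra.
  by apply: ler_wpM2r => //; clear -p_gt e3; lra.
have A3 : a0 <= al * (z0 * (1 - 3 * e)).
  rewrite mulrA -/(aa al); apply: (@le_trans _ _ (am_ * (1 - 3 * e))).
    by rewrite /a0; have := ler_wpM2l (ltW am) e3; clear -p_gt; lra.
  by apply: ler_wpM2r => //; clear -p_gt e3; lra.
pose h := z0 * e.
have h0 : 0 < h by rewrite mulr_gt0.
have E k : z0 * (1 - k * e) = z0 - k * h by rewrite /h; ring.
have E1 : z0 * (1 - e) = z0 - h by rewrite /h; ring.
rewrite !E E1; rewrite !E in B3 A3.
have al1' : 0 <= 1 - al by clear -p_gt al11; lra.
have inb z : z0 - 3 * h <= z -> b0 <= (1 - al) * z.
  by move=> zz3; apply: (le_trans B3); exact: ler_wpM2l.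
have ina z : z0 - 3 * h <= z -> a0 <= al * z.
  by move=> zz3; apply: (le_trans A3); apply: ler_wpM2l => //; exact: ltW.
have dom z : z0 - 3 * h <= z -> 1 < (1 - al) * z.
  by move=> zz3; exact: (lt_le_trans b01 (inb _ zz3)).
have zpos z : z0 - 3 * h <= z -> 0 < z.
  by move=> zz3; have [] := domain_pos hal1 (dom _ zz3).
have zin z : z0 - 3 * h <= z <= z0 -> zlo / 2 <= z <= zhi.
  move=> /andP[h1 h2]; rewrite (le_trans h2 zh) andbT; apply: le_trans h1; rewrite -E.
  by have := ler_pM (ltW zlo0) (_ : 0 <= 1 / 2) zl e3; clear -p_gt zl2; rewrite mul1r; apply; lra.
have [_ root] := curve_scale_spec p_gt hal.
have J0 : scaled_defect p al z0 = 0 by rewrite /scaled_defect root mulr0.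
have [||||Q1 Q2 Q3] := @quadratic_well R (tilt_exponent p al) (scaled_defect p al)
  (fun z => p * (z `^ (- 1) * z `^ (- 1)) * z `^ (1 - p))
  (fun z => z `^ (p - 1) * z `^ (- 1) * (lag_moment p ((1 - al) * z) - lead_moment p (al * z)))
  z0 h v0 v1 j0 j1 h0 v00 j00 J0.
- move=> z /andP[h1 h2]; have z_0 := zpos _ h1.
  apply: (has_der_eq (tilt_exponent_der p_gt hal1 (dom _ h1))).
  rewrite (clock_defect_scaled _ z_0) (powR_inv1 (ltW z_0)) mulrA; congr (_ * _ * _).
  by rewrite expr2 invfM.
- move=> z /andP[h1 h2]; have z_0 := zpos _ h1.
  apply: (has_der_eq (scaled_defect_der p_gt hal1 (dom _ h1))).
  by rewrite (powR_inv1 (ltW z_0)).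
- move=> z hz; have /andP[x1 x2] := HV _ (zin _ hz); have /andP[y1 y2] := HI _ (zin _ hz).
  have i0 : 0 <= z `^ (- 1) by exact: powR_ge0.
  rewrite /v0 /v1; apply/andP; split; apply: ler_pM => //; rewrite ?mulr_ge0 ?(ltW p0) ?(ltW c30) ?(ltW c10) ?powR_ge0 //.
    by rewrite ler_pM2l //; apply: ler_pM; rewrite ?(ltW c30).
  by rewrite ler_pM2l //; apply: ler_pM.
- move=> z hz; have /andP[x1 x2] := HZ _ (zin _ hz); have /andP[y1 y2] := HI _ (zin _ hz).
  move/andP: hz => [h1 h2]; have [_ az0] := domain_pos hal1 (dom _ h1).
  have i0 : 0 <= z `^ (- 1) by exact: powR_ge0.
  have gl : g0 <= lag_moment p ((1 - al) * z) - lead_moment p (al * z).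
    apply: le_trans (moment_gap_ge p_gt az0 (dom _ h1)).
    have azM : al * z <= aM_ by apply: le_trans aah; rewrite /curve_lead -/z0 ler_wpM2l // ltW.
    have S1 : 0 <= (al * z + 1) `^ p by exact: powR_ge0.
    have S2 : (al * z + 1) `^ p <= (aM_ + 1) `^ p.
      by apply: powR_le; [exact: ltW| |rewrite lerD2r]; rewrite // addr_gt0.
    rewrite /g0 ler_pM2l // lef_pV2 ?posrE ?exprn_gt0 //; clear -p_gt S1 S2; try lra.
    by rewrite ler_pXn2r ?nnegrE //; lra.
  have gu : lag_moment p ((1 - al) * z) - lead_moment p (al * z) <= g1.
    apply: lerB; first by apply: (lag_moment_nonincr p_gt b01); exact: inb.
    by apply: (lead_moment_nondecr p_gt a00); exact: ina.
  have gg : 0 <= lag_moment p ((1 - al) * z) - lead_moment p (al * z) by exact: le_trans (ltW g00) gl.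
  rewrite /j0 /j1; apply/andP; split.
    apply: (ler_pM (mulr_ge0 (ltW c20) (ltW c30)) (ltW g00) _ gl).
    exact: (ler_pM (ltW c20) (ltW c30) x1 y1).
  apply: (ler_pM (mulr_ge0 (powR_ge0 _ _) i0) gg _ gu).
  exact: (ler_pM (powR_ge0 _ _) i0 x2 y2).
have zz2 : zlo ^+ 2 <= z0 ^+ 2 by rewrite ler_pXn2r ?nnegrE ?(ltW zlo0) ?(ltW za).
have zz3 : z0 ^+ 2 <= zhi ^+ 2 by rewrite ler_pXn2r ?nnegrE ?(ltW za) // (le_trans (ltW za) zh).
have hh : h ^+ 2 = z0 ^+ 2 * e ^+ 2 by rewrite /h exprMn.
have e20 : 0 <= e ^+ 2 by rewrite sqr_ge0.
split => //.
- apply: le_trans Q1; rewrite hh mulrA; apply: ler_wpM2r => //.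
  by rewrite ler_pM2l // mulr_gt0.
- apply: (le_trans Q2); rewrite hh mulrA; apply: ler_wpM2r => //.
  apply: (@le_trans _ _ (3 * `|v1 * j1| * z0 ^+ 2)).
    by apply: ler_wpM2r; rewrite ?sqr_ge0 // ler_wpM2l // ler_norm.
  by apply: ler_wpM2l => //; rewrite mulr_ge0.
- by rewrite (rate_tilt_exponent p_gt hal).
Qed.

End UniformWell.

(** * Perturbing the tilt and the state *)

Section Scales.
Context {R : realType}.
Variable p : R.
Hypothesis p_gt : 1 / 2 < p.
Implicit Types (x y z t e : R).

Lemma cube_root t : 0 <= t -> (t `^ (1 / 3)) ^+ 3 = t.
Proof.
move=> t0; rewrite -powR_mulrn ?powR_ge0 // -powRrM.
by rewrite (_ : 1 / 3 * 3%:R = 1) ?powRr1 //; field.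
Qed.

Lemma cube_root_sqr t : 0 <= t -> (t `^ (1 / 3)) ^+ 2 = t `^ (2 / 3).
Proof.
move=> t0; rewrite -powR_mulrn ?powR_ge0 // -powRrM.
by congr (_ `^ _); field.
Qed.

(** Since [p > 1 / 2], the square root is the worst case. *)
Lemma powRp_1D_ge e : 0 <= e <= 1 -> 1 + e / 3 <= (1 + e) `^ p.
Proof.
move=> /andP[e0 e1]; apply: (@le_trans _ _ ((1 + e) `^ (1 / 2))); last first.
  by apply: ler_powR; [rewrite lerDl|exact: ltW].
rewrite div1r powR12_sqrt; last by rewrite addr_ge0.
have h : 0 <= 1 + e / 3 by rewrite addr_ge0 // divr_ge0.
rewrite -[leLHS]ger0_norm // -sqrtr_sqr ler_wsqrtr // expr2.
by have := mulr_ge0 e0 e0; have := ler_wpM2l e0 e1; clear -e0 e1; lra.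
Qed.

(** The tilt behaves like [z^(- p)], so a relative decrease of [z] by [e] raises it by a
    factor of at least [1 + e / 3]. *)
Lemma tilt_gap t z e : 0 < t -> 0 < z -> 0 < e -> e <= 1 -> 0 < 1 - 3 * e ->
  e * (t / (z * (1 - 2 * e))) `^ p <=
  3 * ((t / (z * (1 - 3 * e))) `^ p - (t / (z * (1 - 2 * e))) `^ p).
Proof.
move=> t0 z0 e0 e1 e3; set l2 := (t / (z * (1 - 2 * e))) `^ p.
set l3 := (t / (z * (1 - 3 * e))) `^ p.
have e2 : 0 < 1 - 2 * e by clear -e3 e0; lra.
have g2 : 0 < t / (z * (1 - 2 * e)) by rewrite divr_gt0 // mulr_gt0.
pose w := (1 - 2 * e) / (1 - 3 * e).
have wE : w = 1 + e / (1 - 3 * e) by rewrite /w; field; rewrite gt_eqF.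
have we : 1 + e <= w.
  by rewrite wE lerD2l ler_pdivlMr // ler_piMr ?(ltW e0) //; clear -e0; lra.
have w0 : 0 < w by rewrite divr_gt0.
have -> : l3 = l2 * w `^ p.
  rewrite /l3 /l2 -powRM ?(ltW g2) ?(ltW w0) //; congr (_ `^ _).
  by rewrite /w; field; rewrite !gt_eqF.
have l20 : 0 <= l2 by exact: powR_ge0.
have h : 1 + e / 3 <= w `^ p.
  apply: le_trans (powRp_1D_ge (_ : 0 <= e <= 1)) _; first by rewrite (ltW e0).
  by apply: powR_le => //; [exact: ltW (p_gt0 p_gt)|rewrite addr_gt0].
by have := ler_wpM2l l20 h; clear; lra.
Qed.

Lemma lag_correction_le x y : 1 < x -> x <= y ->
  - ln (1 - (y `^ p)^-1) <= - ln (1 - (x `^ p)^-1).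
Proof.
move=> x1 xy; have y1 : 1 < y by exact: lt_le_trans xy.
have xp := powRp_gt1 p_gt x1; have yp := powRp_gt1 p_gt y1.
have x0 : 0 < x by exact: lt_trans x1.
rewrite lerN2 ler_ln ?posrE ?subr_gt0 ?invf_lt1 ?(lt_trans ltr01) // lerD2l lerN2.
by rewrite lef_pV2 ?posrE ?(lt_trans ltr01) //; apply: powR_le => //; exact: ltW (p_gt0 p_gt).
Qed.

Lemma lead_correction_le x y : 0 < x -> x <= y ->
  ln (1 + (y `^ p)^-1) <= ln (1 + (x `^ p)^-1).
Proof.
move=> x0 xy; have y0 : 0 < y by exact: lt_le_trans xy.
rewrite ler_ln ?posrE ?addr_gt0 ?invr_gt0 ?powR_gt0 // lerD2l lef_pV2 ?posrE ?powR_gt0 //.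
by apply: powR_le => //; exact: ltW (p_gt0 p_gt).
Qed.

(** The derivative of the rate is nonincreasing, because both coordinates of the curve
    increase with the fraction; its value at the left end therefore controls the increment. *)
Lemma rate_shift x y : 0 < x -> x <= y -> y < 1 / 2 ->
  0 <= rate p y - rate p x <=
  (ln (1 + (curve_lead p x `^ p)^-1) - ln (1 - (curve_lag p x `^ p)^-1)) * (y - x).
Proof.
move=> x0; rewrite le_eqVlt => /orP[/eqP <- _|xy y1]; first by rewrite !subrr mulr0 lexx.
have D r : x <= r <= y -> is_derive r 1 (rate p)
    (ln (1 + (curve_lead p r `^ p)^-1) - ln (1 - (curve_lag p r `^ p)^-1)).
  by move=> /andP[xr ry]; apply: rate_der => //; rewrite (lt_le_trans x0 xr) (le_lt_trans ry y1).
have [c [/andP[c1 c2] ->]] := mvt xy D.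
have hc : 0 < c < 1 / 2 by rewrite (lt_trans x0 c1) (lt_trans c2 y1).
have hx : 0 < x < 1 / 2 by rewrite x0 (lt_trans xy y1).
have xy0 : 0 < y - x by rewrite subr_gt0.
apply/andP; split; first exact: ltW (mulr_gt0 (rate_der_gt0 p_gt hc) xy0).
rewrite (ler_pM2r xy0); apply: lerD.
  apply: (lead_correction_le (curve_lead_gt0 p_gt hx)).
  by apply: (curve_lead_le p_gt x0 (ltW c1)); case/andP: hc.
apply: (lag_correction_le (curve_lag_gt1 p_gt hx)).
by apply: (curve_lag_le p_gt x0 (ltW c1)); case/andP: hc.
Qed.

End Scales.

(** * Bounds at integer states *)

Section Assembly.
Context {R : realType} {d : measure_display} {T : measurableType d}.
Context {p : R} {Pr : nat * nat -> probability T R} {I : nat -> T -> nat * nat}.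
Hypothesis p_gt : 1 / 2 < p.
Hypothesis process : forall u : nat * nat, (0 < u.1)%N -> (0 < u.2)%N ->
  balls_in_bins (power_feedback p) (Pr u) I u.
Local Notation pow := (power_feedback p).
Local Notation fraction := (@fraction R).
Local Notation lead u := (fine (Pr u (ELead I))).
Local Notation total u := ((u.1 + u.2)%:R : R).

Lemma lead_upper u : (0 < u.1)%N -> (0 < u.2)%N -> 0 < fraction u < 1 / 2 ->
  lead u <= expR (total u * rate p (fraction u) - ln (1 - (curve_lag p (fraction u) `^ p)^-1)).
Proof.
move=> u1 u2 hal; have [dom _] := curve_scale_spec p_gt hal.
apply: (@ELead_upper R p d T (Pr u) I u (tilt p u (curve_scale p (fraction u)))) => //.
- exact: process.
- by rewrite ltW // tilt_gt0.
- by move=> j; exact: tilt_lt.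
- move=> n un; rewrite /harmonic_fun ler_expR (rate_tilt_exponent p_gt hal).
  exact: (log_harmonic_upper p_gt u1 u2 dom (ltnW un)).
Qed.

(** Take the tilts at [z (1 - e)], [z (1 - 2 e)], [z (1 - 3 e)] for the optimal [z].
    By the quadratic minimum they separate the exponents by [t e^2], which must exceed a
    constant for the first tilt to be negligible, while [V] has to be of order [t e^2]
    and costs [V / e = t e]. With [e = t^(-1/3)] both [t e^2 = t^(1/3)] is large and the
    total cost is [t^(2/3)]. *)
Lemma lead_lower d1 d2 : 0 < d1 -> d1 <= d2 -> d2 < 1 / 2 ->
  exists (C : R) (T0 : nat), 0 <= C /\ forall u, (0 < u.1)%N -> (0 < u.2)%N ->
    d1 <= fraction u <= d2 -> (T0 <= u.1 + u.2)%N ->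
    expR (total u * rate p (fraction u) - C * total u `^ (2 / 3)) <= lead u.
Proof.
move=> d10 d12 d21.
have [e0 [k0 [k1 [a0 [b0 [e00 k00 a00 b01 well]]]]]] := uniform_well p_gt d10 d12 d21.
have [q [q0 Hq]] := ELead_lower p_gt.
pose E := - ln (1 - (b0 `^ p)^-1); pose E' := ln (1 + (a0 `^ p)^-1) + 1.
have E_0 : 0 <= E by rewrite oppr_ge0 ln_1Binv_le0.
have E'0 : 0 <= E' by rewrite addr_ge0 // ln_1Dinv_ge0.
have third : 0 < 1 / 3 :> R by rewrite divr_gt0.
(* Beyond [m]: [e <= 1], [e <= e0], and [k0 t e^2] absorbs the errors and the factor 8. *)
have [m Hm] := @powR_large R (1 / 3) (Num.max 1 (Num.max e0^-1 ((E + E' + ln 8) / k0))) third.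
have l4 : 0 <= ln 4 :> R by rewrite ln_ge0 // ler1n.
pose C := 6 * (ln 4 + E + E') + 6 * `|k1| + E' + `|ln q|.
exists C, m; split.
  have s6 : 0 <= 6 * (ln 4 + E + E') by rewrite pmulr_rge0 //; exact: addr_ge0 (addr_ge0 l4 E_0) E'0.
  by rewrite addr_ge0 // (addr_ge0 _ E'0) // addr_ge0 // mulr_ge0.
move=> u u1 u2 hal mt.
have t0 : 0 < total u by rewrite ltr0n addn_gt0 u1.
have := Hm (total u); rewrite ler_nat => /(_ mt).
set t := total u in t0 *; set w := t `^ (1 / 3).
rewrite !ge_max => /andP[w1 /andP[we wk]].
have w0 : 0 < w by exact: lt_le_trans w1.
have tw : t = w ^+ 3 by rewrite cube_root // ltW.
rewrite -(cube_root_sqr (ltW t0)) -/w.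
pose e := w^-1.
have e_0 : 0 < e by rewrite invr_gt0.
have ee0 : e <= e0 by rewrite -[e0]invrK lef_pV2 ?posrE ?invr_gt0.
have e1 : e <= 1 by rewrite invf_le1.
have te2 : t * e ^+ 2 = w by rewrite tw /e; field; rewrite gt_eqF.
set al := fraction u in hal *.
have [B3 A3 gap21 gap32 rate2] := well al e hal e_0 ee0.
have hal2 : 0 < al < 1 / 2.
  by move/andP: hal => [h1 h2]; rewrite (lt_le_trans d10 h1) (le_lt_trans h2 d21).
have hal1 := half_lt1 hal2; have /andP[al0 al1] := hal1.
have al1' : 0 < 1 - al by rewrite subr_gt0.
have z0 := curve_scale_gt0 p_gt hal2; set z := curve_scale p al in z0 B3 A3 gap21 gap32 rate2.
have e3 : 0 < 1 - 3 * e.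
  have : 0 < (1 - al) * (z * (1 - 3 * e)) by apply: lt_le_trans B3; exact: lt_trans b01.
  by rewrite mulrA (pmulr_rgt0 _ (mulr_gt0 al1' z0)).
set z1 := z * (1 - e) in gap21; set z2 := z * (1 - 2 * e) in gap21 gap32 rate2.
set z3 := z * (1 - 3 * e) in B3 A3 gap32.
have z30 : 0 < z3 by rewrite mulr_gt0.
have z32 : z3 < z2 by rewrite ltr_pM2l //; clear -process p_gt e_0; lra.
have z21 : z2 < z1 by rewrite ltr_pM2l //; clear -process p_gt e_0; lra.
have z20 : 0 < z2 by exact: lt_trans z32.
have z10 : 0 < z1 by exact: lt_trans z21.
have B x : z3 <= x -> b0 <= (1 - al) * x by move=> h; apply: (le_trans B3); rewrite ler_pM2l.
have D x : z3 <= x -> 1 < (1 - al) * x by move=> /B; exact: lt_le_trans.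
have h2 := ltW z32; have h1 := le_trans h2 (ltW z21).
have lt_tilt x y : 0 < y -> y < x -> tilt p u x < tilt p u y.
  move=> y0 yx; have x0 := lt_trans y0 yx; apply: powR_lt; first exact: p_gt0.
    by rewrite divr_ge0 // ltW.
  by rewrite ltr_pM2l // ltf_pV2 ?posrE.
have u12 : (0 < u.1 < u.2)%N.
  rewrite u1 -(ltr_nat R); case/andP: hal2 => _; rewrite /al /fraction ltr_pdivrMr // natrD.
  by clear -process p_gt; lra.
pose V := ln 4 + `|k1| * w + (E + E').
have V0 : 0 <= V.
  exact: (addr_ge0 (addr_ge0 l4 (mulr_ge0 (normr_ge0 _) (ltW w0))) (addr_ge0 E_0 E'0)).
have up1 n : (u.1 + u.2 <= n)%N -> log_harmonic pow n (tilt p u z1) u <= t * tilt_exponent p al z1 + E.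
  move=> un; apply: (le_trans (log_harmonic_upper p_gt u1 u2 (D _ h1) un)).
  by rewrite lerD2l; exact: (lag_correction_le p_gt b01 (B _ h1)).
have up3 n : (u.1 + u.2 <= n)%N -> log_harmonic pow n (tilt p u z3) u <= t * tilt_exponent p al z3 + E.
  move=> un; apply: (le_trans (log_harmonic_upper p_gt u1 u2 (D _ (lexx _)) un)).
  by rewrite lerD2l; exact: (lag_correction_le p_gt b01 (B _ (lexx _))).
have [n0 lo2] := log_harmonic_lower p_gt u1 u2 (D _ h2).
have {}lo2 n : (n0 <= n)%N -> t * tilt_exponent p al z2 - E' <= log_harmonic pow n (tilt p u z2) u.
  move=> /lo2; apply: le_trans; rewrite -addrA lerD2l -opprD lerN2 lerD2r.
  by apply: (lead_correction_le p_gt a00); apply: (le_trans A3); rewrite ler_pM2l.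
have key := Hq d T (Pr u) I u (tilt p u z1) (tilt p u z2) (tilt p u z3) V
  (expR (t * rate p al - E')) (process u1 u2) u12 (tilt_gt0 p u1 u2 (D _ h1))
  (lt_tilt _ _ z20 z21) (lt_tilt _ _ z30 z32).
apply: le_trans (key _ _); last first.
- exists (maxn n0 (u.1 + u.2)) => n; rewrite geq_max => /andP[nn un].
  have L1 := up1 n un; have L3 := up3 n un; have L2 := lo2 n nn.
  have G21 := ler_wpM2l (ltW t0) gap21; have G32 := ler_wpM2l (ltW t0) gap32.
  rewrite mulrCA te2 mulrBr in G21; rewrite mulrCA te2 mulrBr in G32.
  rewrite (ler_pdivrMr _ _ k00) in wk.
  have ln4 : 4 = expR (ln 4) :> R by rewrite lnK // posrE.
  have ln8 : 8 = expR (ln 8) :> R by rewrite lnK // posrE.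
  have k1w : k1 * w <= `|k1| * w by rewrite ler_pM2r // ler_norm.
  rewrite /harmonic_fun; split.
  + rewrite {1}ln8 -expRD ler_expR; clear -process p_gt L1 L2 G21 wk; lra.
  + rewrite {1}ln4 -expRD -expRD ler_expR /V; clear -process p_gt L3 L2 G32 k1w; lra.
  + rewrite ler_expR; have := ler_wpM2l (ltW t0) rate2; clear -process p_gt L2; lra.
- by move=> j; apply: (tilt_lt p_gt u1 u2 (D _ (lexx _))).
have lq : q = expR (ln q) by rewrite lnK // posrE.
rewrite {1}lq -expRD -expRD ler_expR.
have l20 := tilt_gt0 p u1 u2 (D _ h2); have l23 := lt_tilt _ _ z30 z32.
have := tilt_gap p_gt t0 z0 e_0 e1 e3; rewrite -/z2 -/z3 -/(tilt p u z2) -/(tilt p u z3).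
set l2 := tilt p u z2 in l20 l23 *; set l3 := tilt p u z3 in l23 * => g.
(* The relative distance of the second and third tilt is at least [e / 3]. *)
have cost : V * (2 * l2) / (l3 - l2) <= V * (6 * w).
  rewrite -mulrA; apply: ler_wpM2l => //; rewrite ler_pdivrMr ?subr_gt0 //.
  have := ler_wpM2l (ltW w0) g; rewrite mulrA divff ?gt_eqF // mul1r; clear -process p_gt; lra.
have ww : w <= w ^+ 2 by rewrite expr2 ler_pMl.
have www : 1 <= w ^+ 2 by exact: le_trans ww.
have x1 := ler_wpM2l (_ : 0 <= 6 * (ln 4 + E + E')) ww.
have x2 : E' * 1 <= E' * w ^+ 2 by exact: ler_wpM2l.
have x3 : `|ln q| * 1 <= `|ln q| * w ^+ 2 by exact: ler_wpM2l.
have x4 := ler_norm (- ln q); rewrite normrN in x4.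
have {}x1 : 6 * (ln 4 + E + E') * w <= 6 * (ln 4 + E + E') * w ^+ 2.
  by apply: x1; rewrite pmulr_rge0 //; exact: addr_ge0 (addr_ge0 l4 E_0) E'0.
have x5 : V * (6 * w) = 6 * (ln 4 + E + E') * w + 6 * `|k1| * w ^+ 2 by rewrite /V; ring.
rewrite x5 in cost.
clear -process p_gt x1 x2 x3 x4 cost; rewrite /C; lra.
Qed.

End Assembly.

(** * Rounding and conclusion *)

Section Rounding.
Context {R : realType}.

Lemma split_stateP (t : nat) (a : R) : 0 < a < 1 / 2 -> (4 <= t)%N ->
  let u := split_state t a in
  [/\ (0 < u.1)%N, (0 < u.2)%N, (u.1 + u.2)%N = t & a * t%:R <= u.1%:R < a * t%:R + 1].
Proof.
move=> /andP[a0 a1] t4; rewrite /split_state; set k := `|_|%N => /=.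
have t4R : 4 <= t%:R :> R by rewrite ler_nat.
have t0 : 0 < t%:R :> R by apply: lt_le_trans t4R.
have at0 : 0 < a * t%:R by rewrite mulr_gt0.
have kE : k%:R = (Num.ceil (a * t%:R))%:~R :> R.
  have c0 : 0 <= Num.ceil (a * t%:R).
    by rewrite -(ler0z R) (le_trans (ltW at0)) // ceil_ge.
  by rewrite /k natr_absz ger0_norm.
have k1 : a * t%:R <= k%:R by rewrite kE; exact: ceil_ge.
have k2 : k%:R < a * t%:R + 1 by have := ceilB1_lt (a * t%:R); rewrite rmorphB /= -kE; clear; lra.
have at2 : a * t%:R < 1 / 2 * t%:R by rewrite ltr_pM2r.
have kt : (k < t)%N by rewrite -(ltr_nat R); lra.
split; rewrite ?k1 ?k2 ?subn_gt0 ?subnKC ?(ltnW kt) //.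
by rewrite -(ltr_nat R); apply: lt_le_trans k1.
Qed.

Lemma combine_errors (x y b C D E : R) : x - y <= D -> b <= E -> 0 <= C ->
  x + b <= y + (C + D + E).
Proof. by lra. Qed.

End Rounding.

Theorem theorem2 (R : realType) (d : measure_display) (T : measurableType d)
    (p : R) (Pr : nat * nat -> probability T R) (I : nat -> T -> nat * nat)
    (p_gt : 1 / 2 < p)
    (process : forall u : nat * nat, (0 < u.1)%N -> (0 < u.2)%N ->
       balls_in_bins (fun x : nat => x%:R `^ p) (Pr u) I u) :
  exists c : R -> R,
    [/\ forall a : R, 0 < a < 1 / 2 ->
          (fun t : nat => ln (fine (Pr (split_state t a) (ELead I))) / t%:R)
            @ \oo --> c a,
        forall a : R, 0 < a < 1 / 2 -> c a < 0,
        smooth_on_oo 0 (1 / 2) c,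
        forall a : R, 0 < a < 1 / 2 -> 0 < derive1 c a
      & forall delta : R, 0 < delta < 1 / 2 ->
          exists (C : R) (T0 : nat), [/\ 0 <= C, (0 < T0)%N &
            forall (a : R) (t : nat), delta < a < 1 / 2 - delta ->
              (T0 <= t)%N ->
              expR (c a * t%:R - C * t%:R `^ (2 / 3))
                <= fine (Pr (split_state t a) (ELead I))
                <= expR (c a * t%:R + C)]].
Proof.
have bounds (delta : R) : 0 < delta < 1 / 2 ->
    exists (C : R) (T0 : nat), [/\ 0 <= C, (0 < T0)%N &
      forall (a : R) (t : nat), delta < a < 1 / 2 - delta -> (T0 <= t)%N ->
        expR (rate p a * t%:R - C * t%:R `^ (2 / 3))
          <= fine (Pr (split_state t a) (ELead I)) <= expR (rate p a * t%:R + C)].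
  move=> /andP[de0 de1].
  (* Half of [delta] is kept in reserve for the rounding of the initial state. *)
  have d10 : 0 < delta / 2 by rewrite divr_gt0.
  have d12 : delta / 2 <= 1 / 2 - delta / 2 by lra.
  have d21 : 1 / 2 - delta / 2 < 1 / 2 by lra.
  have hd1 : 0 < delta / 2 < 1 / 2 by rewrite d10 (le_lt_trans d12 d21).
  have [C [T0 [C0 low]]] := lead_lower p_gt process d10 d12 d21.
  (* [E] bounds the error of the upper bound, [D] the derivative of the rate. *)
  pose E := - ln (1 - (curve_lag p (delta / 2) `^ p)^-1).
  pose D := ln (1 + (curve_lead p (delta / 2) `^ p)^-1) + E.
  have E0 : 0 <= E by rewrite oppr_ge0; apply: ln_1Binv_le0; exact: curve_lag_gt1.
  have D0 : 0 <= D by rewrite addr_ge0 // ln_1Dinv_ge0 // curve_lead_gt0.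
  pose T1 := (Num.truncn (2 / delta)).+1.
  exists (C + D + E), (maxn T0 (maxn 4 T1)); split.
  - exact: addr_ge0 (addr_ge0 C0 D0) E0.
  - by rewrite !leq_max orbT.
  move=> a t /andP[a1 a2]; rewrite !geq_max => /andP[tT /andP[t4 tT1]].
  have ha : 0 < a < 1 / 2 by apply/andP; split; lra.
  have [u1 u2 ut /andP[k1 k2]] := split_stateP ha t4.
  move: u1 u2 ut k1 k2; set u := split_state t a => u1 u2 ut k1 k2.
  have t0 : 0 < t%:R :> R by rewrite ltr0n; exact: leq_trans t4.
  have td : 2 / delta <= t%:R.
    by apply: (@le_trans _ _ T1%:R); [rewrite ltW // truncnS_gt|rewrite ler_nat].
  have {}td : 1 <= delta / 2 * t%:R.
    by move: td; rewrite ler_pdivrMr // => h; lra.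
  have fE : fraction u * t%:R = u.1%:R :> R by rewrite /fraction ut divfK ?gt_eqF.
  have f1 : a <= fraction u by rewrite -(ler_pM2r t0) fE.
  have f2 : fraction u <= a + delta / 2.
    by rewrite -(ler_pM2r t0) fE mulrDl; apply: (le_trans (ltW k2)); rewrite lerD2l.
  have hf : delta / 2 <= fraction u <= 1 / 2 - delta / 2 by apply/andP; split; lra.
  have hf2 : 0 < (fraction u : R) < 1 / 2.
    by move/andP: hf => [h1 h2]; rewrite (lt_le_trans d10 h1) (le_lt_trans h2 d21).
  have /andP[sh1 sh2] : 0 <= rate p (fraction u) - rate p a <= D * (fraction u - a).
    have a0 : 0 < a by case/andP: ha.
    have hx : a < 1 / 2 by case/andP: ha.
    have da : delta / 2 <= a by lra.
    have f3 : fraction u < 1 / 2 :> R by case/andP: hf2.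
    have /andP[r1 r2] := rate_shift p_gt a0 f1 f3.
    rewrite r1; apply: (le_trans r2); apply: ler_wpM2r; first by rewrite subr_ge0.
    apply: lerD; first by apply: (lead_correction_le p_gt); [exact: curve_lead_gt0|exact: curve_lead_le].
    by apply: (lag_correction_le p_gt); [exact: curve_lag_gt1|exact: curve_lag_le].
  have := low u u1 u2 hf; rewrite ut => /(_ tT) lo.
  have up := lead_upper p_gt process u1 u2 hf2; rewrite ut in up.
  apply/andP; split.
    apply: le_trans lo; rewrite ler_expR.
    have s1 : rate p a * t%:R <= t%:R * rate p (fraction u).
      rewrite [leLHS]mulrC; apply: (ler_wpM2l (ltW t0)); rewrite -subr_ge0; exact: sh1.
    have s2 : C * t%:R `^ (2 / 3) <= (C + D + E) * t%:R `^ (2 / 3).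
      exact: (ler_wpM2r (powR_ge0 _ _) (ler_wpDr E0 (ler_wpDr D0 (lexx C)))).
    exact: lerB s1 s2.
  apply: (le_trans up); rewrite ler_expR.
  have s1 : t%:R * (rate p (fraction u) - rate p a) <= D.
    apply: (@le_trans _ _ (t%:R * (D * (fraction u - a)))); first exact: (ler_wpM2l (ltW t0) sh2).
    have -> : t%:R * (D * (fraction u - a)) = D * (fraction u * t%:R - a * t%:R) by ring.
    by rewrite fE ler_piMr // lerBlDl ltW.
  have s2 : - ln (1 - (curve_lag p (fraction u) `^ p)^-1) <= E.
    apply: (lag_correction_le p_gt (curve_lag_gt1 p_gt hd1)); apply: (curve_lag_le p_gt d10).
      by case/andP: hf.
    by case/andP: hf2.
  rewrite mulrBr in s1.
  by rewrite [rate p a * _]mulrC; exact: (combine_errors s1 s2 C0).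
exists (rate p); split.
(* The limit follows from the two bounds, with [a] well inside [(de, 1/2 - de)]. *)
- move=> a ha; pose de : R := Num.min a (1 / 2 - a) / 2.
  have [a0 a1] := andP ha.
  have m0 : 0 < Num.min a (1 / 2 - a) by rewrite lt_min a0 subr_gt0.
  have ma : Num.min a (1 / 2 - a) <= a by rewrite ge_min lexx.
  have mb : Num.min a (1 / 2 - a) <= 1 / 2 - a by rewrite ge_min lexx orbT.
  have hde : 0 < de < 1 / 2 by rewrite /de; apply/andP; split; lra.
  have [C [T0 [C0 T00 HC]]] := bounds de hde.
  have hda : de < a < 1 / 2 - de by rewrite /de; apply/andP; split; lra.
  apply/cvgrPdist_le => /= e e0.
  have third : 0 < 1 / 3 :> R by rewrite divr_gt0.
  have [m Hm] := @powR_large R (1 / 3) (Num.max 1 (C / e)) third.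
  near=> t.
  have tT : (T0 <= t)%N by near: t; exact: nbhs_infty_ge.
  have tm : (m <= t)%N by near: t; exact: nbhs_infty_ge.
  have t0 : 0 < t%:R :> R by rewrite ltr0n; exact: leq_trans tT.
  have := Hm t%:R; rewrite ler_nat => /(_ tm); rewrite ge_max => /andP[w1 wC].
  have /andP[lo up] := HC a t hda tT.
  rewrite -(cube_root_sqr (ltW t0)) in lo; have tw := cube_root (ltW t0).
  set w := t%:R `^ (1 / 3) in w1 wC lo tw.
  have w0 : 0 < w by exact: lt_le_trans w1.
  set P := fine _ in lo up *.
  have P0 : 0 < P by apply: lt_le_trans lo; exact: expR_gt0.
  have l1 : rate p a * t%:R - C * w ^+ 2 <= ln P by rewrite -ler_expR lnK // posrE.
  have l2 : ln P <= rate p a * t%:R + C by rewrite -ler_expR lnK // posrE.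
  have w2 : 1 <= w ^+ 2 by rewrite exprn_ege1.
  have l3 : C <= C * w ^+ 2 by rewrite ler_peMr.
  have l4 : C * w ^+ 2 <= e * t%:R.
    have -> : e * t%:R = e * w * w ^+ 2 by rewrite -tw exprS mulrA.
    rewrite (ler_pM2r (exprn_gt0 2 w0)) mulrC -ler_pdivrMr //; exact: wC.
  rewrite -(ler_pM2r t0) -{2}(gtr0_norm t0) -normrM mulrBl divfK ?gt_eqF //.
  by rewrite ler_norml; apply/andP; split; lra.
- exact: rate_lt0.
- exact: rate_smooth.
- move=> a ha; have H := rate_der p_gt ha.
  by rewrite derive1E derive_val; exact: rate_der_gt0.
- exact: bounds.
Unshelve. all: by end_near.
Qed.
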